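(* Let $\triangleright:H\otimes B\to B$ be a measuring of a coquasi-bialgebra $(H,\phi)$ on a unital associative algebra $B$. Let $\gamma:H\otimes H\to B$ be a unital convolution-invertible map such that $$h\triangleright(g\triangleright b)=\gamma(h_{(1)},g_{(1)})\,\big((h_{(2)}g_{(2)})\triangleright b\big)\,\gamma^{-1}(h_{(3)},g_{(3)}),\qquad 1_H\triangleright b=b,$$ for all $h,g\in H$, $b\in B$. Then the vector space $B\otimes H\otimes B$ is a left $B$-coquasi-bialgebroid, with $B$-coalgebroid structure $$s(b)=b\otimes1\otimes1,\quad t(b)=1\otimes1\otimes b,\quad \Delta(b\otimes h\otimes b')=(b\otimes h_{(1)}\otimes 1)\otimes(1\otimes h_{(2)}\otimes b'),\quad \varepsilon(b\otimes h\otimes b')=bb'\varepsilon(h),$$ with (nonassociative unital) algebra structure $$(a\otimes h\otimes a')(b\otimes g\otimes b')=a(h_{(1)}\triangleright b)\gamma(h_{(2)},g_{(1)})\otimes h_{(3)}g_{(2)}\otimes\gamma^{-1}(h_{(4)},g_{(3)})(h_{(5)}\triangleright b')a',$$ for all $h,g\in H$, $a,a',b,b'\in B$, and with invertible normalised $3$-cocycle $\Phi^\gamma$ given by $$\begin{aligned}\Phi^{\gamma}(X,Y,Z)=\;&a(h_{(1)}\triangleright b)(h_{(2)}\triangleright(g_{(1)}\triangleright c))(h_{(3)}\triangleright\gamma(g_{(2)},f_{(1)}))\,\gamma(h_{(4)},g_{(3)}f_{(2)})\,\phi(h_{(5)},g_{(4)},f_{(3)})\\ &\gamma^{-1}(h_{(6)}g_{(5)},f_{(4)})\,\gamma^{-1}(h_{(7)},g_{(6)})\,(h_{(8)}\triangleright(g_{(7)}\triangleright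 c'))(h_{(9)}\triangleright b')a'\end{aligned}$$ for $X=a\otimes h\otimes a'$, $Y=b\otimes g\otimes b'$, $Z=c\otimes f\otimes c'$.
   Context: $k$ is a field, $B$ a unital associative $k$-algebra, $\overline{B}$ its opposite algebra with the antiisomorphism $b\mapsto\overline{b}$, and $B^e=B\otimes\overline{B}$. $B$ is a left $B^e$-module by $(b\overline{c})\cdot a=bac$. Coquasi-bialgebra: a coalgebra $H$ over $k$ with a unital, not necessarily associative algebra structure whose product and unit are coalgebra morphisms, together with a convolution-invertible linear map $\phi:H\otimes H\otimes H\to k$ such that for all $h,g,f,l\in H$: (1) $\phi(h,1,g)=\varepsilon(hg)$; (2) $\phi(h_{(1)},g_{(1)},f_{(1)}l_{(1)})\phi(h_{(2)}g_{(2)},f_{(2)},l_{(2)})=\phi(g_{(1)},f_{(1)},l_{(1)})\phi(h_{(1)},g_{(2)}f_{(2)},l_{(2)})\phi(h_{(2)},g_{(3)},f_{(3)})$; (3) $\phi(h_{(1)},g_{(1)},f_{(1)})(h_{(2)}g_{(2)})f_{(2)}=h_{(1)}(g_{(1)}f_{(1)})\phi(h_{(2)},g_{(2)},f_{(2)})$. Measuring: a linear map $\triangleright:H\otimes B\to B$ with $h\triangleright(ab)=(h_{(1)}\triangleright a)(h_{(2)}\triangleright b)$ and $h\triangleright1_B=\varepsilon(h)1_B$. The map $\gamma$ is unital if $\gamma(1,h)=\gamma(h,1)=\varepsilon(h)1_B$; $\gamma^{-1}$ is its convolution inverse in $\mathrm{Hom}(H\otimes H,B)$. For $B^e$-bimodules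 $M,N$: $M\diamond_B N:=M\otimes N/\langle \overline{b}m\otimes n-m\otimes bn\rangle$, and the Takeuchi product $M\times_B N\subseteq M\diamond_B N$ consists of the elements $\sum_i m_i\otimes n_i$ with $\sum_i m_i\overline{b}\otimes n_i=\sum_i m_i\otimes n_i b$ for all $b\in B$; $B^e$ acts on it from the left by $b\overline{c}(m\otimes n)=bm\otimes\overline{c}n$. The triple product $M\times_B P\times_B N$ is defined analogously: take the quotient of $M\otimes P\otimes N$ by $\overline{b}m\otimes p\otimes n=m\otimes bp\otimes n$ and $m\otimes\overline{b}p\otimes n=m\otimes p\otimes bn$, and the elements invariant in the sense $\sum m\overline{b}\otimes p\otimes n=\sum m\otimes pb\otimes n$, $\sum m\otimes p\overline{b}\otimes n=\sum m\otimes p\otimes nb$. A left $B$-coalgebroid ($\times_B$-coalgebra) is a $B^e$-bimodule $\mathcal{L}$ with left $B^e$-module maps $\Delta:\mathcal{L}\to\mathcal{L}\times_B\mathcal{L}$, $\Delta(X)=X_{(1)}\otimes X_{(2)}$, and $\varepsilon:\mathcal{L}\to B$, such that $\Delta$ is coassociative (the two iterated coproducts agree in $\mathcal{L}\times_B\mathcal{L}\times_B\mathcal{L}$) and $\varepsilon(X_{(1)})X_{(2)}=X=\overline{\varepsilon(X_{(2)})}X_{(1)}$. In the claim the displayed coproduct takes values in $\mathcal L\times_B\mathcal L\subseteq\mathcal L\diamond_B\mathcal L$ for $\mathcal L=B\otimes H\otimes B$. A left $B$-coquasi-bialgebroid is a unital, not necessarily associative algebra $\mathcal{L}$ with algebra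 maps $s:B\to\mathcal{L}$, $t:\overline{B}\to\mathcal{L}$ with commuting images, which is also a left $B$-coalgebroid for the $B^e$-bimodule structure given by multiplication with $s,t$ (write $bX=s(b)X$, $\overline{b}X=t(b)X$, $Xb=Xs(b)$, $X\overline{b}=Xt(b)$), such that: (i) $\Delta:\mathcal{L}\to\mathcal{L}\times_B\mathcal{L}$ is an algebra map (factorwise product on the target). (ii) $\varepsilon(1)=1_B$ and $\varepsilon(X\varepsilon(Y))=\varepsilon(XY)=\varepsilon(X\overline{\varepsilon(Y)})$. (iii) There is a convolution-invertible $\Phi\in\mathrm{Hom}_{B^e-}(\mathcal{L}\otimes_{B^e}\mathcal{L}\otimes_{B^e}\mathcal{L},B)$ (an invertible normalised $3$-cocycle) such that for all $X,Y,Z,W\in\mathcal{L}$, $b\in B$: (1) $\Phi(1,X,Y)=\Phi(X,1,Y)=\Phi(X,Y,1)=\varepsilon(XY)$; (2) $\Phi(X,Y,Zb)=\Phi(X,Y,Z\overline{b})$; (3) $\Phi(X_{(1)},Y_{(1)},Z_{(1)}W_{(1)})\Phi(X_{(2)}Y_{(2)},Z_{(2)},W_{(2)})=\Phi(X_{(1)},\Phi(Y_{(1)},Z_{(1)},W_{(1)})Y_{(2)}Z_{(2)},W_{(2)})\Phi(X_{(2)},Y_{(3)},Z_{(3)})$; (4) $\Phi(X_{(1)},Y_{(1)},Z_{(1)})\,(X_{(2)}Y_{(2)})Z_{(2)}=\overline{\Phi(X_{(2)},Y_{(2)},Z_{(2)})}\,X_{(1)}(Y_{(1)}Z_{(1)})$.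 Here $\mathrm{Hom}_{B^e-}$ denotes left $B^e$-linear maps, and convolution is $(f\star g)(X,Y,Z)=f(X_{(1)},Y_{(1)},Z_{(1)})g(X_{(2)},Y_{(2)},Z_{(2)})$ with unit $\varepsilon(XYZ):=\varepsilon((XY)Z)=\varepsilon(X(YZ))$. *)

(* Defs.v *)
From HB Require Import structures.
From mathcomp Require Import all_boot all_algebra.
From mathcomp Require Import generic_quotient boolp.
From mathcomp.multinomials Require freeg.

Set Implicit Arguments.
Unset Strict Implicit.
Unset Printing Implicit Defensive.

Import GRing.Theory.
Local Open Scope ring_scope.
Local Open Scope quotient_scope.


Section Quotient.
Variables (k : fieldType) (V : lmodType k) (S : V -> Prop).

Inductive span : V -> Prop :=
| span0 : span 0
| spanS a x v : S x -> span v -> span (a *: x + v).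

Lemma span_gen x : S x -> span x.
Proof. by move=> Sx; rewrite -[x]addr0 -[x]scale1r; apply: spanS span0. Qed.

Lemma spanD u v : span u -> span v -> span (u + v).
Proof.
by elim=> [|a x w Sx _ IH] sv; rewrite ?add0r // -addrA; apply/spanS/IH.
Qed.

Lemma spanZ a v : span v -> span (a *: v).
Proof.
elim=> [|b x w Sx _ IH]; first by rewrite scaler0; apply: span0.
by rewrite scalerDr scalerA; apply: spanS.
Qed.

Definition eqv (x y : V) : bool := `[< span (x - y) >].

Lemma eqv_equiv : equiv_class_of eqv.
Proof.
split=> [x|x y|y x z].
- by apply/asboolP; rewrite subrr; apply: span0.
- by apply: asbool_equiv_eq; split=> h; rewrite -opprB -scaleN1r; apply: spanZ.
move=> /asboolP xy /asboolP yz; apply/asboolP.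
by rewrite -[x](subrK y) -addrA; apply: spanD.
Qed.

Canonical eqv_equivRel := EquivRelPack eqv_equiv.
Canonical eqv_encModRel := defaultEncModRel eqv.

Definition quot := {eq_quot eqv}.
HB.instance Definition _ : EqQuotient V eqv quot := EqQuotient.on quot.
HB.instance Definition _ := Choice.on quot.

Lemma quotE (x y : V) : (\pi_quot x = \pi_quot y) <-> span (x - y).
Proof. by split=> [/eqP|h]; [rewrite piE => /asboolP|apply/eqP; rewrite piE; apply/asboolP]. Qed.

Definition qzero : quot := lift_cst quot 0.
Definition qadd := lift_op2 quot +%R.
Definition qopp := lift_op1 quot -%R.
Definition qscale (a : k) := lift_op1 quot ( *:%R a).

Canonical pi_qzero_morph := PiConst qzero.

Lemma pi_qopp : {morph \pi_quot : x / - x >-> qopp x}.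
Proof.
move=> x; unlock qopp; apply/quotE.
by rewrite -opprD -[- (_ + _)]scaleN1r; apply: spanZ; apply/quotE; rewrite reprK.
Qed.
Canonical pi_qopp_morph := PiMorph1 pi_qopp.

Lemma pi_qscale a : {morph \pi_quot : x / a *: x >-> qscale a x}.
Proof.
move=> x; unlock qscale; apply/quotE.
by rewrite -scalerBr; apply: spanZ; apply/quotE; rewrite reprK.
Qed.
Canonical pi_qscale_morph a := PiMorph1 (pi_qscale a).

Lemma pi_qadd : {morph \pi_quot : x y / x + y >-> qadd x y}.
Proof.
move=> x y; unlock qadd; apply/quotE.
by rewrite opprD addrACA; apply: spanD; apply/quotE; rewrite reprK.
Qed.
Canonical pi_qadd_morph := PiMorph2 pi_qadd.

Lemma qaddA : associative qadd.
Proof. by move=> x y z; rewrite -[x]reprK -[y]reprK -[z]reprK !piE addrA. Qed.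
Lemma qaddC : commutative qadd.
Proof. by move=> x y; rewrite -[x]reprK -[y]reprK !piE addrC. Qed.
Lemma qadd0 : left_id qzero qadd.
Proof. by move=> x; rewrite -[x]reprK !piE add0r. Qed.
Lemma qaddN : left_inverse qzero qopp qadd.
Proof. by move=> x; rewrite -[x]reprK !piE addNr. Qed.
HB.instance Definition _ := GRing.isZmodule.Build quot qaddA qaddC qadd0 qaddN.

Lemma qscaleA a b x : qscale a (qscale b x) = qscale (a * b) x.
Proof. by rewrite -[x]reprK !piE scalerA. Qed.
Lemma qscale1 : left_id 1 qscale.
Proof. by move=> x; rewrite -[x]reprK !piE scale1r. Qed.
Lemma qscaleDr : right_distributive qscale +%R.
Proof.
by move=> a x y; rewrite -[x]reprK -[y]reprK /GRing.add /= !piE scalerDr.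
Qed.
Lemma qscaleDl x : {morph qscale^~ x : a b / a + b}.
Proof.
by move=> a b; rewrite -[x]reprK /GRing.add /= -[in LHS]/(GRing.add a b) !piE scalerDl.
Qed.
HB.instance Definition _ :=
  GRing.Zmodule_isLmodule.Build k quot qscaleA qscale1 qscaleDr qscaleDl.

Definition qpi (v : V) : quot := \pi_quot v.

Lemma qpi_linear : linear qpi.
Proof. by move=> a x y; rewrite /qpi pi_qadd pi_qscale. Qed.
HB.instance Definition _ := GRing.isLinear.Build k V quot _ qpi qpi_linear.

Lemma qpi_rel x : S x -> qpi x = 0.
Proof.
move=> Sx; rewrite -(linear0 qpi); apply/quotE.
by rewrite subr0; apply: span_gen.
Qed.

Lemma qpi_surj (y : quot) : exists x, y = qpi x.
Proof. by exists (repr y); rewrite /qpi reprK. Qed.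

Section Lift.
Variables (W : lmodType k) (f : {linear V -> W}).
Hypothesis f0 : forall x, S x -> f x = 0.

Definition qlift (y : quot) : W := f (repr y).

Lemma qliftE x : qlift (qpi x) = f x.
Proof.
suff h v : span v -> f v = 0.
  apply/eqP; rewrite -subr_eq0 -linearB; apply/eqP/h.
  by apply/quotE; rewrite reprK.
elim=> [|a y w Sy _ IH]; first exact: linear0.
by rewrite linearP f0 // IH scaler0 addr0.
Qed.

Lemma qlift_linear : linear qlift.
Proof.
move=> a x y; have [[u ->] [v ->]] := (qpi_surj x, qpi_surj y).
by rewrite -linearP !qliftE linearP.
Qed.
End Lift.

End Quotient.


Module Tensor.
Import freeg.

Section Def.
Variables (k : fieldType) (U V : lmodType k).

Local Notation free := {freeg (U * V)%type / k}.
Local Notation gen u v := (<< 1 *g (u, v) >> : free).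

Inductive rel : free -> Prop :=
| addl u u' v : rel (gen (u + u') v - gen u v - gen u' v)
| addr u v v' : rel (gen u (v + v') - gen u v - gen u v')
| scalel a u v : rel (gen (a *: u) v - a *: gen u v)
| scaler a u v : rel (gen u (a *: v) - a *: gen u v).

Definition type : Type := quot rel.
#[export] HB.instance Definition _ := GRing.Lmodule.on type.

Definition pure (u : U) (v : V) : type := qpi rel (gen u v).

Lemma pureDl u u' v : pure (u + u') v = pure u v + pure u' v.
Proof.
apply/eqP; rewrite -subr_eq0 opprD addrA -!linearB; apply/eqP.
exact/qpi_rel/addl.
Qed.

Lemma pureDr u v v' : pure u (v + v') = pure u v + pure u v'.
Proof.
apply/eqP; rewrite -subr_eq0 opprD addrA -!linearB; apply/eqP.
exact/qpi_rel/addr.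
Qed.

Lemma pureZl a u v : pure (a *: u) v = a *: pure u v.
Proof.
apply/eqP; rewrite -subr_eq0 -linearZ -linearB; apply/eqP.
exact/qpi_rel/scalel.
Qed.

Lemma pureZr a u v : pure u (a *: v) = a *: pure u v.
Proof.
apply/eqP; rewrite -subr_eq0 -linearZ -linearB; apply/eqP.
exact/qpi_rel/scaler.
Qed.

Lemma span_pure (t : type) : exists s : seq (U * V), t = \sum_(p <- s) pure p.1 p.2.
Proof.
have [D ->] := qpi_surj t; exists [seq (coeff z D *: z.1, z.2) | z <- dom D].
rewrite big_map -{1}[D]freeg_sumE linear_sum; apply: eq_bigr => -[u v] _ /=.
rewrite pureZl -linearZ; congr (qpi _ _).
by apply/eqP/freeg_eqP => x; rewrite coeffZ !coeffU mul1r.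
Qed.

Section Lift.
Variables (W : lmodType k) (f : U -> V -> W).
Hypotheses (fDl : forall u u' v, f (u + u') v = f u v + f u' v)
  (fDr : forall u v v', f u (v + v') = f u v + f u v')
  (fZl : forall a u v, f (a *: u) v = a *: f u v)
  (fZr : forall a u v, f u (a *: v) = a *: f u v).

Let F (D : free) : W := fglift (fun p => f p.1 p.2) D.

Let F_linear : linear F.
Proof.
have FB x y : F (x - y) = F x - F y by apply: lift_is_additive.
have F0 : F 0 = 0 by rewrite -(subrr 0) FB subrr.
have FN x : F (- x) = - F x by rewrite -[- x]sub0r FB F0 sub0r.
have FD x y : F (x + y) = F x + F y by rewrite -[y in LHS]opprK FB FN opprK.
have FZ a x : F (a *: x) = a *: F x.
  have FS (I : Type) (r : seq I) (G : I -> free) :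
      F (\sum_(i <- r) G i) = \sum_(i <- r) F (G i).
    by elim: r => [|i r IH]; rewrite ?big_nil ?F0 // !big_cons FD IH.
  rewrite -[in RHS](freeg_sumE x) -[in LHS](freeg_sumE x) scaler_sumr !FS.
  rewrite scaler_sumr; apply: eq_bigr => z _.
  have -> : a *: << coeff z x *g z >> = << a * coeff z x *g z >> :> free.
    by apply/eqP/freeg_eqP => y; rewrite coeffZ !coeffU mulrA.
  by rewrite /F !liftU scalerA.
by move=> a x y; rewrite FD FZ.
Qed.

HB.instance Definition _ := GRing.isLinear.Build k free W _ F F_linear.

Let FE u v : F (gen u v) = f u v.
Proof. by rewrite /F liftU scale1r. Qed.

Let F_rel D : rel D -> F D = 0.
Proof.
have FZ a x : F (a *: x) = a *: F x by exact: linearZ.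
case=> [x x' y|x y y'|a x y|a x y]; rewrite !linearB /= ?FZ !FE.
- by rewrite fDl -addrA -opprD subrr.
- by rewrite fDr -addrA -opprD subrr.
- by rewrite fZl subrr.
- by rewrite fZr subrr.
Qed.

Lemma lift_ex : exists g : {linear type -> W}, forall u v, g (pure u v) = f u v.
Proof.
pose m := GRing.isLinear.Build k type W _ (qlift F) (qlift_linear F_rel).
pose g : {linear type -> W} := HB.pack (qlift F : type -> W) m.
by exists g => u v; apply: etrans (FE u v); apply/qliftE/F_rel.
Qed.
End Lift.
End Def.

Module Exports. HB.reexport. End Exports.
End Tensor.
Export Tensor.Exports.

Notation tens := Tensor.type.
Notation tensor := Tensor.pure.
Notation "U ⨂ V" := (tens U V) (at level 40, left associativity).
Notation "u ⊗ v" := (tensor u v) (at level 40, left associativity).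

(* A finite family of elementary tensors with sum t. *)
Definition tens_rep (k : fieldType) (U V : lmodType k) (t : U ⨂ V) :
  seq (U * V) := projT1 (cid (Tensor.span_pure t)).

Lemma tens_repE (k : fieldType) (U V : lmodType k) (t : U ⨂ V) :
  t = \sum_(p <- tens_rep t) p.1 ⊗ p.2.
Proof. by rewrite /tens_rep; case: cid. Qed.

Lemma tens_ind (k : fieldType) (U V : lmodType k) (P : U ⨂ V -> Prop) :
  (forall x y, P x -> P y -> P (x + y)) -> (forall u v, P (u ⊗ v)) ->
  forall t, P t.
Proof.
move=> PD Pp t; rewrite (tens_repE t); apply: (big_ind P) => // [].
by rewrite -(scale0r (0 ⊗ 0)) -Tensor.pureZl.
Qed.

(* The enveloping algebra of B and its opposite, carried by B ⨂ B with
   product (a ⊗ b)(c ⊗ d) = ac ⊗ db; b and \bar b are b ⊗ 1 and 1 ⊗ b. *)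

Section Enveloping.
Variables (k : fieldType) (B : algType k).

Definition Be : Type := B ⨂ B.
HB.instance Definition _ := GRing.Lmodule.on Be.

Lemma sandwich_ex (a b c d : B) :
  exists g : {linear Be -> Be}, forall u v : B, g (u ⊗ v) = (a * u * c) ⊗ (d * v * b).
Proof.
apply: (Tensor.lift_ex (W := Be) (f := fun u v => (a * u * c) ⊗ (d * v * b))) => *;
  by rewrite ?(mulrDr, mulrDl) -?(scalerAl, scalerAr) -?(scalerAl, scalerAr)
     ?(Tensor.pureDl, Tensor.pureDr, Tensor.pureZl, Tensor.pureZr).
Qed.
Definition sandwich a b c d : {linear Be -> Be} := projT1 (cid (sandwich_ex a b c d)).
Lemma sandwichE a b c d u v :
  sandwich a b c d (u ⊗ v) = (a * u * c) ⊗ (d * v * b).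
Proof. by rewrite /sandwich; case: cid. Qed.

Definition Be_one : Be := 1 ⊗ 1.
Definition Be_mul (x y : Be) : Be :=
  \sum_(p <- tens_rep x) \sum_(q <- tens_rep y) (p.1 * q.1) ⊗ (q.2 * p.2).

Lemma Be_mulEl x y : Be_mul x y = \sum_(p <- tens_rep x) sandwich p.1 p.2 1 1 y.
Proof.
apply: eq_bigr => p _; rewrite [in RHS](tens_repE y) linear_sum.
by apply: eq_bigr => q _; rewrite sandwichE mulr1 mul1r.
Qed.

Lemma Be_mulEr x y : Be_mul x y = \sum_(q <- tens_rep y) sandwich 1 1 q.1 q.2 x.
Proof.
rewrite /Be_mul exchange_big; apply: eq_bigr => q _.
rewrite [in RHS](tens_repE x) linear_sum.
by apply: eq_bigr => p _; rewrite sandwichE mulr1 mul1r.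
Qed.

Lemma Be_mulE a b c d : Be_mul (a ⊗ b) (c ⊗ d) = (a * c) ⊗ (d * b).
Proof.
rewrite Be_mulEr; under eq_bigr do rewrite sandwichE mulr1 mul1r.
transitivity (sandwich a b 1 1 (c ⊗ d)); last by rewrite sandwichE mulr1 mul1r.
rewrite [in RHS](tens_repE (c ⊗ d)) linear_sum.
by apply: eq_bigr => q _; rewrite sandwichE mulr1 mul1r.
Qed.

Lemma Be_mulDl : left_distributive Be_mul +%R.
Proof.
move=> x y z; rewrite !Be_mulEr -big_split.
by apply: eq_bigr => q _; rewrite linearD.
Qed.

Lemma Be_mulDr : right_distributive Be_mul +%R.
Proof.
move=> x y z; rewrite !Be_mulEl -big_split.
by apply: eq_bigr => q _; rewrite linearD.
Qed.

Lemma Be_mulZl (a : k) x y : a *: Be_mul x y = Be_mul (a *: x) y.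
Proof.
rewrite !Be_mulEr scaler_sumr.
by apply: eq_bigr => q _; rewrite linearZ.
Qed.

Lemma Be_mulZr (a : k) x y : a *: Be_mul x y = Be_mul x (a *: y).
Proof.
rewrite !Be_mulEl scaler_sumr.
by apply: eq_bigr => q _; rewrite linearZ.
Qed.

Lemma Be_mulA : associative Be_mul.
Proof.
elim/tens_ind=> [x y IHx IHy u v|a a' y z]; first by rewrite !Be_mulDl IHx IHy.
elim/tens_ind: y z => [x y IHx IHy z|b b' z].
  by rewrite !(Be_mulDl, Be_mulDr) IHx IHy.
elim/tens_ind: z => [x y IHx IHy|c c']; first by rewrite !Be_mulDr IHx IHy.
by rewrite !Be_mulE !mulrA.
Qed.

Lemma Be_mul1 : left_id Be_one Be_mul.
Proof.
elim/tens_ind=> [x y IHx IHy|a a']; first by rewrite Be_mulDr IHx IHy.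
by rewrite Be_mulE mul1r mulr1.
Qed.

Lemma Be_mulr1 : right_id Be_one Be_mul.
Proof.
elim/tens_ind=> [x y IHx IHy|a a']; first by rewrite Be_mulDl IHx IHy.
by rewrite Be_mulE mul1r mulr1.
Qed.

Lemma Be_one_neq0 : Be_one != 0.
Proof.
have [g gE] : exists g : {linear Be -> B}, forall u v : B, g (u ⊗ v) = u * v.
  apply: (Tensor.lift_ex (f := fun u v : B => u * v)) => *;
  by rewrite ?(mulrDl, mulrDr) -?(scalerAl, scalerAr).
apply: contra_neq (oner_neq0 B) => e.
by rewrite -[1]mulr1 -gE [1 ⊗ 1]e linear0.
Qed.

HB.instance Definition _ := GRing.Zmodule_isNzRing.Build Be
  Be_mulA Be_mul1 Be_mulr1 Be_mulDl Be_mulDr Be_one_neq0.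
HB.instance Definition _ := GRing.Lmodule_isLalgebra.Build k Be Be_mulZl.
HB.instance Definition _ := GRing.Lalgebra_isAlgebra.Build k Be Be_mulZr.

End Enveloping.

Definition env (k : fieldType) (B : algType k) (b c : B) : Be B := b ⊗ c.

(* Sweedler notation: [R x] lists pairs (x_(1), x_(2)) whose tensors sum to
   the coproduct of x; longer sums re-expand the last factor. *)

Fixpoint nfun (C V : Type) (n : nat) : Type :=
  if n is m.+1 then C -> nfun C V m else V.

Fixpoint sw (C : Type) (V : nmodType) (R : C -> seq (C * C)) (n : nat) :
    nfun C V n.+1 -> C -> V :=
  match n return nfun C V n.+1 -> C -> V with
  | 0 => fun F x => F x
  | m.+1 => fun F x => \sum_(p <- R x) sw R (n := m) (F p.1) p.2
  end.
Arguments sw {C V} R n F x.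

(* Sum of F x_(1) ... x_(n). *)
Notation sweedler R n x F := (sw R n.-1 F x).


Section Coquasi.
Variables (k : fieldType) (H : lmodType k).
Variables (Delta : {linear H -> H ⨂ H}) (eps : {linear H -> k^o}).

(* By multilinearity, Sweedler sums do not depend on this choice. *)
Definition cop (h : H) : seq (H * H) := tens_rep (Delta h).

Record is_coalgebra : Prop := {
  coassoc : forall h,
    sweedler cop 2 h (fun h1 h2 =>
      sweedler cop 2 h1 (fun h11 h12 => h11 ⊗ h12 ⊗ h2))
    = sweedler cop 3 h (fun h1 h2 h3 => h1 ⊗ h2 ⊗ h3);
  counitl : forall h, sweedler cop 2 h (fun h1 h2 => eps h1 *: h2) = h;
  counitr : forall h, sweedler cop 2 h (fun h1 h2 => eps h2 *: h1) = h }.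

(* Associativity is not required. *)
Record is_unital_algebra (mul : {linear H ⨂ H -> H}) (one : H) : Prop := {
  alg_mul1 : forall x, mul (one ⊗ x) = x;
  alg_mulr1 : forall x, mul (x ⊗ one) = x }.

Definition conv_inv2 (B : algType k) (f g : {linear H ⨂ H -> B}) : Prop :=
  forall x y,
    sweedler cop 2 x (fun x1 x2 => sweedler cop 2 y (fun y1 y2 =>
      f (x1 ⊗ y1) * g (x2 ⊗ y2))) = (eps x * eps y) *: 1
    /\
    sweedler cop 2 x (fun x1 x2 => sweedler cop 2 y (fun y1 y2 =>
      g (x1 ⊗ y1) * f (x2 ⊗ y2))) = (eps x * eps y) *: 1.

Definition conv_inv3 (f g : {linear H ⨂ H ⨂ H -> k^o}) : Prop :=
  forall x y z,
    sweedler cop 2 x (fun x1 x2 => sweedler cop 2 y (fun y1 y2 =>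
    sweedler cop 2 z (fun z1 z2 =>
      f (x1 ⊗ y1 ⊗ z1) * g (x2 ⊗ y2 ⊗ z2)))) = eps x * eps y * eps z
    /\
    sweedler cop 2 x (fun x1 x2 => sweedler cop 2 y (fun y1 y2 =>
    sweedler cop 2 z (fun z1 z2 =>
      g (x1 ⊗ y1 ⊗ z1) * f (x2 ⊗ y2 ⊗ z2)))) = eps x * eps y * eps z.

Record is_coquasi_bialgebra (mul : {linear H ⨂ H -> H}) (one : H)
    (phi : {linear H ⨂ H ⨂ H -> k^o}) : Prop := {
  cq_coalgebra : is_coalgebra;
  cq_algebra : is_unital_algebra mul one;
  cq_Delta_mul : forall h g,
    Delta (mul (h ⊗ g)) =
    sweedler cop 2 h (fun h1 h2 => sweedler cop 2 g (fun g1 g2 =>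
      mul (h1 ⊗ g1) ⊗ mul (h2 ⊗ g2)));
  cq_eps_mul : forall h g, eps (mul (h ⊗ g)) = eps h * eps g;
  cq_Delta_one : Delta one = one ⊗ one;
  cq_eps_one : eps one = 1;
  cq_phi_inv : exists psi, conv_inv3 phi psi;
  cq_phi_unital : forall h g, phi (h ⊗ one ⊗ g) = eps (mul (h ⊗ g));
  cq_phi_cocycle : forall h g f l,
    sweedler cop 2 h (fun h1 h2 => sweedler cop 2 g (fun g1 g2 =>
    sweedler cop 2 f (fun f1 f2 => sweedler cop 2 l (fun l1 l2 =>
      phi (h1 ⊗ g1 ⊗ mul (f1 ⊗ l1)) * phi (mul (h2 ⊗ g2) ⊗ f2 ⊗ l2)))))
    = sweedler cop 2 h (fun h1 h2 => sweedler cop 3 g (fun g1 g2 g3 =>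
      sweedler cop 3 f (fun f1 f2 f3 => sweedler cop 2 l (fun l1 l2 =>
      phi (g1 ⊗ f1 ⊗ l1) * phi (h1 ⊗ mul (g2 ⊗ f2) ⊗ l2)
      * phi (h2 ⊗ g3 ⊗ f3)))));
  cq_quasi_assoc : forall h g f,
    sweedler cop 2 h (fun h1 h2 => sweedler cop 2 g (fun g1 g2 =>
    sweedler cop 2 f (fun f1 f2 =>
      phi (h1 ⊗ g1 ⊗ f1) *: mul (mul (h2 ⊗ g2) ⊗ f2))))
    = sweedler cop 2 h (fun h1 h2 => sweedler cop 2 g (fun g1 g2 =>
      sweedler cop 2 f (fun f1 f2 =>
      phi (h2 ⊗ g2 ⊗ f2) *: mul (h1 ⊗ mul (g1 ⊗ f1))))) }.

Record is_measuring (B : algType k) (act : {linear H ⨂ B -> B}) : Prop := {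
  act_mul : forall h a b,
    act (h ⊗ (a * b)) =
    sweedler cop 2 h (fun h1 h2 => act (h1 ⊗ a) * act (h2 ⊗ b));
  act_one : forall h, act (h ⊗ 1) = eps h *: 1 }.

Definition gamma_unital (one : H) (B : algType k) (gamma : {linear H ⨂ H -> B}) :=
  forall h, gamma (one ⊗ h) = eps h *: 1 /\ gamma (h ⊗ one) = eps h *: 1.

End Coquasi.


Record is_bimodule (k : fieldType) (A : algType k) (M : lmodType k)
    (l : {linear A ⨂ M -> M}) (r : {linear M ⨂ A -> M}) : Prop := {
  bim_l1 : forall m, l (1 ⊗ m) = m;
  bim_lM : forall a b m, l ((a * b) ⊗ m) = l (a ⊗ l (b ⊗ m));
  bim_r1 : forall m, r (m ⊗ 1) = m;
  bim_rM : forall a b m, r (m ⊗ (a * b)) = r (r (m ⊗ a) ⊗ b);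
  bim_lr : forall a b m, r (l (a ⊗ m) ⊗ b) = l (a ⊗ r (m ⊗ b)) }.

Section Diamond.
Variables (k : fieldType) (B : algType k).

Section Two.
Variables (M N : lmodType k).
Variables (lM : {linear Be B ⨂ M -> M}) (lN : {linear Be B ⨂ N -> N}).
Variables (rM : {linear M ⨂ Be B -> M}) (rN : {linear N ⨂ Be B -> N}).

Inductive diamond_rel : M ⨂ N -> Prop :=
| DiamondRel b m n :
    diamond_rel (lM (env 1 b ⊗ m) ⊗ n - m ⊗ lN (env b 1 ⊗ n)).

Definition diamond : Type := quot diamond_rel.
HB.instance Definition _ := GRing.Lmodule.on diamond.
Definition dia (m : M) (n : N) : diamond := qpi diamond_rel (m ⊗ n).

(* Both sides are independent of the decomposition of t when the left and
   right actions commute. *)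
Definition takeuchi (t : diamond) : Prop :=
  forall s : seq (M * N), t = \sum_(p <- s) dia p.1 p.2 ->
  forall b, \sum_(p <- s) dia (rM (p.1 ⊗ env 1 b)) p.2
          = \sum_(p <- s) dia p.1 (rN (p.2 ⊗ env b 1)).
End Two.

Section Three.
Variables (M P N : lmodType k).
Variables (lM : {linear Be B ⨂ M -> M}) (lP : {linear Be B ⨂ P -> P})
  (lN : {linear Be B ⨂ N -> N}).
Variables (rM : {linear M ⨂ Be B -> M}) (rP : {linear P ⨂ Be B -> P})
  (rN : {linear N ⨂ Be B -> N}).

Inductive diamond3_rel : M ⨂ P ⨂ N -> Prop :=
| Diamond3Rel1 b m p n :
    diamond3_rel (lM (env 1 b ⊗ m) ⊗ p ⊗ n - m ⊗ lP (env b 1 ⊗ p) ⊗ n)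
| Diamond3Rel2 b m p n :
    diamond3_rel (m ⊗ lP (env 1 b ⊗ p) ⊗ n - m ⊗ p ⊗ lN (env b 1 ⊗ n)).

Definition diamond3 : Type := quot diamond3_rel.
HB.instance Definition _ := GRing.Lmodule.on diamond3.
Definition dia3 (m : M) (p : P) (n : N) : diamond3 :=
  qpi diamond3_rel (m ⊗ p ⊗ n).

Definition takeuchi3 (t : diamond3) : Prop :=
  forall s : seq (M * P * N), t = \sum_(x <- s) dia3 x.1.1 x.1.2 x.2 ->
  forall b,
    \sum_(x <- s) dia3 (rM (x.1.1 ⊗ env 1 b)) x.1.2 x.2
    = \sum_(x <- s) dia3 x.1.1 (rP (x.1.2 ⊗ env b 1)) x.2
    /\
    \sum_(x <- s) dia3 x.1.1 (rP (x.1.2 ⊗ env 1 b)) x.2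
    = \sum_(x <- s) dia3 x.1.1 x.1.2 (rN (x.2 ⊗ env b 1)).
End Three.
End Diamond.

(* L ⊗_A L ⊗_A L. *)
Section BalancedCube.
Variables (k : fieldType) (A : algType k) (L : lmodType k).
Variables (l : {linear A ⨂ L -> L}) (r : {linear L ⨂ A -> L}).

Inductive cube_rel : L ⨂ L ⨂ L -> Prop :=
| CubeRel1 a x y z : cube_rel (r (x ⊗ a) ⊗ y ⊗ z - x ⊗ l (a ⊗ y) ⊗ z)
| CubeRel2 a x y z : cube_rel (x ⊗ r (y ⊗ a) ⊗ z - x ⊗ y ⊗ l (a ⊗ z)).

Definition cube : Type := quot cube_rel.
HB.instance Definition _ := GRing.Lmodule.on cube.
Definition cub (x y z : L) : cube := qpi cube_rel (x ⊗ y ⊗ z).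
End BalancedCube.


Section Bialgebroid.
Variables (k : fieldType) (B : algType k) (L : lmodType k).
Variables (l : {linear Be B ⨂ L -> L}) (r : {linear L ⨂ Be B -> L}).
Variables (Delta : {linear L -> diamond l l}) (eps : {linear L -> B}).

Local Notation "x ⋄ y" := (dia l l x y) (at level 42, no associativity).
Local Notation "b ·l x" := (l (env b 1 ⊗ x)) (at level 38, right associativity).
Local Notation "b ·lbar x" := (l (env 1 b ⊗ x)) (at level 38, right associativity).
Local Notation "x ·r b" := (r (x ⊗ env b 1)) (at level 39, left associativity).
Local Notation "x ·rbar b" := (r (x ⊗ env 1 b)) (at level 39, left associativity).

(* R chooses Sweedler representatives.  The axioms below are imposed for
   every choice: over B, unlike over k, it is not automatic from the types
   that an expression depends only on the class in the diamond product. *)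
Definition represents (R : L -> seq (L * L)) : Prop :=
  forall X, Delta X = \sum_(p <- R X) (p.1 ⋄ p.2).

Record is_left_coalgebroid : Prop := {
  cb_bimodule : is_bimodule l r;
  cb_Delta_linear : forall R, represents R -> forall b c X,
    Delta (l (env b c ⊗ X)) =
    sweedler R 2 X (fun X1 X2 => (b ·l X1) ⋄ (c ·lbar X2));
  cb_Delta_takeuchi : forall X, takeuchi r r (Delta X);
  cb_eps_linear : forall b c X, eps (l (env b c ⊗ X)) = b * eps X * c;
  cb_coassoc : forall R, represents R -> forall X,
    sweedler R 2 X (fun X1 X2 => sweedler R 2 X1 (fun X11 X12 =>
      dia3 l l l X11 X12 X2))
    = sweedler R 3 X (fun X1 X2 X3 => dia3 l l l X1 X2 X3);
  cb_takeuchi3 : forall R, represents R -> forall X,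
    takeuchi3 r r r (sweedler R 3 X (fun X1 X2 X3 => dia3 l l l X1 X2 X3));
  cb_counitl : forall R, represents R -> forall X,
    sweedler R 2 X (fun X1 X2 => eps X1 ·l X2) = X;
  cb_counitr : forall R, represents R -> forall X,
    sweedler R 2 X (fun X1 X2 => eps X2 ·lbar X1) = X }.

Variables (mul : {linear L ⨂ L -> L}) (one : L) (s t : {linear B -> L}).

Local Notation "x • y" := (mul (x ⊗ y)) (at level 41, no associativity).

Definition left_linear (Phi : {linear cube l r -> B}) : Prop :=
  forall b c X Y Z,
    Phi (cub l r (l (env b c ⊗ X)) Y Z) = b * Phi (cub l r X Y Z) * c.

Definition conv_inverse (Phi Psi : {linear cube l r -> B}) : Prop :=
  forall R, represents R -> forall X Y Z,
    sweedler R 2 X (fun X1 X2 => sweedler R 2 Y (fun Y1 Y2 =>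
    sweedler R 2 Z (fun Z1 Z2 =>
      Phi (cub l r X1 Y1 Z1) * Psi (cub l r X2 Y2 Z2))))
    = eps ((X • Y) • Z)
    /\
    sweedler R 2 X (fun X1 X2 => sweedler R 2 Y (fun Y1 Y2 =>
    sweedler R 2 Z (fun Z1 Z2 =>
      Psi (cub l r X1 Y1 Z1) * Phi (cub l r X2 Y2 Z2))))
    = eps ((X • Y) • Z).

(* coc_unit makes the convolution unit XYZ |-> eps (XYZ) unambiguous. *)
Record is_normalised_cocycle (Phi : {linear cube l r -> B}) : Prop := {
  coc_linear : left_linear Phi;
  coc_unit : forall X Y Z, eps ((X • Y) • Z) = eps (X • (Y • Z));
  coc_inv : exists Psi, left_linear Psi /\ conv_inverse Phi Psi;
  coc_normal : forall X Y,
    [/\ Phi (cub l r one X Y) = eps (X • Y),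
        Phi (cub l r X one Y) = eps (X • Y) &
        Phi (cub l r X Y one) = eps (X • Y)];
  coc_right : forall X Y Z b,
    Phi (cub l r X Y (Z ·r b)) = Phi (cub l r X Y (Z ·rbar b));
  coc_cocycle : forall R, represents R -> forall X Y Z W,
    sweedler R 2 X (fun X1 X2 => sweedler R 2 Y (fun Y1 Y2 =>
    sweedler R 2 Z (fun Z1 Z2 => sweedler R 2 W (fun W1 W2 =>
      Phi (cub l r X1 Y1 (Z1 • W1)) * Phi (cub l r (X2 • Y2) Z2 W2)))))
    = sweedler R 2 X (fun X1 X2 => sweedler R 3 Y (fun Y1 Y2 Y3 =>
      sweedler R 3 Z (fun Z1 Z2 Z3 => sweedler R 2 W (fun W1 W2 =>
      Phi (cub l r X1 (Phi (cub l r Y1 Z1 W1) ·l (Y2 • Z2)) W2)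
      * Phi (cub l r X2 Y3 Z3)))));
  coc_assoc : forall R, represents R -> forall X Y Z,
    sweedler R 2 X (fun X1 X2 => sweedler R 2 Y (fun Y1 Y2 =>
    sweedler R 2 Z (fun Z1 Z2 =>
      Phi (cub l r X1 Y1 Z1) ·l ((X2 • Y2) • Z2))))
    = sweedler R 2 X (fun X1 X2 => sweedler R 2 Y (fun Y1 Y2 =>
      sweedler R 2 Z (fun Z1 Z2 =>
      Phi (cub l r X2 Y2 Z2) ·lbar (X1 • (Y1 • Z1))))) }.

Record is_left_coquasi_bialgebroid (Phi : {linear cube l r -> B}) : Prop := {
  cqb_algebra : is_unital_algebra mul one;
  cqb_s : s 1 = one /\ forall b c, s (b * c) = s b • s c;
  cqb_t : t 1 = one /\ forall b c, t (b * c) = t c • t b;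
  cqb_st : forall b c, s b • t c = t c • s b;
  cqb_actions : forall b X,
    [/\ b ·l X = s b • X, b ·lbar X = t b • X,
        X ·r b = X • s b & X ·rbar b = X • t b];
  cqb_coalgebroid : is_left_coalgebroid;
  cqb_Delta_one : Delta one = one ⋄ one;
  cqb_Delta_mul : forall R, represents R -> forall X Y,
    Delta (X • Y) =
    sweedler R 2 X (fun X1 X2 => sweedler R 2 Y (fun Y1 Y2 =>
      (X1 • Y1) ⋄ (X2 • Y2)));
  cqb_eps_one : eps one = 1;
  cqb_eps_mul : forall X Y,
    eps (X ·r eps Y) = eps (X • Y) /\ eps (X ·rbar eps Y) = eps (X • Y);
  cqb_cocycle : is_normalised_cocycle Phi }.

End Bialgebroid.

Lemma represents_ex (k : fieldType) (B : algType k) (L : lmodType k)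
    (l : {linear Be B ⨂ L -> L}) (Delta : {linear L -> diamond l l}) :
  exists R, represents Delta R.
Proof.
suff h X : exists s : seq (L * L), Delta X = \sum_(p <- s) dia l l p.1 p.2.
  by exists (fun X => projT1 (cid (h X))) => X; case: cid.
have [x ->] := qpi_surj (Delta X); exists (tens_rep x).
by rewrite {1}[x]tens_repE linear_sum.
Qed.

(* Main.v *)
(* All computations are made with generalised elements: linear maps x, y, ...
   from an arbitrary coalgebra C to H and u, v, ... from C to B, multiplied by
   convolution.  When x, y, z are pairwise commuting coalgebra maps, a Sweedler
   identity becomes an identity between words.  With
     Omega(x,y,z) = (x |> gamma(y,z)) gamma(x,yz) phi(x,y,z)
                    gamma^-1(xy,z) gamma^-1(x,y)
   the twisting condition says that (x |> y |> u) gamma(x,y) = gamma(x,y) (xy |> u),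
   so Omega(x,y,z) commutes with x |> y |> z |> u, and the 3-cocycle identity of
   phi turns into a 3-cocycle identity for Omega.  On the generalised elements
   u[x]u' of B (x) H (x) B one has
     u[x]u' . v[y]v' = u (x |> v) gamma(x,y) [xy] gamma^-1(x,y) (x |> v') u',
     Phi(u[x]u', v[y]v', r[z]r') = u (x |> v (y |> r)) Omega(x,y,z) (x |> (y |> r') v') u',
   and the axioms for pure tensors are words in Omega.

   Over B the axioms are required for arbitrary representatives of the coproducts.
   In each of them a scalar moves between the two factors of X term by term, and a
   scalar on a factor of Y can be moved to the right of the corresponding factor of
   X; since Delta X lies in the Takeuchi product, the sum over X is again balanced
   in Y, and so on for Z and W.  Hence representatives may be chosen canonically. *)

Require Import Defs.
From HB Require Import structures.
From mathcomp Require Import all_boot all_algebra.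
From mathcomp Require Import boolp.
Import GRing.Theory.
Local Open Scope ring_scope.

Set Implicit Arguments.
Unset Strict Implicit.
Unset Printing Implicit Defensive.

(** * Multilinear maps *)

Section LinearMaps.
Variable k : fieldType.

(** Convolution is not commutative, so the order of the Sweedler factors matters even where the
    values are scalars. Generalised elements remove the indices: since a coalgebra map [x] satisfies
    x(c)_(1) (x) x(c)_(2) = x(c_(1)) (x) x(c_(2)), every h_(i) of a formula becomes the same letter
    [x], and its position in the word records the index. Letters of different variables may be
    interchanged, those of one variable in general not; besides this, letters move only by the
    twisting condition and by the rebracketing that phi performs. The projections of H (x) H (x) H
    give back the identities on elements, while an arbitrary [C] allows products such as xy to be
    substituted for a letter. Omega is phi changed by the nonabelian coboundary of gamma. The recipe
    for Phi makes sense with any map in the place of Omega; it turns convolution products into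
    convolution products and the counit into eps(XYZ). Invertibility of Phi thus reduces to that of
    Omega. *)

Definition lin (U V : lmodType k) (f : U -> V) : Prop :=
  forall a x y, f (a *: x + y) = a *: f x + f y.

Definition mklin (U V : lmodType k) (f : U -> V) (hf : lin f) : {linear U -> V} :=
  HB.pack f (GRing.isLinear.Build k U V _ f hf).

Lemma linD (U V : lmodType k) (f : U -> V) : lin f -> forall x y, f (x + y) = f x + f y.
Proof. by move=> hf x y; rewrite -[x]scale1r hf !scale1r. Qed.

Lemma lin0 (U V : lmodType k) (f : U -> V) : lin f -> f 0 = 0.
Proof. by move=> hf; apply: (addrI (f 0)); rewrite -linD // !addr0. Qed.

Lemma linZ (U V : lmodType k) (f : U -> V) : lin f -> forall a x, f (a *: x) = a *: f x.
Proof. by move=> hf a x; rewrite -[a *: x]addr0 hf lin0 // addr0. Qed.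

Lemma lin_sum (U V : lmodType k) (f : U -> V) I (s : seq I) (G : I -> U) :
  lin f -> f (\sum_(i <- s) G i) = \sum_(i <- s) f (G i).
Proof.
by move=> hf; elim: s => [|i s IH]; rewrite ?big_nil ?lin0 // !big_cons linD // IH.
Qed.

(** Functional extensionality identifies the functions, and the linearity fields are propositions.
    Identities between words thereby become equalities of maps, usable by rewriting inside longer
    words. *)
Lemma linP_eq (U V : lmodType k) (f g : {linear U -> V}) : f =1 g -> f = g.
Proof.
case: f g => [f cf] [g cg] /= /funext e; case: _ / e cg => cg.
congr GRing.Linear.Pack; case: cf cg => [[mf] [sf]] [[mg] [sg]].
by rewrite (Prop_irrelevance mf mg) (Prop_irrelevance sf sg).
Qed.

Lemma lin_linear (U V : lmodType k) (f : {linear U -> V}) : lin f.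
Proof. by move=> a x y; rewrite linearP. Qed.

Lemma lin_id (U : lmodType k) : lin (fun x : U => x).
Proof. by []. Qed.

Lemma lin_app (U V W : lmodType k) (g : {linear V -> W}) (f : U -> V) :
  lin f -> lin (fun x => g (f x)).
Proof. by move=> hf a x y; rewrite hf linearP. Qed.

Lemma lin_comp (U V W : lmodType k) (g : V -> W) (f : U -> V) :
  lin g -> lin f -> lin (fun x => g (f x)).
Proof. by move=> hg hf a x y; rewrite hf hg. Qed.

Lemma lin_tensl (U V W : lmodType k) (f : U -> V) (w : W) :
  lin f -> lin (fun x => f x ⊗ w).
Proof. by move=> hf a x y; rewrite hf Tensor.pureDl Tensor.pureZl. Qed.

Lemma lin_tensr (U V W : lmodType k) (f : U -> V) (w : W) :
  lin f -> lin (fun x => w ⊗ f x).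
Proof. by move=> hf a x y; rewrite hf Tensor.pureDr Tensor.pureZr. Qed.

Lemma lin_add (U V : lmodType k) (f g : U -> V) :
  lin f -> lin g -> lin (fun x => f x + g x).
Proof. by move=> hf hg a x y; rewrite hf hg scalerDr addrACA. Qed.

Lemma lin_scale (U V : lmodType k) (f : U -> V) (b : k) :
  lin f -> lin (fun x => b *: f x).
Proof. by move=> hf a x y; rewrite hf scalerDr !scalerA mulrC. Qed.

Lemma lin_scalel (U V : lmodType k) (f : U -> k^o) (v : V) :
  lin f -> lin (fun x => (f x : k) *: v).
Proof. by move=> hf a x y; rewrite hf scalerDl scalerA. Qed.

Lemma lin_mull (U : lmodType k) (B : algType k) (f : U -> B) (b : B) :
  lin f -> lin (fun x => f x * b).
Proof. by move=> hf a x y; rewrite hf mulrDl scalerAl. Qed.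

Lemma lin_mulr (U : lmodType k) (B : algType k) (f : U -> B) (b : B) :
  lin f -> lin (fun x => b * f x).
Proof. by move=> hf a x y; rewrite hf mulrDr scalerAr. Qed.

Lemma lin_big (U V : lmodType k) I (s : seq I) (f : I -> U -> V) :
  (forall i, lin (f i)) -> lin (fun x => \sum_(i <- s) f i x).
Proof.
move=> hf a x y; rewrite scaler_sumr -big_split.
by apply: eq_bigr => i _; rewrite hf.
Qed.

Definition bilin (U V W : lmodType k) (F : U -> V -> W) : Prop :=
  (forall v, lin (F^~ v)) /\ (forall u, lin (F u)).

Lemma tens_lift (U V W : lmodType k) (F : U -> V -> W) :
  bilin F -> exists g : {linear U ⨂ V -> W}, forall u v, g (u ⊗ v) = F u v.
Proof.
case=> Fl Fr; apply: Tensor.lift_ex => *.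
- exact: linD (Fl _) _ _.
- exact: linD (Fr _) _ _.
- exact: linZ (Fl _) _ _.
- exact: linZ (Fr _) _ _.
Qed.

Lemma lin_ind (U V W : lmodType k) (f g : U ⨂ V -> W) :
  lin f -> lin g -> (forall u v, f (u ⊗ v) = g (u ⊗ v)) -> f =1 g.
Proof.
by move=> hf hg e; elim/tens_ind=> // x y hx hy; rewrite !linD // hx hy.
Qed.

Lemma tens_lin_eq (U V W : lmodType k) (f g : {linear U ⨂ V -> W}) :
  (forall u v, f (u ⊗ v) = g (u ⊗ v)) -> f = g.
Proof. by move=> e; apply: linP_eq; apply: lin_ind e => a x y; rewrite linearP. Qed.

Lemma tens_lin_eq3 (U V W X : lmodType k) (f g : {linear U ⨂ V ⨂ W -> X}) :
  (forall u v w, f (u ⊗ v ⊗ w) = g (u ⊗ v ⊗ w)) -> f = g.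
Proof.
move=> e; apply: tens_lin_eq => uv w; move: uv; apply: lin_ind => [||u v]; last exact: e.
  by apply: lin_app; apply: lin_tensl.
by apply: lin_app; apply: lin_tensl.
Qed.

Definition trilin (U V W X : lmodType k) (F : U -> V -> W -> X) : Prop :=
  [/\ forall v w, lin (fun u => F u v w), forall u w, lin (fun v => F u v w)
    & forall u v, lin (F u v)].

Lemma tens_lift3 (U V W X : lmodType k) (F : U -> V -> W -> X) :
  trilin F ->
  exists g : {linear U ⨂ V ⨂ W -> X}, forall u v w, g (u ⊗ v ⊗ w) = F u v w.
Proof.
case=> F1 F2 F3.
(* The first two variables are lifted for fixed [w]; the lift is linear in [w] because linear maps
   are determined by their values on pure tensors. *)
have /choice [G GE] w : exists g : {linear U ⨂ V -> X}, forall u v, g (u ⊗ v) = F u v w.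
  by apply: tens_lift; split=> *; [apply: F1 | apply: F2].
have [|g gE] := @tens_lift _ _ _ (fun x w => G w x).
  split=> [w|x a w w']; first exact: lin_linear.
  move: x; apply: lin_ind => [||u v]; first exact: lin_linear.
    by apply: lin_add; [apply: lin_scale|]; apply: lin_linear.
  by rewrite !GE F3.
by exists g => u v w; rewrite gE GE.
Qed.

Definition lcomp (U V W : lmodType k) (g : {linear V -> W}) (f : {linear U -> V}) :
  {linear U -> W} := g \o f.

Lemma lcompE (U V W : lmodType k) (g : {linear V -> W}) (f : {linear U -> V}) x :
  lcomp g f x = g (f x).
Proof. by []. Qed.

Definition tmap_ex (U V U' V' : lmodType k) (f : {linear U -> U'}) (g : {linear V -> V'}) :
  exists h : {linear U ⨂ V -> U' ⨂ V'}, forall u v, h (u ⊗ v) = f u ⊗ g v.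
Proof.
apply: (tens_lift (F := fun u v => f u ⊗ g v)); split=> w.
  exact/lin_tensl/lin_linear.
exact/lin_tensr/lin_linear.
Qed.
Definition tmap U V U' V' f g := projT1 (cid (@tmap_ex U V U' V' f g)).
Lemma tmapE U V U' V' f g u v : @tmap U V U' V' f g (u ⊗ v) = f u ⊗ g v.
Proof. by rewrite /tmap; case: cid. Qed.

End LinearMaps.

Notation "g ∘ f" := (lcomp g f) (at level 50, left associativity).

(** * Coalgebras *)

Structure coalg (k : fieldType) := Coalg {
  car :> lmodType k;
  cdelta : {linear car -> car ⨂ car};
  ceps : {linear car -> k^o};
  coalgP : is_coalgebra cdelta ceps }.

Definition S2 (k : fieldType) (C : coalg k) (V : lmodType k) (c : C) (F : C -> C -> V) : V :=
  \sum_(p <- cop (cdelta C) c) F p.1 p.2.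

Section SumLin.
Variables (k : fieldType) (C : coalg k).

Lemma S2_ext (V : lmodType k) (c : C) (F G : C -> C -> V) :
  (forall c1 c2, F c1 c2 = G c1 c2) -> S2 c F = S2 c G.
Proof. by move=> e; apply: eq_bigr => p _; apply: e. Qed.

(** Both sums are the value at the coproduct of [c] of the linear map induced by [F]; bilinearity is
    what makes a Sweedler sum independent of the chosen family. *)
Lemma S2_rep (V : lmodType k) (F : C -> C -> V) c (s : seq (C * C)) :
  bilin F -> cdelta C c = \sum_(p <- s) p.1 ⊗ p.2 ->
  S2 c F = \sum_(p <- s) F p.1 p.2.
Proof.
move=> /tens_lift [g gE] e; transitivity (g (cdelta C c)).
  by rewrite [in RHS](tens_repE (cdelta C c)) linear_sum; apply: eq_bigr => p _; rewrite gE.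
by rewrite e linear_sum; apply: eq_bigr => p _; rewrite gE.
Qed.

Lemma S2_lift (V : lmodType k) (g : {linear C ⨂ C -> V}) c :
  S2 c (fun c1 c2 => g (c1 ⊗ c2)) = g (cdelta C c).
Proof. by rewrite [in RHS](tens_repE (cdelta C c)) linear_sum. Qed.

(** The chosen family [cop] need not be additive in its argument, so linearity is obtained by
    rewriting the sum as a linear map applied to the coproduct. *)
Lemma lin_S2c (U V : lmodType k) (F : C -> C -> V) (f : U -> C) :
  bilin F -> lin f -> lin (fun x => S2 (f x) F).
Proof.
move=> /tens_lift [g gE] hf a x y.
have e z : S2 (f z) F = g (cdelta C (f z)).
  by rewrite -S2_lift; apply: S2_ext => *; rewrite gE.
by rewrite !e hf !linearP.
Qed.

Lemma lin_S2 (U V : lmodType k) (F : U -> C -> C -> V) c :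
  (forall c1 c2, lin (fun x => F x c1 c2)) -> lin (fun x => S2 c (F x)).
Proof. by move=> h; apply: lin_big => p; apply: h. Qed.

Lemma S2_mor (V W : lmodType k) (f : V -> W) c (F : C -> C -> V) :
  lin f -> f (S2 c F) = S2 c (fun c1 c2 => f (F c1 c2)).
Proof. exact: lin_sum. Qed.

Lemma S2_mulr (B : algType k) c (F : C -> C -> B) b :
  S2 c F * b = S2 c (fun c1 c2 => F c1 c2 * b).
Proof. exact: mulr_suml. Qed.

Lemma S2_mull (B : algType k) c (F : C -> C -> B) b :
  b * S2 c F = S2 c (fun c1 c2 => b * F c1 c2).
Proof. exact: mulr_sumr. Qed.

Lemma S2_exch (D : coalg k) (V : lmodType k) (c : C) (d : D) (F : C -> C -> D -> D -> V) :
  S2 c (fun c1 c2 => S2 d (F c1 c2))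
  = S2 d (fun d1 d2 => S2 c (fun c1 c2 => F c1 c2 d1 d2)).
Proof. exact: exchange_big. Qed.

End SumLin.

Ltac lin_hook := fail.

(** Linearity is found by descending to the occurrence of the variable. Most manipulations of a
    Sweedler sum leave such a side condition, since the sums run over chosen representatives. *)
Ltac lin :=
  lazymatch goal with
  | |- bilin _ => split=> ? /=; lin
  | |- trilin _ => split=> ? ? /=; lin
  | |- forall _, _ => move=> ?; lin
  | |- lin _ => first [lin_hook; lin | lin_step]
  end
with lin_step :=
  lazymatch goal with
  | |- lin (fun _ => GRing.Linear.sort ?g _) =>
    first [exact: lin_linear | apply: lin_app; lin]
  | |- lin (fun _ => Tensor.pure _ ?v) => apply: lin_tensl; lin
  | |- lin (fun _ => Tensor.pure ?u _) => apply: lin_tensr; lin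
  | |- lin _ =>
    first
    [ assumption
    | exact: lin_id | exact: lin_linear
    | apply: lin_tensl; lin | apply: lin_tensr; lin
    | apply: lin_mull; lin | apply: lin_mulr; lin
    | apply: lin_scalel; lin | apply: lin_scale; lin
    | apply: lin_S2c; lin
    | apply: lin_S2; lin
    | apply: lin_big; lin
    | apply: lin_app; lin ]
  end.

Section Coalg.
Variables (k : fieldType) (C : coalg k).

Lemma S2_assoc (V : lmodType k) (F : C -> C -> C -> V) c : trilin F ->
  S2 c (fun c1 c2 => S2 c1 (fun c11 c12 => F c11 c12 c2))
  = S2 c (fun c1 c2 => S2 c2 (fun c21 c22 => F c1 c21 c22)).
Proof.
case/tens_lift3=> g gE.
have := congr1 g (coassoc (coalgP C) c).
rewrite /= !linear_sum => e; apply: etrans (etrans e _).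
  apply: eq_bigr => p _; rewrite linear_sum.
  by apply: eq_bigr => q _; rewrite gE.
apply: eq_bigr => p _; rewrite linear_sum.
by apply: eq_bigr => q _; rewrite gE.
Qed.

Lemma S2_counitl (V : lmodType k) (F : C -> V) c : lin F ->
  S2 c (fun c1 c2 => (ceps C c1 : k) *: F c2) = F c.
Proof.
move=> hF; rewrite -[in RHS](counitl (coalgP C) c) /= lin_sum //.
by apply: eq_bigr => p _; rewrite linZ.
Qed.

Lemma S2_counitr (V : lmodType k) (F : C -> V) c : lin F ->
  S2 c (fun c1 c2 => (ceps C c2 : k) *: F c1) = F c.
Proof.
move=> hF; rewrite -[in RHS](counitr (coalgP C) c) /= lin_sum //.
by apply: eq_bigr => p _; rewrite linZ.
Qed.

End Coalg.

Section TensCoalg.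
Variables (k : fieldType) (C D : coalg k).

Lemma tdelta_ex : exists g : {linear C ⨂ D -> (C ⨂ D) ⨂ (C ⨂ D)}, forall c d,
  g (c ⊗ d) = S2 c (fun c1 c2 => S2 d (fun d1 d2 => (c1 ⊗ d1) ⊗ (c2 ⊗ d2))).
Proof.
apply: (tens_lift (F := fun c d => S2 c (fun c1 c2 => S2 d (fun d1 d2 => (c1 ⊗ d1) ⊗ (c2 ⊗ d2))))).
lin.
Qed.
Definition tdelta := projT1 (cid tdelta_ex).
Lemma tdeltaE c d :
  tdelta (c ⊗ d) = S2 c (fun c1 c2 => S2 d (fun d1 d2 => (c1 ⊗ d1) ⊗ (c2 ⊗ d2))).
Proof. by rewrite /tdelta; case: cid. Qed.

Lemma teps_ex : exists g : {linear C ⨂ D -> k^o}, forall c d,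
  g (c ⊗ d) = ceps C c * ceps D d :> k.
Proof.
apply: (tens_lift (F := fun c d => (ceps C c : k) *: ceps D d)).
lin.
Qed.
Definition teps := projT1 (cid teps_ex).
Lemma tepsE c d : teps (c ⊗ d) = ceps C c * ceps D d :> k.
Proof. by rewrite /teps; case: cid. Qed.

Lemma S2t (V : lmodType k) (F : C ⨂ D -> C ⨂ D -> V) c d : bilin F ->
  \sum_(p <- cop tdelta (c ⊗ d)) F p.1 p.2
  = S2 c (fun c1 c2 => S2 d (fun d1 d2 => F (c1 ⊗ d1) (c2 ⊗ d2))).
Proof.
case/tens_lift=> g gE; transitivity (g (tdelta (c ⊗ d))).
  rewrite [in RHS](tens_repE (tdelta (c ⊗ d))) linear_sum.
  by apply: eq_bigr => p _; rewrite gE.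
rewrite tdeltaE S2_mor; last exact: lin_linear.
apply: S2_ext => c1 c2; rewrite S2_mor; last exact: lin_linear.
by apply: S2_ext => *; rewrite gE.
Qed.

Lemma lin_copt (U V : lmodType k) (F : C ⨂ D -> C ⨂ D -> V) (f : U -> C ⨂ D) :
  bilin F -> lin f -> lin (fun x => \sum_(p <- cop tdelta (f x)) F p.1 p.2).
Proof.
move=> /tens_lift [g gE] hf a x y.
have e z : \sum_(p <- cop tdelta (f z)) F p.1 p.2 = g (tdelta (f z)).
  rewrite [in RHS](tens_repE (tdelta (f z))) linear_sum.
  by apply: eq_bigr => *; rewrite gE.
by rewrite !e hf !linearP.
Qed.

(** On pure tensors the sums over the two factors are independent, so each axiom is checked one
    factor at a time; sums have to be exchanged because the coproduct interleaves the factors. *)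
Lemma tcoalgP : is_coalgebra tdelta teps.
Proof.
split=> [h|h|h] /=.
- move: h; apply: lin_ind.
  + apply: (lin_copt (F := fun x y => \sum_(p <- cop tdelta x) p.1 ⊗ p.2 ⊗ y)); last exact: lin_id.
    split=> v; first by apply: (lin_copt (F := fun a b => a ⊗ b ⊗ v)); lin.
    lin.
  + apply: (lin_copt (F := fun x y => \sum_(p <- cop tdelta y) x ⊗ p.1 ⊗ p.2)); last exact: lin_id.
    split=> v; first lin.
    by apply: (lin_copt (F := fun a b => v ⊗ a ⊗ b)); lin.
  move=> c d.
  rewrite (S2t (F := fun x y => \sum_(p <- cop tdelta x) p.1 ⊗ p.2 ⊗ y)); last first.
    split=> v; first by apply: (lin_copt (F := fun a b => a ⊗ b ⊗ v)); lin.
    lin.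
  rewrite (S2t (F := fun x y => \sum_(p <- cop tdelta y) x ⊗ p.1 ⊗ p.2)); last first.
    split=> v; first lin.
    by apply: (lin_copt (F := fun a b => v ⊗ a ⊗ b)); lin.
  transitivity (S2 c (fun c1 c2 => S2 c1 (fun c11 c12 => S2 d (fun d1 d2 =>
     S2 d1 (fun d11 d12 => (c11 ⊗ d11) ⊗ (c12 ⊗ d12) ⊗ (c2 ⊗ d2)))))).
    apply: S2_ext => c1 c2; rewrite [RHS]S2_exch; apply: S2_ext => d1 d2.
    by rewrite (S2t (F := fun a b => a ⊗ b ⊗ (c2 ⊗ d2))); last lin.
  rewrite S2_assoc; last lin; apply: S2_ext => c1 c2.
  transitivity (S2 c2 (fun c21 c22 => S2 d (fun d1 d2 => S2 d2 (fun d21 d22 =>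
     (c1 ⊗ d1) ⊗ (c21 ⊗ d21) ⊗ (c22 ⊗ d22))))).
    by apply: S2_ext => c21 c22; rewrite S2_assoc; last lin.
  rewrite S2_exch; apply: S2_ext => d1 d2.
  by rewrite (S2t (F := fun a b => (c1 ⊗ d1) ⊗ a ⊗ b)); last lin.
- move: h; apply: lin_ind => [||c d]; [|exact: lin_id|].
    by apply: (lin_copt (F := fun a b => (teps a : k) *: b)); lin.
  rewrite (S2t (F := fun a b => (teps a : k) *: b)); last lin.
  transitivity (S2 c (fun c1 c2 => (ceps C c1 : k) *: (c2 ⊗ d))).
    apply: S2_ext => c1 c2; rewrite -[in RHS](S2_counitl (F := fun d => c2 ⊗ d)); last lin.
    rewrite (S2_mor (f := fun x => (ceps C c1 : k) *: x)); last lin.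
    by apply: S2_ext => d1 d2; rewrite tepsE scalerA.
  by rewrite (S2_counitl (F := fun c => c ⊗ d)); last lin.
- move: h; apply: lin_ind => [||c d]; [|exact: lin_id|].
    by apply: (lin_copt (F := fun a b => (teps b : k) *: a)); lin.
  rewrite (S2t (F := fun a b => (teps b : k) *: a)); last lin.
  transitivity (S2 c (fun c1 c2 => (ceps C c2 : k) *: (c1 ⊗ d))).
    apply: S2_ext => c1 c2; rewrite -[in RHS](S2_counitr (F := fun d => c1 ⊗ d)); last lin.
    rewrite (S2_mor (f := fun x => (ceps C c2 : k) *: x)); last lin.
    by apply: S2_ext => d1 d2; rewrite tepsE scalerA.
  by rewrite (S2_counitr (F := fun c => c ⊗ d)); last lin.
Qed.

Definition tcoalg : coalg k := Coalg tcoalgP.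

Lemma S2_tens (V : lmodType k) (F : tcoalg -> tcoalg -> V) (c : C) (d : D) : bilin F ->
  S2 (C := tcoalg) (c ⊗ d) F
  = S2 c (fun c1 c2 => S2 d (fun d1 d2 => F (c1 ⊗ d1) (c2 ⊗ d2))).
Proof. exact: S2t. Qed.

Lemma ceps_tens (c : C) (d : D) : ceps tcoalg (c ⊗ d) = ceps C c * ceps D d :> k.
Proof. exact: tepsE. Qed.

End TensCoalg.

(** * Generalised elements *)

HB.lock Definition cpair (k : fieldType) (C : coalg k) (U V : lmodType k)
    (P : {linear C -> U}) (Q : {linear C -> V}) : {linear C -> U ⨂ V} :=
  tmap P Q ∘ cdelta C.
Arguments cpair {k C U V} P Q.

(** Convolution along the bilinear operation [f]. One definition serves the product of [B], the
    action, [gamma], the product of [H] and the bimodule actions; it is locked so that words stay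
    folded during rewriting. *)
HB.lock Definition op2 (k : fieldType) (C : coalg k) (U V W : lmodType k)
    (f : {linear U ⨂ V -> W}) (P : {linear C -> U}) (Q : {linear C -> V}) :
    {linear C -> W} := f ∘ cpair P Q.
Arguments op2 {k C U V W} f P Q.

Section Points.
Variables (k : fieldType) (C : coalg k).

Lemma cpairE (U V : lmodType k) (P : {linear C -> U}) (Q : {linear C -> V}) c :
  cpair P Q c = S2 c (fun c1 c2 => P c1 ⊗ Q c2).
Proof. by rewrite cpair.unlock lcompE -S2_lift; apply: S2_ext => *; rewrite tmapE. Qed.

Lemma op2_def (U V W : lmodType k) (f : {linear U ⨂ V -> W})
  (P : {linear C -> U}) (Q : {linear C -> V}) : op2 f P Q = f ∘ cpair P Q.
Proof. by rewrite op2.unlock. Qed.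

Lemma op2_id (U V : lmodType k) (P : {linear C -> U}) (Q : {linear C -> V}) :
  op2 (idfun : {linear U ⨂ V -> U ⨂ V}) P Q = cpair P Q.
Proof. by rewrite op2_def; apply: linP_eq. Qed.

Lemma op2E (U V W : lmodType k) (f : {linear U ⨂ V -> W})
  (P : {linear C -> U}) (Q : {linear C -> V}) c :
  op2 f P Q c = S2 c (fun c1 c2 => f (P c1 ⊗ Q c2)).
Proof. by rewrite op2_def lcompE cpairE S2_mor //; lin. Qed.

Lemma op2_comp (U V W X : lmodType k) (g : {linear W -> X}) (f : {linear U ⨂ V -> W}) (P : {linear C -> U}) (Q : {linear C -> V}) :
  g ∘ op2 f P Q = op2 (g ∘ f) P Q.
Proof. by rewrite !op2_def; apply: linP_eq. Qed.

Lemma op2_compl (U U' V W : lmodType k) (f : {linear U' ⨂ V -> W})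
    (f' : {linear U ⨂ V -> W}) (g : {linear U -> U'}) (P : {linear C -> U}) (Q : {linear C -> V}) :
  (forall u v, f (g u ⊗ v) = f' (u ⊗ v)) -> op2 f (g ∘ P) Q = op2 f' P Q.
Proof. by move=> e; apply: linP_eq => c; rewrite !op2E; apply: S2_ext => *; rewrite e. Qed.

Lemma op2_compr (U V V' W : lmodType k) (f : {linear U ⨂ V' -> W})
    (f' : {linear U ⨂ V -> W}) (g : {linear V -> V'}) (P : {linear C -> U}) (Q : {linear C -> V}) :
  (forall u v, f (u ⊗ g v) = f' (u ⊗ v)) -> op2 f P (g ∘ Q) = op2 f' P Q.
Proof. by move=> e; apply: linP_eq => c; rewrite !op2E; apply: S2_ext => *; rewrite e. Qed.

(** Reassociating keeps the order of the factors of [c], so the equation is coassociativity of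
    [C]. *)
Lemma op2_assoc (U V W UV VW X : lmodType k) (f : {linear U ⨂ VW -> X})
    (f' : {linear V ⨂ W -> VW}) (g : {linear UV ⨂ W -> X}) (g' : {linear U ⨂ V -> UV}) (P : {linear C -> U}) (Q : {linear C -> V}) (R : {linear C -> W}) :
  (forall u v w, f (u ⊗ f' (v ⊗ w)) = g (g' (u ⊗ v) ⊗ w)) ->
  op2 f P (op2 f' Q R) = op2 g (op2 g' P Q) R.
Proof.
move=> e; apply: linP_eq => c; rewrite !op2E; symmetry.
transitivity (S2 c (fun c1 c2 => S2 c1 (fun c11 c12 =>
    f (P c11 ⊗ f' (Q c12 ⊗ R c2))))).
  apply: S2_ext => c1 c2; rewrite op2E (S2_mor (f := fun x => g (x ⊗ R c2))); last lin.
  by apply: S2_ext => *; rewrite e.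
rewrite S2_assoc; last lin; apply: S2_ext => c1 c2; rewrite op2E.
by rewrite (S2_mor (f := fun x => f (P c1 ⊗ x))); last lin.
Qed.

(* P and Q then behave as if they depended on different tensor factors of C. *)
Definition comm (U V : lmodType k) (P : {linear C -> U}) (Q : {linear C -> V}) : Prop :=
  forall c, S2 c (fun c1 c2 => P c1 ⊗ Q c2) = S2 c (fun c1 c2 => P c2 ⊗ Q c1).

Section Comm.
Variables (U V : lmodType k) (P : {linear C -> U}) (Q : {linear C -> V}).

Lemma commE (W : lmodType k) (F : U -> V -> W) c : comm P Q -> bilin F ->
  S2 c (fun c1 c2 => F (P c1) (Q c2)) = S2 c (fun c1 c2 => F (P c2) (Q c1)).
Proof.
move=> h /tens_lift [g gE]; have := congr1 g (h c).
rewrite !S2_mor; [|exact: lin_linear..] => e; apply: etrans (etrans e _);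
by apply: S2_ext => *; rewrite gE.
Qed.

Lemma comm_sym : comm P Q -> comm Q P.
Proof.
by move=> h c; rewrite (commE (F := fun x y => y ⊗ x)) //; lin.
Qed.

End Comm.

Lemma comm_comp (U V W : lmodType k) (P : {linear C -> U}) (Q : {linear C -> V}) (g : {linear V -> W}) :
  comm P Q -> comm P (g ∘ Q).
Proof. by move=> h c; rewrite (commE (F := fun u v => u ⊗ g v)) //; lin. Qed.

(** [P] passes [Q] and then [R]; coassociativity groups it each time with the map that it passes. *)
Lemma comm_pair (U V W : lmodType k) (P : {linear C -> U}) (Q : {linear C -> V}) (R : {linear C -> W}) :
  comm P Q -> comm P R -> comm P (cpair Q R).
Proof.
move=> hQ hR c.
transitivity (S2 c (fun c1 c2 => S2 c2 (fun c21 c22 => P c1 ⊗ (Q c21 ⊗ R c22)))).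
  apply: S2_ext => c1 c2; rewrite cpairE (S2_mor (f := fun x => P c1 ⊗ x)) //; lin.
rewrite -(S2_assoc (F := fun c1 c2 c3 => P c1 ⊗ (Q c2 ⊗ R c3))); last lin.
transitivity (S2 c (fun c1 c2 => S2 c1 (fun c11 c12 => P c12 ⊗ (Q c11 ⊗ R c2)))).
  by apply: S2_ext => c1 c2; rewrite (commE (F := fun u v => u ⊗ (v ⊗ R c2))) //; lin.
rewrite (S2_assoc (F := fun c1 c2 c3 => P c2 ⊗ (Q c1 ⊗ R c3))); last lin.
transitivity (S2 c (fun c1 c2 => S2 c2 (fun c21 c22 => P c22 ⊗ (Q c1 ⊗ R c21)))).
  by apply: S2_ext => c1 c2; rewrite (commE (F := fun u v => u ⊗ (Q c1 ⊗ v))) //; lin.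
rewrite -(S2_assoc (F := fun c1 c2 c3 => P c3 ⊗ (Q c1 ⊗ R c2))); last lin.
apply: S2_ext => c1 c2; rewrite cpairE (S2_mor (f := fun x => P c2 ⊗ x)) //; lin.
Qed.

Lemma comm_op2 (U V W X : lmodType k) (f : {linear V ⨂ W -> X})
    (P : {linear C -> U}) (Q : {linear C -> V}) (R : {linear C -> W}) :
  comm P Q -> comm P R -> comm P (op2 f Q R).
Proof. by move=> hQ hR; rewrite op2_def; apply: comm_comp; apply: comm_pair. Qed.

Lemma op2_exchr (U V W UV UW X : lmodType k) (f : {linear UV ⨂ W -> X})
    (g : {linear U ⨂ V -> UV}) (f' : {linear UW ⨂ V -> X}) (g' : {linear U ⨂ W -> UW}) (P : {linear C -> U}) (Q : {linear C -> V}) (R : {linear C -> W}) :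
  (forall u v w, f (g (u ⊗ v) ⊗ w) = f' (g' (u ⊗ w) ⊗ v)) -> comm Q R ->
  op2 f (op2 g P Q) R = op2 f' (op2 g' P R) Q.
Proof.
move=> e h; apply: linP_eq => c; rewrite !op2E.
transitivity (S2 c (fun c1 c2 => S2 c1 (fun c11 c12 => f (g (P c11 ⊗ Q c12) ⊗ R c2)))).
  by apply: S2_ext => c1 c2; rewrite op2E (S2_mor (f := fun x => f (x ⊗ R c2))) //; lin.
rewrite (S2_assoc (F := fun c1 c2 c3 => f (g (P c1 ⊗ Q c2) ⊗ R c3))); last lin.
transitivity (S2 c (fun c1 c2 => S2 c2 (fun c21 c22 => f' (g' (P c1 ⊗ R c21) ⊗ Q c22)))).
  apply: S2_ext => c1 c2; rewrite (commE (F := fun u v => f (g (P c1 ⊗ u) ⊗ v))) //; last lin.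
  by apply: S2_ext => *; rewrite e.
rewrite -(S2_assoc (F := fun c1 c2 c3 => f' (g' (P c1 ⊗ R c2) ⊗ Q c3))); last lin.
by apply: S2_ext => c1 c2; rewrite op2E (S2_mor (f := fun x => f' (x ⊗ Q c2))) //; lin.
Qed.

Lemma op2_exchl (U V W VW UW X : lmodType k) (f : {linear U ⨂ VW -> X})
    (g : {linear V ⨂ W -> VW}) (f' : {linear V ⨂ UW -> X}) (g' : {linear U ⨂ W -> UW}) (P : {linear C -> U}) (Q : {linear C -> V}) (R : {linear C -> W}) :
  (forall u v w, f (u ⊗ g (v ⊗ w)) = f' (v ⊗ g' (u ⊗ w))) -> comm P Q ->
  op2 f P (op2 g Q R) = op2 f' Q (op2 g' P R).
Proof.
move=> e h; apply: linP_eq => c; rewrite !op2E.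
transitivity (S2 c (fun c1 c2 => S2 c2 (fun c21 c22 => f (P c1 ⊗ g (Q c21 ⊗ R c22))))).
  by apply: S2_ext => c1 c2; rewrite op2E (S2_mor (f := fun x => f (P c1 ⊗ x))) //; lin.
rewrite -(S2_assoc (F := fun c1 c2 c3 => f (P c1 ⊗ g (Q c2 ⊗ R c3)))); last lin.
transitivity (S2 c (fun c1 c2 => S2 c1 (fun c11 c12 => f' (Q c11 ⊗ g' (P c12 ⊗ R c2))))).
  apply: S2_ext => c1 c2; rewrite (commE (F := fun u v => f (u ⊗ g (v ⊗ R c2)))) //; last lin.
  by apply: S2_ext => *; rewrite e.
rewrite (S2_assoc (F := fun c1 c2 c3 => f' (Q c1 ⊗ g' (P c2 ⊗ R c3)))); last lin.
by apply: S2_ext => c1 c2; rewrite op2E (S2_mor (f := fun x => f' (Q c1 ⊗ x))) //; lin.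
Qed.

Lemma cst_ex (U : lmodType k) (u : U) : exists g : {linear C -> U}, forall c, g c = (ceps C c : k) *: u.
Proof.
suff h : lin (fun c => (ceps C c : k) *: u) by exists (mklin h).
lin.
Qed.
(** A constant function is not linear; its place among the letters is taken by eps(c) u, which
    commutes with every map. *)
Definition cst (U : lmodType k) (u : U) : {linear C -> U} := projT1 (cid (cst_ex u)).
Lemma cstE (U : lmodType k) (u : U) c : cst u c = (ceps C c : k) *: u.
Proof. by rewrite /cst; case: cid. Qed.

Lemma op2_cstl (U V W : lmodType k) (f : {linear U ⨂ V -> W}) (g : {linear V -> W}) u (Q : {linear C -> V}) :
  (forall v, f (u ⊗ v) = g v) -> op2 f (cst u) Q = g ∘ Q.
Proof.
move=> e; apply: linP_eq => c; rewrite op2E /= -(S2_counitl (F := fun c => g (Q c))); last lin.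
by apply: S2_ext => c1 c2; rewrite cstE Tensor.pureZl linearZ e.
Qed.

Lemma op2_cstr (U V W : lmodType k) (f : {linear U ⨂ V -> W}) (g : {linear U -> W}) (P : {linear C -> U}) v :
  (forall u, f (u ⊗ v) = g u) -> op2 f P (cst v) = g ∘ P.
Proof.
move=> e; apply: linP_eq => c; rewrite op2E /= -(S2_counitr (F := fun c => g (P c))); last lin.
by apply: S2_ext => c1 c2; rewrite cstE Tensor.pureZr linearZ e.
Qed.

Lemma op2_idl (U V : lmodType k) (f : {linear U ⨂ V -> V}) u (Q : {linear C -> V}) :
  (forall v, f (u ⊗ v) = v) -> op2 f (cst u) Q = Q.
Proof. by move=> e; rewrite (op2_cstl (g := idfun)) //; apply: linP_eq. Qed.

Lemma op2_idr (U V : lmodType k) (f : {linear U ⨂ V -> U}) v (P : {linear C -> U}) :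
  (forall u, f (u ⊗ v) = u) -> op2 f P (cst v) = P.
Proof. by move=> e; rewrite (op2_cstr (g := idfun)) //; apply: linP_eq. Qed.

Lemma comp_cst (U V : lmodType k) (g : {linear U -> V}) u : g ∘ cst u = cst (g u).
Proof. by apply: linP_eq => c; rewrite /= !cstE linearZ. Qed.

Lemma comm_cst (U V : lmodType k) (P : {linear C -> U}) (v : V) : comm P (cst v).
Proof.
move=> c; transitivity (P c ⊗ v).
  rewrite -[RHS](S2_counitr (F := fun c => P c ⊗ v)); last lin.
  by apply: S2_ext => *; rewrite cstE Tensor.pureZr.
rewrite -[LHS](S2_counitl (F := fun c => P c ⊗ v)); last lin.
by apply: S2_ext => *; rewrite cstE Tensor.pureZr.
Qed.

(** Coalgebra maps into [D]. Several occurrences of such an [x] in a word stand for consecutive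
    Sweedler factors of one element. *)
Definition cpt (D : coalg k) (x : {linear C -> D}) : Prop :=
  (forall c, S2 (x c) (fun d1 d2 => d1 ⊗ d2) = S2 c (fun c1 c2 => x c1 ⊗ x c2))
  /\ forall c, ceps D (x c) = ceps C c.

Lemma cptE (D : coalg k) (x : {linear C -> D}) (V : lmodType k) (F : D -> D -> V) c :
  cpt x -> bilin F -> S2 (x c) F = S2 c (fun c1 c2 => F (x c1) (x c2)).
Proof.
case=> h _ /tens_lift [g gE]; have := congr1 g (h c).
rewrite !S2_mor; [|exact: lin_linear..] => e; apply: etrans (etrans _ e) _;
by apply: S2_ext => *; rewrite gE.
Qed.

Lemma cst_cpt (D : coalg k) (x : {linear C -> D}) (U : lmodType k) (u : U) c :
  cpt x -> (ceps D (x c) : k) *: u = cst u c.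
Proof. by case=> _ e; rewrite e cstE. Qed.

(** If [f] distributes over products in the manner of a measuring, so does convolution along [f] by
    a coalgebra map [x]. The copy of [x] that goes to [Q] has to pass [P], whence the commutation
    hypothesis. *)
Lemma op2_distr (D : coalg k) (V1 V2 V W1 W2 W : lmodType k) (m : {linear V1 ⨂ V2 -> V})
    (n : {linear W1 ⨂ W2 -> W}) (f : {linear D ⨂ V -> W}) (f1 : {linear D ⨂ V1 -> W1})
    (f2 : {linear D ⨂ V2 -> W2}) (x : {linear C -> D}) (P : {linear C -> V1}) (Q : {linear C -> V2}) :
  (forall h v1 v2, f (h ⊗ m (v1 ⊗ v2)) = S2 h (fun h1 h2 => n (f1 (h1 ⊗ v1) ⊗ f2 (h2 ⊗ v2)))) ->
  cpt x -> comm x P ->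
  op2 f x (op2 m P Q) = op2 n (op2 f1 x P) (op2 f2 x Q).
Proof.
move=> e hx hP; apply: linP_eq => c; rewrite !op2E.
transitivity (S2 c (fun c1 c2 => S2 c1 (fun c11 c12 => S2 c2 (fun c21 c22 =>
    n (f1 (x c11 ⊗ P c21) ⊗ f2 (x c12 ⊗ Q c22)))))).
  apply: S2_ext => c1 c2; rewrite S2_exch op2E (S2_mor (f := fun y => f (x c1 ⊗ y))); last lin.
  apply: S2_ext => c21 c22; rewrite e.
  by rewrite (cptE (F := fun a b => n (f1 (a ⊗ P c21) ⊗ f2 (b ⊗ Q c22)))) //; lin.
transitivity (S2 c (fun c1 c2 => S2 c2 (fun c2 c3 => S2 c2 (fun c21 c22 =>
    n (f1 (x c1 ⊗ P c21) ⊗ f2 (x c22 ⊗ Q c3)))))).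
  rewrite (S2_assoc (F := fun c1 c2 c3 => S2 c3 (fun c31 c32 => n (f1 (x c1 ⊗ P c31) ⊗ f2 (x c2 ⊗ Q c32))))); last lin.
  apply: S2_ext => c1 c2.
  rewrite -(S2_assoc (F := fun a b d => n (f1 (x c1 ⊗ P b) ⊗ f2 (x a ⊗ Q d)))); last lin.
  apply: S2_ext => c3 c4.
  by rewrite (commE (F := fun a b => n (f1 (x c1 ⊗ b) ⊗ f2 (a ⊗ Q c4)))) //; lin.
symmetry; transitivity (S2 c (fun c1 c2 => S2 c1 (fun c11 c12 => S2 c2 (fun c21 c22 =>
    n (f1 (x c11 ⊗ P c12) ⊗ f2 (x c21 ⊗ Q c22)))))).
  apply: S2_ext => c1 c2; rewrite S2_exch (op2E f2) (S2_mor (f := fun y => n (op2 f1 x P c1 ⊗ y))); last lin.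
  by apply: S2_ext => c21 c22; rewrite op2E (S2_mor (f := fun y => n (y ⊗ f2 (x c21 ⊗ Q c22)))); last lin.
rewrite (S2_assoc (F := fun c1 c2 c3 => S2 c3 (fun c31 c32 => n (f1 (x c1 ⊗ P c2) ⊗ f2 (x c31 ⊗ Q c32))))); last lin.
apply: S2_ext => c1 c2.
by rewrite -(S2_assoc (F := fun a b d => n (f1 (x c1 ⊗ P a) ⊗ f2 (x b ⊗ Q d)))); last lin.
Qed.

End Points.

(** Identities proved at the projections of a tensor power of [H] reach arbitrary points by pullback
    along the pairing of these points. *)
Lemma op2_pull (k : fieldType) (C D : coalg k) (x : {linear C -> D}) (U V W : lmodType k)
    (f : {linear U ⨂ V -> W}) (P : {linear D -> U}) (Q : {linear D -> V}) :
  cpt x -> op2 f P Q ∘ x = op2 f (P ∘ x) (Q ∘ x).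
Proof.
move=> hx; apply: linP_eq => c; rewrite lcompE !op2E.
by rewrite (cptE (F := fun a b => f (P a ⊗ Q b))) //; lin.
Qed.

Section MorePoints.
Variables (k : fieldType) (C : coalg k).

(** The coproduct of the pair has its Sweedler indices in the order x x y y, two copies of the pair
    have x y x y; one interchange of [x] and [y] relates them. *)
Lemma cpt_pair (D E : coalg k) (x : {linear C -> D}) (y : {linear C -> E}) :
  cpt x -> cpt y -> comm x y -> cpt (D := tcoalg D E) (cpair x y).
Proof.
move=> hx hy h; split=> c; last first.
  rewrite cpairE (S2_mor (f := fun z => ceps (tcoalg D E) z)); last lin.
  rewrite -[RHS](S2_counitr (F := ceps C)) //; last lin.
  by apply: S2_ext => c1 c2; rewrite ceps_tens hx.2 hy.2 mulrC.
rewrite cpairE (S2_mor (f := fun z => S2 z (fun d1 d2 : tcoalg D E => d1 ⊗ d2))); last lin.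
transitivity (S2 c (fun c1 c2 => S2 c1 (fun c11 c12 => S2 c2 (fun c21 c22 =>
    (x c11 ⊗ y c21) ⊗ (x c12 ⊗ y c22))))).
  apply: S2_ext => c1 c2; rewrite S2_tens; last lin.
  rewrite (cptE (F := fun a b => S2 (y c2) (fun d1 d2 => (a ⊗ d1) ⊗ (b ⊗ d2)))) //; last lin.
  apply: S2_ext => c11 c12.
  by rewrite (cptE (F := fun a b => (x c11 ⊗ a) ⊗ (x c12 ⊗ b))) //; last lin.
rewrite (S2_assoc (F := fun c1 c2 c3 => S2 c3 (fun c31 c32 => (x c1 ⊗ y c31) ⊗ (x c2 ⊗ y c32)))); last lin.
symmetry; transitivity (S2 c (fun c1 c2 => S2 c1 (fun c11 c12 => S2 c2 (fun c21 c22 =>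
    (x c11 ⊗ y c12) ⊗ (x c21 ⊗ y c22))))).
  apply: S2_ext => c1 c2; rewrite S2_exch (cpairE x y c2) (S2_mor (f := fun z => _ ⊗ z)); last lin.
  by apply: S2_ext => c21 c22; rewrite cpairE (S2_mor (f := fun z => z ⊗ _)); last lin.
rewrite (S2_assoc (F := fun c1 c2 c3 => S2 c3 (fun c31 c32 => (x c1 ⊗ y c2) ⊗ (x c31 ⊗ y c32)))); last lin.
apply: S2_ext => c1 c2.
rewrite -(S2_assoc (F := fun a b d => (x c1 ⊗ y a) ⊗ (x b ⊗ y d))); last lin.
rewrite -(S2_assoc (F := fun a b d => (x c1 ⊗ y b) ⊗ (x a ⊗ y d))); last lin.
apply: S2_ext => c3 c4.
by rewrite (commE (F := fun a b => (x c1 ⊗ b) ⊗ (a ⊗ y c4))) //; lin.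
Qed.

Lemma cpt_comp (D E : coalg k) (x : {linear C -> D}) (f : {linear D -> E}) :
  cpt x -> cpt f -> cpt (f ∘ x).
Proof.
move=> hx hf; split=> c /=; last by rewrite hf.2 hx.2.
by rewrite (cptE (F := fun a b => a ⊗ b) _ hf) ?(cptE (F := fun a b => f a ⊗ f b)) //; lin.
Qed.

Lemma cpt_id : cpt (D := C) (idfun : {linear C -> C}).
Proof. by []. Qed.

Lemma cpt_cst (D : coalg k) (u : D) :
  (S2 u (fun d1 d2 => d1 ⊗ d2) = u ⊗ u) -> ceps D u = 1 -> cpt (D := D) (cst C u).
Proof.
move=> hu eu; split=> c; last by rewrite cstE linearZ /= eu; apply: mulr1.
rewrite cstE; transitivity ((ceps C c : k) *: S2 u (fun d1 d2 => d1 ⊗ d2)).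
  by have /linZ -> : lin (fun x : D => S2 x (fun d1 d2 => d1 ⊗ d2)) by lin.
rewrite hu -(S2_counitl (F := fun c => (ceps C c : k) *: (u ⊗ u))); last lin.
by apply: S2_ext => c1 c2; rewrite !cstE Tensor.pureZl Tensor.pureZr.
Qed.

End MorePoints.

(** * Projections of a tensor product of coalgebras *)

Section Proj.
Variables (k : fieldType) (C D : coalg k).

Lemma prl_ex : exists g : {linear tcoalg C D -> C}, forall c d, g (c ⊗ d) = (ceps D d : k) *: c.
Proof. apply: (tens_lift (F := fun c d => (ceps D d : k) *: c)); lin. Qed.
Definition prl := projT1 (cid prl_ex).
Lemma prlE c d : prl (c ⊗ d) = (ceps D d : k) *: c.
Proof. by rewrite /prl; case: cid. Qed.

Lemma prr_ex : exists g : {linear tcoalg C D -> D}, forall c d, g (c ⊗ d) = (ceps C c : k) *: d.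
Proof. apply: (tens_lift (F := fun c d => (ceps C c : k) *: d)); lin. Qed.
Definition prr := projT1 (cid prr_ex).
Lemma prrE c d : prr (c ⊗ d) = (ceps C c : k) *: d.
Proof. by rewrite /prr; case: cid. Qed.

Lemma op2_tens (U V W : lmodType k) (f : {linear U ⨂ V -> W})
    (P : {linear tcoalg C D -> U}) (Q : {linear tcoalg C D -> V}) c d :
  op2 f P Q (c ⊗ d)
  = S2 c (fun c1 c2 => S2 d (fun d1 d2 => f (P (c1 ⊗ d1) ⊗ Q (c2 ⊗ d2)))).
Proof. by rewrite op2E S2_tens //; lin. Qed.

(** A letter that factors through a projection splits only the variable that it sees, the counit
    collapsing the other sum. The closed formulas obtain their numbers of Sweedler factors in this
    way. *)
Lemma op2_tens_prll (U V W : lmodType k) (f : {linear U ⨂ V -> W})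
    (P : {linear C -> U}) (Q : {linear tcoalg C D -> V}) c d :
  op2 f (P ∘ prl) Q (c ⊗ d) = S2 c (fun c1 c2 => f (P c1 ⊗ Q (c2 ⊗ d))).
Proof.
rewrite op2_tens; apply: S2_ext => c1 c2.
rewrite -(S2_counitl (F := fun d => f (P c1 ⊗ Q (c2 ⊗ d)))); last lin.
by apply: S2_ext => d1 d2; rewrite /= prlE linearZ Tensor.pureZl linearZ.
Qed.

Lemma op2_tens_prlr (U V W : lmodType k) (f : {linear U ⨂ V -> W})
    (P : {linear tcoalg C D -> U}) (Q : {linear C -> V}) c d :
  op2 f P (Q ∘ prl) (c ⊗ d) = S2 c (fun c1 c2 => f (P (c1 ⊗ d) ⊗ Q c2)).
Proof.
rewrite op2_tens; apply: S2_ext => c1 c2.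
rewrite -(S2_counitr (F := fun d => f (P (c1 ⊗ d) ⊗ Q c2))); last lin.
by apply: S2_ext => d1 d2; rewrite /= prlE linearZ Tensor.pureZr linearZ.
Qed.

Lemma op2_tens_prrr (U V W : lmodType k) (f : {linear U ⨂ V -> W})
    (P : {linear tcoalg C D -> U}) (Q : {linear D -> V}) c d :
  op2 f P (Q ∘ prr) (c ⊗ d) = S2 d (fun d1 d2 => f (P (c ⊗ d1) ⊗ Q d2)).
Proof.
rewrite op2_tens S2_exch; apply: S2_ext => d1 d2.
rewrite -(S2_counitr (F := fun c => f (P (c ⊗ d1) ⊗ Q d2))); last lin.
by apply: S2_ext => c1 c2; rewrite /= prrE linearZ Tensor.pureZr linearZ.
Qed.

Lemma pair_prl_prr (U V : lmodType k) (P : {linear C -> U}) (Q : {linear D -> V}) c d :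
  cpair (P ∘ prl) (Q ∘ prr) (c ⊗ d) = P c ⊗ Q d.
Proof.
rewrite -op2_id.
rewrite op2_tens_prll -[RHS](S2_counitr (F := fun c => P c ⊗ Q d)); last lin.
by apply: S2_ext => c1 c2; rewrite /= prrE linearZ Tensor.pureZr.
Qed.

(** The counit deletes the variable that a map does not see, so in both orders the sum collapses to
    [P c ⊗ Q d]. *)
Lemma comm_prl_prr (U V : lmodType k) (P : {linear C -> U}) (Q : {linear D -> V}) :
  comm (P ∘ prl) (Q ∘ prr).
Proof.
move=> z; rewrite -cpairE; move: z; apply: lin_ind => [||c d]; [lin..|].
rewrite pair_prl_prr S2_tens; last lin.
rewrite -[LHS](S2_counitl (F := fun c => P c ⊗ Q d)); last lin.
apply: S2_ext => c1 c2; rewrite -[P c2 ⊗ Q d](S2_counitr (F := fun d => P c2 ⊗ Q d)); last lin.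
rewrite (S2_mor (f := fun x => (ceps C c1 : k) *: x)); last lin.
apply: S2_ext => d1 d2; rewrite /= prlE prrE (linZ (lin_linear P)) (linZ (lin_linear Q)) Tensor.pureZl Tensor.pureZr.
by rewrite !scalerA mulrC.
Qed.

Lemma cpt_prl : cpt prl.
Proof.
split=> z; move: z; last first.
  apply: lin_ind => [||c d]; [exact/lin_app/lin_linear|exact: lin_linear|].
  by rewrite prlE linearZ ceps_tens; apply: mulrC.
apply: lin_ind => [||c d]; [lin..|].
  rewrite S2_tens; last lin.
  rewrite prlE (linZ (f := fun c => S2 c (fun a b => a ⊗ b))); last lin.
  rewrite -(S2_counitl (F := fun d => (ceps D d : k) *: S2 c (fun a b => a ⊗ b))); last lin.
  rewrite S2_exch; apply: S2_ext => d1 d2.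
  rewrite scalerA (S2_mor (f := fun x => (ceps D d1 * ceps D d2 : k) *: x)); last lin.
  by apply: S2_ext => c1 c2; rewrite !prlE Tensor.pureZl Tensor.pureZr scalerA.
Qed.

Lemma cpt_prr : cpt prr.
Proof.
split=> z; move: z; last first.
  apply: lin_ind => [||c d]; [exact/lin_app/lin_linear|exact: lin_linear|].
  by rewrite prrE linearZ ceps_tens.
apply: lin_ind => [||c d]; [lin..|].
  rewrite S2_tens; last lin.
  rewrite prrE (linZ (f := fun c => S2 c (fun a b => a ⊗ b))); last lin.
  rewrite -(S2_counitl (F := fun c => (ceps C c : k) *: S2 d (fun a b => a ⊗ b))); last lin.
  apply: S2_ext => d1 d2.
  rewrite scalerA (S2_mor (f := fun x => (ceps C d1 * ceps C d2 : k) *: x)); last lin.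
  by apply: S2_ext => c1 c2; rewrite !prrE Tensor.pureZl Tensor.pureZr scalerA.
Qed.
End Proj.

Global Opaque tmap cst prl prr tdelta teps.

Section CommMore.
Variables (k : fieldType) (C : coalg k).

Lemma comm_compl (U V W : lmodType k) (P : {linear C -> U}) (Q : {linear C -> V}) (g : {linear V -> W}) :
  comm Q P -> comm (g ∘ Q) P.
Proof. by move=> h; apply/comm_sym/comm_comp/comm_sym. Qed.

Lemma comm_pairl (U V W : lmodType k) (P : {linear C -> U}) (Q : {linear C -> V}) (R : {linear C -> W}) :
  comm Q P -> comm R P -> comm (cpair Q R) P.
Proof. by move=> h1 h2; apply/comm_sym/comm_pair; apply: comm_sym. Qed.

Lemma comm_op2l (U V W X : lmodType k) (f : {linear V ⨂ W -> X})
    (P : {linear C -> U}) (Q : {linear C -> V}) (R : {linear C -> W}) :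
  comm Q P -> comm R P -> comm (op2 f Q R) P.
Proof. by move=> h1 h2; apply/comm_sym/comm_op2; apply: comm_sym. Qed.

Lemma comm_cstl (U V : lmodType k) (P : {linear C -> U}) (v : V) : comm (cst C v) P.
Proof. exact/comm_sym/comm_cst. Qed.

Lemma cpt_op2 (D1 D2 E : coalg k) (f : {linear D1 ⨂ D2 -> E})
    (x : {linear C -> D1}) (y : {linear C -> D2}) :
  cpt (C := tcoalg D1 D2) (D := E) f -> cpt x -> cpt y -> comm x y -> cpt (D := E) (op2 f x y).
Proof. by move=> hf hx hy h; rewrite op2_def; apply: (cpt_comp (D := tcoalg D1 D2)) hf; apply: cpt_pair. Qed.

End CommMore.

Ltac cm_hook := fail.

(** Commutation and being a coalgebra map pass from letters to words, so these side conditions are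
    settled by recursion on the word, down to the hypotheses on its letters. *)
Ltac cm :=
  lazymatch goal with
  | |- comm _ _ =>
    first
    [ assumption
    | apply: comm_sym; assumption
    | apply: comm_cst | apply: comm_cstl
    | apply: comm_op2; cm | apply: comm_op2l; cm
    | apply: comm_pair; cm | apply: comm_pairl; cm
    | apply: comm_comp; cm | apply: comm_compl; cm
    | cm_hook; cm ]
  | |- cpt _ =>
    first
    [ assumption
    | cm_hook; cm
    | apply: cpt_op2; cm
    | apply: cpt_pair; cm ]
  end.

(** * The convolution algebra of maps into B *)

Section Mult.
Variables (k : fieldType) (B : algType k).

Lemma mulB_ex : exists g : {linear B ⨂ B -> B}, forall u v, g (u ⊗ v) = u * v.
Proof. apply: tens_lift; lin. Qed.
Definition mulB := projT1 (cid mulB_ex).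
Lemma mulBE u v : mulB (u ⊗ v) = u * v.
Proof. by rewrite /mulB; case: cid. Qed.

Variable U : lmodType k.
Lemma scl_ex : exists g : {linear k^o ⨂ U -> U}, forall a u, g (a ⊗ u) = (a : k) *: u.
Proof. apply: (tens_lift (U := k^o) (F := fun (a : k^o) u => (a : k) *: u)); lin. Qed.
Definition scl := projT1 (cid scl_ex).
Lemma sclE a u : scl (a ⊗ u) = (a : k) *: u.
Proof. by rewrite /scl; case: cid. Qed.

Lemma scr_ex : exists g : {linear U ⨂ k^o -> U}, forall u a, g (u ⊗ a) = (a : k) *: u.
Proof. apply: (tens_lift (V := k^o) (F := fun u (a : k^o) => (a : k) *: u)); lin. Qed.
Definition scr := projT1 (cid scr_ex).
Lemma scrE u a : scr (u ⊗ a) = (a : k) *: u.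
Proof. by rewrite /scr; case: cid. Qed.

Lemma sca_ex : exists g : {linear k^o -> B}, forall a, g a = (a : k) *: 1.
Proof.
suff h : lin (fun a : k^o => (a : k) *: (1 : B)) by exists (mklin h).
by apply: lin_scalel; apply: lin_id.
Qed.
(** Makes the field-valued [phi] and its inverse letters of words with values in [B]. *)
Definition sca := projT1 (cid sca_ex).
Lemma scaE a : sca a = (a : k) *: 1.
Proof. by rewrite /sca; case: cid. Qed.

End Mult.

Section Conv.
Variables (k : fieldType) (C : coalg k) (B : algType k).
Implicit Types u v w : {linear C -> B}.

Lemma convA u v w : op2 (mulB B) u (op2 (mulB B) v w) = op2 (mulB B) (op2 (mulB B) u v) w.
Proof. by apply: op2_assoc => *; rewrite !mulBE mulrA. Qed.

Lemma conv1 u : op2 (mulB B) (cst C 1) u = u.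
Proof. by apply: op2_idl => v; rewrite mulBE mul1r. Qed.

Lemma convr1 u : op2 (mulB B) u (cst C 1) = u.
Proof. by apply: op2_idr => v; rewrite mulBE mulr1. Qed.

Lemma conv_cst (a b : B) : op2 (mulB B) (cst C a) (cst C b) = cst C (a * b).
Proof.
have [g gE] : exists g : {linear B -> B}, forall x, g x = a * x.
  by have h : lin (fun x => a * x) by [lin]; exists (mklin h).
rewrite (op2_cstl (g := g)); last by move=> v; rewrite mulBE gE.
by rewrite comp_cst gE.
Qed.
End Conv.

Section Eval.
Variables (k : fieldType) (C D E F : coalg k).

Lemma S2_tens3 (V : lmodType k) (f : tcoalg (tcoalg C D) E -> tcoalg (tcoalg C D) E -> V) c d e :
  bilin f ->
  S2 (C := tcoalg (tcoalg C D) E) (c ⊗ d ⊗ e) f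
  = S2 c (fun c1 c2 => S2 d (fun d1 d2 => S2 e (fun e1 e2 =>
      f (c1 ⊗ d1 ⊗ e1) (c2 ⊗ d2 ⊗ e2)))).
Proof.
move=> hf; have [g gE] := tens_lift hf.
transitivity (S2 (C := tcoalg (tcoalg C D) E) (c ⊗ d ⊗ e) (fun a b => g (a ⊗ b))).
  by apply: S2_ext => *; rewrite gE.
rewrite S2_tens; last lin; rewrite S2_tens; last lin.
by apply: S2_ext => ? ?; apply: S2_ext => ? ?; apply: S2_ext => ? ?; rewrite gE.
Qed.

Lemma op2_tens3 (U V W : lmodType k) (f : {linear U ⨂ V -> W})
    (P : {linear tcoalg (tcoalg C D) E -> U}) (Q : {linear tcoalg (tcoalg C D) E -> V}) c d e :
  op2 f P Q (c ⊗ d ⊗ e)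
  = S2 c (fun c1 c2 => S2 d (fun d1 d2 => S2 e (fun e1 e2 =>
      f (P (c1 ⊗ d1 ⊗ e1) ⊗ Q (c2 ⊗ d2 ⊗ e2))))).
Proof. by rewrite op2_tens S2_tens; last lin. Qed.

Lemma op2_tens4 (U V W : lmodType k) (f : {linear U ⨂ V -> W})
    (P : {linear tcoalg (tcoalg (tcoalg C D) E) F -> U})
    (Q : {linear tcoalg (tcoalg (tcoalg C D) E) F -> V}) c d e x :
  op2 f P Q (c ⊗ d ⊗ e ⊗ x)
  = S2 c (fun c1 c2 => S2 d (fun d1 d2 => S2 e (fun e1 e2 => S2 x (fun x1 x2 =>
      f (P (c1 ⊗ d1 ⊗ e1 ⊗ x1) ⊗ Q (c2 ⊗ d2 ⊗ e2 ⊗ x2)))))).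
Proof. by rewrite op2_tens !S2_tens; [|lin|lin]. Qed.

Lemma prl_pair (K : coalg k) (x : {linear K -> C}) (y : {linear K -> D}) : cpt y ->
  prl C D ∘ cpair x y = x.
Proof.
move=> hy; apply: linP_eq => c; rewrite lcompE cpairE S2_mor; last lin.
rewrite -[RHS](S2_counitr (F := fun c => x c)); last lin.
by apply: S2_ext => c1 c2; rewrite prlE hy.2.
Qed.

Lemma prr_pair (K : coalg k) (x : {linear K -> C}) (y : {linear K -> D}) : cpt x ->
  prr C D ∘ cpair x y = y.
Proof.
move=> hy; apply: linP_eq => c; rewrite lcompE cpairE S2_mor; last lin.
rewrite -[RHS](S2_counitl (F := fun c => y c)); last lin.
by apply: S2_ext => c1 c2; rewrite prrE hy.2.
Qed.

End Eval.

Lemma tmap_pair (k : fieldType) (C : coalg k) (U V U' V' : lmodType k) (f : {linear U -> U'})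
    (g : {linear V -> V'}) (P : {linear C -> U}) (Q : {linear C -> V}) :
  tmap f g ∘ cpair P Q = cpair (f ∘ P) (g ∘ Q).
Proof.
apply: linP_eq => c; rewrite lcompE !cpairE S2_mor; last lin.
by apply: S2_ext => *; rewrite tmapE.
Qed.

Lemma pair_compl (k : fieldType) (C : coalg k) (U V U' : lmodType k) (f : {linear U -> U'})
    (P : {linear C -> U}) (Q : {linear C -> V}) :
  cpair (f ∘ P) Q = tmap f idfun ∘ cpair P Q.
Proof. by rewrite tmap_pair; congr cpair; apply: linP_eq. Qed.

Lemma lcompA (k : fieldType) (U V W X : lmodType k) (f : {linear W -> X}) (g : {linear V -> W})
  (h : {linear U -> V}) : f ∘ (g ∘ h) = f ∘ g ∘ h.
Proof. exact: linP_eq. Qed.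

Lemma op2_flat (k : fieldType) (C : coalg k) (U V W VW X : lmodType k) (f : {linear U ⨂ VW -> X})
    (f' : {linear V ⨂ W -> VW}) (g : {linear U ⨂ V ⨂ W -> X})
    (P : {linear C -> U}) (Q : {linear C -> V}) (R : {linear C -> W}) :
  (forall u v w, f (u ⊗ f' (v ⊗ w)) = g (u ⊗ v ⊗ w)) ->
  op2 f P (op2 f' Q R) = g ∘ cpair (cpair P Q) R.
Proof.
move=> e; have -> : cpair P Q = op2 (idfun : {linear U ⨂ V -> U ⨂ V}) P Q by rewrite op2_id.
by rewrite -op2_def; apply: op2_assoc.
Qed.

Lemma pair_flat (k : fieldType) (C : coalg k) (U V W VW : lmodType k)
    (f : {linear V ⨂ W -> VW}) (g : {linear U ⨂ V ⨂ W -> U ⨂ VW})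
    (P : {linear C -> U}) (Q : {linear C -> V}) (R : {linear C -> W}) :
  (forall u v w, u ⊗ f (v ⊗ w) = g (u ⊗ v ⊗ w)) ->
  cpair P (op2 f Q R) = g ∘ cpair (cpair P Q) R.
Proof.
by move=> e; rewrite -(op2_flat (f := idfun) (f' := f)) // op2_id.
Qed.

Lemma pair_comp_id (k : fieldType) (C : coalg k) (U V V' : lmodType k) (f : {linear V -> V'})
    (P : {linear C -> U}) (Q : {linear C -> V}) :
  tmap f idfun ∘ cpair Q P = cpair (f ∘ Q) P.
Proof. by rewrite tmap_pair; congr cpair; apply: linP_eq. Qed.

Lemma sw_S2 (k : fieldType) (C : coalg k) (V : lmodType k) n (F : nfun C V n.+2) (c : C) :
  sw (cop (cdelta C)) n.+1 F c
  = S2 c (fun c1 c2 => sw (cop (cdelta C)) n (F c1) c2).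
Proof. by []. Qed.

Global Opaque mulB scl scr sca.

(** A word depends linearly on its parameters, such as the constants b in [cst C b]; maps on tensor
    products are later defined by words with parameters. *)
Lemma lin_op2l (k : fieldType) (C : coalg k) (X U V W : lmodType k) (f : {linear U ⨂ V -> W})
    (P : X -> {linear C -> U}) (Q : {linear C -> V}) c :
  (forall c, lin (fun x => P x c)) -> lin (fun x => op2 f (P x) Q c).
Proof.
move=> h a x y; rewrite !op2E.
have hs : lin (fun x => S2 c (fun c1 c2 => f (P x c1 ⊗ Q c2))).
  by apply: lin_S2 => c1 c2; apply: lin_app; apply: lin_tensl.
exact: hs.
Qed.

Lemma lin_op2r (k : fieldType) (C : coalg k) (X U V W : lmodType k) (f : {linear U ⨂ V -> W})
    (P : {linear C -> U}) (Q : X -> {linear C -> V}) c :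
  (forall c, lin (fun x => Q x c)) -> lin (fun x => op2 f P (Q x) c).
Proof.
move=> h a x y; rewrite !op2E.
have hs : lin (fun x => S2 c (fun c1 c2 => f (P c1 ⊗ Q x c2))).
  by apply: lin_S2 => c1 c2; apply: lin_app; apply: lin_tensr.
exact: hs.
Qed.

Lemma lin_cst (k : fieldType) (C : coalg k) (U V : lmodType k) (f : U -> V) c :
  lin f -> lin (fun x => cst C (f x) c).
Proof. by move=> h a x y; rewrite !cstE h scalerDr !scalerA mulrC. Qed.

Ltac lin_hook ::=
  lazymatch goal with
  | |- lin (fun _ => GRing.Linear.sort (op2 _ _ ?Q) ?c) => apply: lin_op2l
  | |- lin (fun _ => GRing.Linear.sort (op2 _ ?P _) ?c) => apply: lin_op2r
  | |- lin (fun _ => GRing.Linear.sort (cst _ _) ?c) => apply: lin_cst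
  end.

(* Exchanges independent sums on the left until their order is that of the right. *)
Ltac s2pull c :=
  lazymatch goal with
  | |- S2 c _ = _ => reflexivity
  | |- S2 _ _ = _ => etransitivity; [apply: S2_ext => ? ?; cbv beta; s2pull c | exact: S2_exch]
  end.

Ltac s2match :=
  lazymatch goal with
  | |- _ = S2 ?c _ => etransitivity; [s2pull c | apply: S2_ext => ? ?; cbv beta; s2match]
  | |- _ => idtac
  end.

(** * Linear maps on tensor products of several triples *)

Section Lifts.
Variable k : fieldType.

Lemma trilin_add (W1 W2 W3 X : lmodType k) (F G : W1 -> W2 -> W3 -> X) :
  trilin F -> trilin G -> trilin (fun a b c => F a b c + G a b c).
Proof. by case=> ? ? ? [? ? ?]; split=> *; apply: lin_add. Qed.

Lemma trilin_tens (U V W1 W2 W3 X : lmodType k) (G : W1 -> W2 -> W3 -> U ⨂ V -> X) :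
  (forall a b c, lin (G a b c)) ->
  (forall u v, trilin (fun a b c => G a b c (u ⊗ v))) ->
  forall t, trilin (fun a b c => G a b c t).
Proof.
move=> hG h; elim/tens_ind=> // x y hx hy.
have e a b c : G a b c (x + y) = G a b c x + G a b c y by rewrite linD.
case: (trilin_add hx hy) => h1 h2 h3.
split=> [b c|a c|a b] s u v; rewrite !e; [exact: h1|exact: h2|exact: h3].
Qed.

Lemma trilin_tens3 (U V Z W1 W2 W3 X : lmodType k) (G : W1 -> W2 -> W3 -> U ⨂ V ⨂ Z -> X) :
  (forall a b c, lin (G a b c)) ->
  (forall u v z, trilin (fun a b c => G a b c (u ⊗ v ⊗ z))) ->
  forall t, trilin (fun a b c => G a b c t).
Proof.
move=> hG h; apply: trilin_tens => // uv z; move: uv.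
apply: (trilin_tens (G := fun a b c t => G a b c (t ⊗ z))) => // a b c.
by apply: (lin_comp (g := G a b c)) => //; apply: lin_tensl; apply: lin_id.
Qed.

(** Adds one triple of variables: the map on the triple is lifted for fixed [u], and the lift is
    linear in [u] because maps on a triple tensor product are determined on pure tensors. *)
Lemma tens_lift_step (U W1 W2 W3 X : lmodType k) (G : W1 -> W2 -> W3 -> U -> X) :
  (forall a b c, lin (G a b c)) ->
  (forall u, trilin (fun a b c => G a b c u)) ->
  exists g : {linear U ⨂ (W1 ⨂ W2 ⨂ W3) -> X},
    forall u a b c, g (u ⊗ (a ⊗ b ⊗ c)) = G a b c u.
Proof.
move=> hG h; have /choice [g gE] u := tens_lift3 (h u).
have [|f fE] := @tens_lift _ _ _ _ (fun u w => g u w).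
  split=> [w s x y|u]; last exact: lin_linear.
  have hs : lin (fun w => s *: g x w + g y w).
    by apply: lin_add; [apply: lin_scale|]; apply: lin_linear.
  have -> : g (s *: x + y) = mklin hs by apply: tens_lin_eq3 => a b c /=; rewrite !gE hG.
  by [].
by exists f => u a b c; rewrite fE gE.
Qed.

Lemma tens_lift33 (U1 U2 U3 V1 V2 V3 X : lmodType k) (F : U1 -> U2 -> U3 -> V1 -> V2 -> V3 -> X) :
  (forall v1 v2 v3, trilin (fun u1 u2 u3 => F u1 u2 u3 v1 v2 v3)) ->
  (forall u1 u2 u3, trilin (F u1 u2 u3)) ->
  exists g : {linear (U1 ⨂ U2 ⨂ U3) ⨂ (V1 ⨂ V2 ⨂ V3) -> X},
    forall u1 u2 u3 v1 v2 v3, g ((u1 ⊗ u2 ⊗ u3) ⊗ (v1 ⊗ v2 ⊗ v3)) = F u1 u2 u3 v1 v2 v3.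
Proof.
move=> h1 h2.
have /choice [G0 G0E] (v : V1 * V2 * V3) := tens_lift3 (h1 v.1.1 v.1.2 v.2).
have [||g gE] := @tens_lift_step _ _ _ _ _ (fun v1 v2 v3 => G0 (v1, v2, v3)).
- by move=> *; apply: lin_linear.
- apply: trilin_tens3 => [a b c|u v z]; first exact: lin_linear.
  by case: (h2 u v z) => t1 t2 t3; split=> [b c|a c|a b] s x y; rewrite !G0E /=; [apply: t1|apply: t2|apply: t3].
by exists g => *; rewrite gE G0E.
Qed.

Lemma tens_lift333 (U1 U2 U3 V1 V2 V3 W1 W2 W3 X : lmodType k)
    (F : U1 -> U2 -> U3 -> V1 -> V2 -> V3 -> W1 -> W2 -> W3 -> X) :
  (forall v1 v2 v3 w1 w2 w3, trilin (fun u1 u2 u3 => F u1 u2 u3 v1 v2 v3 w1 w2 w3)) ->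
  (forall u1 u2 u3 w1 w2 w3, trilin (fun v1 v2 v3 => F u1 u2 u3 v1 v2 v3 w1 w2 w3)) ->
  (forall u1 u2 u3 v1 v2 v3, trilin (F u1 u2 u3 v1 v2 v3)) ->
  exists g : {linear (U1 ⨂ U2 ⨂ U3) ⨂ (V1 ⨂ V2 ⨂ V3) ⨂ (W1 ⨂ W2 ⨂ W3) -> X},
    forall u1 u2 u3 v1 v2 v3 w1 w2 w3,
      g ((u1 ⊗ u2 ⊗ u3) ⊗ (v1 ⊗ v2 ⊗ v3) ⊗ (w1 ⊗ w2 ⊗ w3)) = F u1 u2 u3 v1 v2 v3 w1 w2 w3.
Proof.
move=> h1 h2 h3.
have /choice [G0 G0E] (w : W1 * W2 * W3) :=
  tens_lift33 (fun v1 v2 v3 => h1 v1 v2 v3 w.1.1 w.1.2 w.2) (fun u1 u2 u3 => h2 u1 u2 u3 w.1.1 w.1.2 w.2).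
have [||g gE] := @tens_lift_step _ _ _ _ _ (fun v1 v2 v3 => G0 (v1, v2, v3)).
- by move=> *; apply: lin_linear.
- apply: trilin_tens => [a b c|u v]; first exact: lin_linear.
  move: u; apply: (trilin_tens3 (G := fun a b c u => G0 (a, b, c) (u ⊗ v))) => [a b c|u1 u2 u3].
    by apply: lin_app; apply: lin_tensl; apply: lin_id.
  move: v; apply: (trilin_tens3 (G := fun a b c v => G0 (a, b, c) ((u1 ⊗ u2 ⊗ u3) ⊗ v))) => [a b c|v1 v2 v3].
    by apply: lin_app; apply: lin_tensr; apply: lin_id.
  by case: (h3 u1 u2 u3 v1 v2 v3) => t1 t2 t3; split=> [b c|a c|a b] s x y; rewrite !G0E /=; [apply: t1|apply: t2|apply: t3].
by exists g => *; rewrite gE G0E.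
Qed.

End Lifts.

Lemma comm_pull (k : fieldType) (C D : coalg k) (U V : lmodType k) (x : {linear C -> D})
    (P : {linear D -> U}) (Q : {linear D -> V}) : cpt x -> comm P Q -> comm (P ∘ x) (Q ∘ x).
Proof.
move=> hx h c; rewrite -(cptE (F := fun a b => P a ⊗ Q b) c hx); last lin.
by rewrite h (cptE (F := fun a b => P b ⊗ Q a) c hx); last lin.
Qed.

Section Eval3.
Variables (k : fieldType) (C D E : coalg k).
Local Notation CD := (tcoalg C D).
Local Notation CDE := (tcoalg CD E).
Variables (U V W : lmodType k) (f : {linear U ⨂ V -> W}).

Lemma op2_tens3_prll (P : {linear CD -> U}) (Q : {linear CDE -> V}) c d e :
  op2 f (P ∘ prl CD E) Q (c ⊗ d ⊗ e)
  = S2 c (fun c1 c2 => S2 d (fun d1 d2 => f (P (c1 ⊗ d1) ⊗ Q (c2 ⊗ d2 ⊗ e)))).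
Proof. by rewrite op2_tens_prll S2_tens //; lin. Qed.

Lemma op2_tens3_prlr (P : {linear CDE -> U}) (Q : {linear CD -> V}) c d e :
  op2 f P (Q ∘ prl CD E) (c ⊗ d ⊗ e)
  = S2 c (fun c1 c2 => S2 d (fun d1 d2 => f (P (c1 ⊗ d1 ⊗ e) ⊗ Q (c2 ⊗ d2)))).
Proof. by rewrite op2_tens_prlr S2_tens //; lin. Qed.

Lemma op2_tens3_prlll (P : {linear C -> U}) (Q : {linear CDE -> V}) c d e :
  op2 f (P ∘ (prl C D ∘ prl CD E)) Q (c ⊗ d ⊗ e)
  = S2 c (fun c1 c2 => f (P c1 ⊗ Q (c2 ⊗ d ⊗ e))).
Proof.
rewrite lcompA op2_tens3_prll; apply: S2_ext => c1 c2.
rewrite -[RHS](S2_counitl (F := fun d => f (P c1 ⊗ Q (c2 ⊗ d ⊗ e)))); last lin.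
apply: S2_ext => d1 d2.
by rewrite lcompE prlE (linZ (lin_linear P)) Tensor.pureZl (linZ (lin_linear f)).
Qed.

Lemma op2_tens3_prllr (P : {linear CDE -> U}) (Q : {linear C -> V}) c d e :
  op2 f P (Q ∘ (prl C D ∘ prl CD E)) (c ⊗ d ⊗ e)
  = S2 c (fun c1 c2 => f (P (c1 ⊗ d ⊗ e) ⊗ Q c2)).
Proof.
rewrite lcompA op2_tens3_prlr; apply: S2_ext => c1 c2.
rewrite -[RHS](S2_counitr (F := fun d => f (P (c1 ⊗ d ⊗ e) ⊗ Q c2))); last lin.
apply: S2_ext => d1 d2.
by rewrite lcompE prlE (linZ (lin_linear Q)) Tensor.pureZr (linZ (lin_linear f)).
Qed.

End Eval3.

Section PairOp.
Variables (k : fieldType) (C : coalg k).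

Lemma tens_lift3r (U V W X : lmodType k) (F : U -> V -> W -> X) : trilin F ->
  exists g : {linear U ⨂ (V ⨂ W) -> X}, forall u v w, g (u ⊗ (v ⊗ w)) = F u v w.
Proof.
case=> h1 h2 h3.
have [|g gE] := tens_lift3 (F := fun v w u => F u v w); first by split=> *; [apply: h2|apply: h3|apply: h1].
have [|f fE] := tens_lift (F := fun u (Z : V ⨂ W) => g (Z ⊗ u)); first by lin.
by exists f => *; rewrite fE gE.
Qed.

(** Used for functions of three arguments whose first two are packed as a pair: a letter acting on
    the first component is taken out of the pair, with one [g] for all maps. *)
Lemma pair_op2l (A U U' V : lmodType k) (m : {linear A ⨂ U -> U'}) :
  exists g : {linear A ⨂ (U ⨂ V) -> U' ⨂ V}, (forall a u v, g (a ⊗ (u ⊗ v)) = m (a ⊗ u) ⊗ v)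
  /\ forall (P : {linear C -> A}) (M : {linear C -> U}) (N : {linear C -> V}),
       cpair (op2 m P M) N = op2 g P (cpair M N).
Proof.
have [|g gE] := tens_lift3r (F := fun a u (v : V) => m (a ⊗ u) ⊗ v); first by lin.
exists g; split=> // P M N.
have -> : cpair M N = op2 (idfun : {linear U ⨂ V -> U ⨂ V}) M N by rewrite op2_id.
rewrite (op2_assoc (g := idfun) (g' := m)); first by rewrite op2_id.
by move=> *; rewrite /= gE.
Qed.

(** The letter [P] stands between [M] and [N] and leaves the pair at its right end, so it has to
    pass [N]. *)
Lemma pair_op2r (A U U' V : lmodType k) (m : {linear U ⨂ A -> U'}) :
  exists g : {linear (U ⨂ V) ⨂ A -> U' ⨂ V}, (forall u v a, g ((u ⊗ v) ⊗ a) = m (u ⊗ a) ⊗ v)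
  /\ forall (P : {linear C -> A}) (M : {linear C -> U}) (N : {linear C -> V}), comm P N ->
       cpair (op2 m M P) N = op2 g (cpair M N) P.
Proof.
have [|g gE] := tens_lift3 (F := fun u (v : V) a => m (u ⊗ a) ⊗ v); first by lin.
exists g; split=> // P M N c.
have -> : cpair M N = op2 (idfun : {linear U ⨂ V -> U ⨂ V}) M N by rewrite op2_id.
rewrite -(op2_exchr (f := idfun) (g := m) M (Q := P) (R := N)) //; first by rewrite op2_id.
by move=> *; rewrite /= gE.
Qed.

End PairOp.

Lemma pair_pull (k : fieldType) (C D : coalg k) (z : {linear C -> D}) (U V : lmodType k)
    (P : {linear D -> U}) (Q : {linear D -> V}) :
  cpt z -> cpair P Q ∘ z = cpair (P ∘ z) (Q ∘ z).
Proof.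
by move=> hz; rewrite -!op2_id op2_pull.
Qed.

Lemma pair_cstl (k : fieldType) (C : coalg k) (U V : lmodType k) (u : U) (P : {linear C -> V}) :
  cpair (cst C u) P = mklin (f := fun v => u ⊗ v) ltac:(lin) ∘ P.
Proof. by rewrite -op2_id; apply: op2_cstl. Qed.

Lemma pair_cstr (k : fieldType) (C : coalg k) (U V : lmodType k) (u : U) (P : {linear C -> V}) :
  cpair P (cst C u) = mklin (f := fun v => v ⊗ u) ltac:(lin) ∘ P.
Proof. by rewrite -op2_id; apply: op2_cstr. Qed.

(** * Twisting *)

Structure twisted (k : fieldType) (B : algType k) := Twisted {
  tw_C : coalg k;
  tw_mul : {linear tw_C ⨂ tw_C -> tw_C};
  tw_one : tw_C;
  tw_phi : {linear tw_C ⨂ tw_C ⨂ tw_C -> k^o};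
  tw_coquasi : is_coquasi_bialgebra (cdelta tw_C) (ceps tw_C) tw_mul tw_one tw_phi;
  tw_act : {linear tw_C ⨂ B -> B};
  tw_measuring : is_measuring (cdelta tw_C) (ceps tw_C) tw_act;
  tw_gamma : {linear tw_C ⨂ tw_C -> B};
  tw_gammaI : {linear tw_C ⨂ tw_C -> B};
  tw_gamma_unital : gamma_unital (ceps tw_C) tw_one tw_gamma;
  tw_gamma_inv : conv_inv2 (cdelta tw_C) (ceps tw_C) tw_gamma tw_gammaI;
  tw_act_gamma : forall h g b,
    tw_act (h ⊗ tw_act (g ⊗ b)) =
    sweedler (cop (cdelta tw_C)) 3 h (fun h1 h2 h3 =>
    sweedler (cop (cdelta tw_C)) 3 g (fun g1 g2 g3 =>
      tw_gamma (h1 ⊗ g1) * tw_act (tw_mul (h2 ⊗ g2) ⊗ b) * tw_gammaI (h3 ⊗ g3)));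
  tw_act_one : forall b, tw_act (tw_one ⊗ b) = b }.

Definition tw_psi (k : fieldType) (B : algType k) (T : twisted B) :
    {linear tw_C T ⨂ tw_C T ⨂ tw_C T -> k^o} := projT1 (cid (cq_phi_inv (tw_coquasi T))).

Lemma tw_psiP (k : fieldType) (B : algType k) (T : twisted B) :
  conv_inv3 (cdelta (tw_C T)) (ceps (tw_C T)) (tw_phi T) (tw_psi T).
Proof. by rewrite /tw_psi; case: cid. Qed.

Local Notation "u ⋆ v" := (op2 (mulB _) u v) (at level 40, left associativity).

(* The value of Phi at 1[x]1, 1[y]1, 1[z]1. *)
HB.lock Definition om (k : fieldType) (B : algType k) (T : twisted B) (C : coalg k)
    (x y z : {linear C -> tw_C T}) : {linear C -> B} :=
  op2 (tw_act T) x (op2 (tw_gamma T) y z) ⋆ op2 (tw_gamma T) x (op2 (tw_mul T) y z)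
  ⋆ (sca B ∘ (tw_phi T ∘ cpair (cpair x y) z))
  ⋆ op2 (tw_gammaI T) (op2 (tw_mul T) x y) z ⋆ op2 (tw_gammaI T) x y.
Arguments om {k B T C} x y z.

(** The five factors of [om] inverted and in reverse order. *)
HB.lock Definition omI (k : fieldType) (B : algType k) (T : twisted B) (C : coalg k)
    (x y z : {linear C -> tw_C T}) : {linear C -> B} :=
  op2 (tw_gamma T) x y ⋆ op2 (tw_gamma T) (op2 (tw_mul T) x y) z
  ⋆ (sca B ∘ (tw_psi T ∘ cpair (cpair x y) z))
  ⋆ op2 (tw_gammaI T) x (op2 (tw_mul T) y z) ⋆ op2 (tw_act T) x (op2 (tw_gammaI T) y z).
Arguments omI {k B T C} x y z.

Section Twisted.
Variables (k : fieldType) (B : algType k) (T : twisted B).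
Local Notation H := (tw_C T).
Local Notation mulH := (tw_mul T).
Local Notation oneH := (tw_one T).
Local Notation phi := (tw_phi T).
Local Notation psi := (tw_psi T).
Local Notation act := (tw_act T).
Local Notation gamma := (tw_gamma T).
Local Notation gammaI := (tw_gammaI T).
Local Notation Hcq := (tw_coquasi T).
Local Notation act_meas := (tw_measuring T).
Local Notation HH := (tcoalg H H).
Local Notation HHH := (tcoalg HH H).
Local Notation HHHH := (tcoalg HHH H).
Local Notation L := (B ⨂ H ⨂ B).
Local Notation p1 := (prl H H).
Local Notation p2 := (prr H H).
Local Notation q1 := (prl H H ∘ prl HH H).
Local Notation q2 := (prr H H ∘ prl HH H).
Local Notation q3 := (prr HH H).
Local Notation "x ▷ u" := (op2 act x u) (at level 35, right associativity).
Local Notation "x ⊙ y" := (op2 mulH x y) (at level 31, left associativity).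
Local Notation G := (op2 gamma).
Local Notation GI := (op2 gammaI).
Local Notation "1%P" := (cst _ (1 : B)).
Local Notation PB x y z := (sca B ∘ (phi ∘ cpair (cpair x y) z)).
Local Notation PBI x y z := (sca B ∘ (psi ∘ cpair (cpair x y) z)).

Lemma cpt_mulH : cpt (C := HH) mulH.
Proof.
split=> z; move: z; apply: lin_ind; [lin|lin| |lin|lin|] => h g.
  rewrite S2_tens; last lin.
  by rewrite (S2_lift idfun) /=; apply: (cq_Delta_mul Hcq).
by rewrite ceps_tens; apply: (cq_eps_mul Hcq).
Qed.

Lemma gammaK : op2 (C := HH) (mulB B) gamma gammaI = cst HH 1.
Proof.
apply: tens_lin_eq => h g; rewrite op2_tens cstE ceps_tens -(tw_gamma_inv h g).1.
rewrite (sw_S2 (V := B) (n := 0)); apply: S2_ext => h1 h2.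
rewrite [RHS](sw_S2 (V := B) (n := 0)); apply: S2_ext => g1 g2.
by rewrite mulBE.
Qed.

Lemma gammaIK : op2 (C := HH) (mulB B) gammaI gamma = cst HH 1.
Proof.
apply: tens_lin_eq => h g; rewrite op2_tens cstE ceps_tens -(tw_gamma_inv h g).2.
rewrite (sw_S2 (V := B) (n := 0)); apply: S2_ext => h1 h2.
rewrite [RHS](sw_S2 (V := B) (n := 0)); apply: S2_ext => g1 g2.
by rewrite mulBE.
Qed.

Definition acti (b : B) : {linear H -> B} := mklin (f := fun h => act (h ⊗ b)) ltac:(lin).

Definition act2 : {linear H ⨂ H ⨂ B -> B} :=
  projT1 (cid (tens_lift3 (F := fun h g b => act (h ⊗ act (g ⊗ b))) ltac:(lin))).
Lemma act2E h g b : act2 (h ⊗ g ⊗ b) = act (h ⊗ act (g ⊗ b)).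
Proof. by rewrite /act2; case: cid. Qed.

Definition actm : {linear H ⨂ H ⨂ B -> B} := act ∘ tmap mulH idfun.
Lemma actmE d b : actm (d ⊗ b) = act (mulH d ⊗ b).
Proof. by rewrite /= tmapE. Qed.

(** The twisting condition convolved with [gamma] on the right, which removes [gammaI]. What remains
    is an exchange rule between [gamma] and the action. *)
Lemma act2_gamma (d : HH) b :
  S2 d (fun d1 d2 => act2 (d1 ⊗ b) * gamma d2)
  = S2 d (fun d1 d2 => gamma d1 * act (mulH d2 ⊗ b)).
Proof.
pose A : {linear HH -> B} := mklin (f := fun d => act2 (d ⊗ b)) ltac:(lin).
have AE : A = op2 (C := HH) (mulB B) gamma (op2 (C := HH) (mulB B) (acti b ∘ mulH) gammaI).
  apply: tens_lin_eq => h g; rewrite [LHS]act2E tw_act_gamma op2_tens.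
  rewrite (sw_S2 (V := B) (n := 1)); apply: S2_ext => h1 h'.
  rewrite [LHS](sw_S2 (V := B) (n := 0)).
  transitivity (S2 h' (fun h2 h3 => S2 g (fun g1 g' => S2 g' (fun g2 g3 =>
    gamma (h1 ⊗ g1) * act (mulH (h2 ⊗ g2) ⊗ b) * gammaI (h3 ⊗ g3))))); first by [].
  rewrite S2_exch; apply: S2_ext => g1 g'; rewrite mulBE op2_tens S2_mull.
  apply: S2_ext => h2 h3; rewrite S2_mull.
  by apply: S2_ext => g2 g3; rewrite mulBE mulrA.
have := congr1 (fun f : {linear _ -> _} => f d) (erefl (op2 (C := HH) (mulB B) A gamma)).
(* Only the second copy of [A] is expanded, which turns the trivial equation into the exchange
   rule. *)
rewrite {2}AE -!convA gammaIK convr1 !op2E => e; apply: etrans (etrans e _).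
  by apply: S2_ext => *; rewrite mulBE.
by apply: S2_ext => *; rewrite mulBE.
Qed.

Section Points.
Variable C : coalg k.
Implicit Types (x y z w : {linear C -> H}) (u v P Q : {linear C -> B}).

Lemma cpt_mul x y : cpt x -> cpt y -> comm x y -> cpt (x ⊙ y).
Proof. by move=> hx hy h; apply: (cpt_op2 ) => //; apply: cpt_mulH. Qed.

Lemma act_conv x u v : cpt x -> comm x u -> x ▷ (u ⋆ v) = (x ▷ u) ⋆ (x ▷ v).
Proof.
move=> hx h; apply: (op2_distr) => // a b c.
by rewrite mulBE (act_mul act_meas) (sw_S2 (V := B) (n := 0)); apply: S2_ext => *; rewrite mulBE.
Qed.

Lemma act_cst1 x : cpt x -> x ▷ 1%P = 1%P.
Proof.
move=> hx; rewrite (op2_cstr (g := acti 1)) //.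
by apply: linP_eq => c; rewrite /= (act_one act_meas) (cst_cpt _ _ hx).
Qed.

Lemma cptC1 (D : coalg k) (z : {linear C -> D}) (b : B) : cpt z -> cst D b ∘ z = cst C b.
Proof. by move=> hz; apply: linP_eq => c; rewrite /= cstE cst_cpt. Qed.

Lemma gamK x y : cpt x -> cpt y -> comm x y -> G x y ⋆ GI x y = 1%P.
Proof.
move=> hx hy h; have hz := cpt_pair hx hy h.
by rewrite (op2_def gamma) (op2_def gammaI) -(op2_pull (D := HH)) // gammaK cptC1.
Qed.

Lemma gamIK x y : cpt x -> cpt y -> comm x y -> GI x y ⋆ G x y = 1%P.
Proof.
move=> hx hy h; have hz := cpt_pair hx hy h.
by rewrite (op2_def gamma) (op2_def gammaI) -(op2_pull (D := HH)) // gammaIK cptC1.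
Qed.

(** In [act2_gamma] the element b is fixed; here [P] varies with c as well, so it is first moved to
    the last Sweedler factor, where it behaves as a constant. *)
Lemma act_gam x y P : cpt x -> cpt y -> comm x y -> comm x P -> comm y P ->
  (x ▷ y ▷ P) ⋆ G x y = G x y ⋆ (x ⊙ y ▷ P).
Proof.
move=> hx hy hxy hxP hyP; have hz := cpt_pair hx hy hxy.
have hzP : comm (cpair x y) P by cm.
have -> : x ▷ y ▷ P = op2 act2 (cpair x y) P.
  have -> : cpair x y = op2 (idfun : {linear H ⨂ H -> H ⨂ H}) x y by rewrite op2_id.
  by apply: op2_assoc => *; rewrite act2E.
have -> : x ⊙ y ▷ P = op2 actm (cpair x y) P.
  by rewrite (op2_def mulH); apply: op2_compl => *; rewrite actmE.
rewrite (op2_def gamma); move: (cpair x y) hz hzP => {hx hy hxy hxP hyP x y} z hz hzP.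
apply: linP_eq => c; rewrite !op2E.
transitivity (S2 c (fun c1 c2 => S2 c1 (fun c11 c12 => act2 (z c11 ⊗ P c12) * gamma (z c2)))).
  by apply: S2_ext => c1 c2; rewrite op2E mulBE S2_mulr.
rewrite (S2_assoc (F := fun a b d => act2 (z a ⊗ P b) * gamma (z d))); last lin.
transitivity (S2 c (fun c1 c2 => S2 c2 (fun c21 c22 => act2 (z c1 ⊗ P c22) * gamma (z c21)))).
  apply: S2_ext => c1 c2.
  by rewrite (commE (F := fun a b => act2 (z c1 ⊗ b) * gamma a)) //; lin.
rewrite -(S2_assoc (F := fun a b d => act2 (z a ⊗ P d) * gamma (z b))); last lin.
transitivity (S2 c (fun c1 c2 => S2 c1 (fun c11 c12 => gamma (z c11) * act (mulH (z c12) ⊗ P c2)))).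
  apply: S2_ext => c1 c2.
  rewrite -(cptE (D := HH) (F := fun a b => act2 (a ⊗ P c2) * gamma b)) //; last lin.
  by rewrite act2_gamma (cptE (D := HH) (F := fun a b => gamma a * act (mulH b ⊗ P c2))) //; lin.
rewrite (S2_assoc (F := fun a b d => gamma (z a) * act (mulH (z b) ⊗ P d))); last lin.
apply: S2_ext => c1 c2; rewrite mulBE op2E S2_mull.
by apply: S2_ext => *; rewrite actmE.
Qed.

Definition mulL : {linear H ⨂ H ⨂ H -> H} := mulH ∘ tmap mulH idfun.
Definition mulR : {linear H ⨂ H ⨂ H -> H} :=
  projT1 (cid (tens_lift3 (F := fun h g f => mulH (h ⊗ mulH (g ⊗ f))) ltac:(lin))).
Lemma mulRE h g f : mulR (h ⊗ g ⊗ f) = mulH (h ⊗ mulH (g ⊗ f)).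
Proof. by rewrite /mulR; case: cid. Qed.

Lemma quasi_assocE : op2 (C := HHH) (scl H) phi mulL = op2 (C := HHH) (scr H) mulR phi.
Proof.
apply: tens_lin_eq3 => h g f; rewrite !op2_tens3.
have e : S2 h (fun h1 h2 => S2 g (fun g1 g2 => S2 f (fun f1 f2 =>
    (phi (h1 ⊗ g1 ⊗ f1) : k) *: mulH (mulH (h2 ⊗ g2) ⊗ f2))))
  = S2 h (fun h1 h2 => S2 g (fun g1 g2 => S2 f (fun f1 f2 =>
    (phi (h2 ⊗ g2 ⊗ f2) : k) *: mulH (h1 ⊗ mulH (g1 ⊗ f1))))) := cq_quasi_assoc Hcq h g f.
transitivity (S2 h (fun h1 h2 => S2 g (fun g1 g2 => S2 f (fun f1 f2 =>
    (phi (h1 ⊗ g1 ⊗ f1) : k) *: mulH (mulH (h2 ⊗ g2) ⊗ f2))))).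
  apply: S2_ext => h1 h2; apply: S2_ext => g1 g2; apply: S2_ext => f1 f2.
  by rewrite sclE /= tmapE.
rewrite e.
apply: S2_ext => h1 h2; apply: S2_ext => g1 g2; apply: S2_ext => f1 f2.
by rewrite scrE mulRE.
Qed.

Local Notation ph x y z := (phi ∘ cpair (cpair x y) z).

Section ThreePoints.
Variables x y z : {linear C -> H}.
Hypotheses (hx : cpt x) (hy : cpt y) (hz : cpt z).
Hypotheses (hxy : comm x y) (hxz : comm x z) (hyz : comm y z).

Let cpt3 : cpt (D := HHH) (cpair (cpair x y) z).
Proof.
by apply: (cpt_pair (D := HH)) => //; [apply: (cpt_pair)|cm].
Qed.

Let mL_pt : mulL ∘ cpair (cpair x y) z = (x ⊙ y) ⊙ z.
Proof. by rewrite !(op2_def mulH) -lcompA -pair_compl. Qed.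

Let mR_pt : mulR ∘ cpair (cpair x y) z = x ⊙ (y ⊙ z).
Proof. by symmetry; apply: op2_flat => *; rewrite mulRE. Qed.

Lemma phi_quasi_assoc : op2 (scl H) (ph x y z) ((x ⊙ y) ⊙ z) = op2 (scr H) (x ⊙ (y ⊙ z)) (ph x y z).
Proof.
by rewrite -mL_pt -mR_pt -!(op2_pull (D := HHH)) // quasi_assocE.
Qed.

Lemma sca_conv (U : lmodType k) (s : {linear C -> k^o}) (u : {linear C -> B}) :
  op2 (mulB B) (sca B ∘ s) u = op2 (scl B) s u.
Proof. by apply: op2_compl => a b; rewrite mulBE scaE sclE -scalerAl mul1r. Qed.

Lemma conv_sca (s : {linear C -> k^o}) (u : {linear C -> B}) :
  op2 (mulB B) u (sca B ∘ s) = op2 (scr B) u s.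
Proof. by apply: op2_compr => a b; rewrite mulBE scaE scrE -scalerAr mulr1. Qed.

(** Being scalar, [phi] passes a letter at the cost of the order of Sweedler factors only, and axiom
    (3) of a coquasi-bialgebra corrects this order by moving the brackets of x, y, z. *)
Lemma phi_slider (V : lmodType k) (f : {linear H ⨂ V -> B}) (P : {linear C -> V}) :
  comm x P -> comm y P -> comm z P ->
  PB x y z ⋆ op2 f ((x ⊙ y) ⊙ z) P = op2 f (x ⊙ (y ⊙ z)) P ⋆ PB x y z.
Proof.
move=> cx cy cz; rewrite (sca_conv B) conv_sca.
rewrite (op2_assoc (g := f) (g' := scl H)); last first.
  by move=> a h p; rewrite !sclE Tensor.pureZl linearZ.
rewrite phi_quasi_assoc; apply: op2_exchr; last by cm.
by move=> h a p; rewrite !scrE Tensor.pureZl linearZ.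
Qed.

Lemma phi_slidel (V : lmodType k) (f : {linear V ⨂ H -> B}) (P : {linear C -> V}) :
  comm x P -> comm y P -> comm z P ->
  PB x y z ⋆ op2 f P ((x ⊙ y) ⊙ z) = op2 f P (x ⊙ (y ⊙ z)) ⋆ PB x y z.
Proof.
move=> cx cy cz; rewrite (sca_conv B) conv_sca.
rewrite (op2_exchl (f' := f) (g' := scl H)); [|move=> a p h|by cm]; last first.
  by rewrite !sclE Tensor.pureZr linearZ.
rewrite phi_quasi_assoc; apply: op2_assoc => p h a.
by rewrite !scrE Tensor.pureZr linearZ.
Qed.

End ThreePoints.

End Points.

Ltac cm_hook ::= match goal with |- cpt _ => apply: cpt_mul end.

(** * The cocycle identity of [phi] at four points *)

Lemma phiK1_ex : exists g : {linear HHHH -> k^o}, forall d f l,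
  g (d ⊗ f ⊗ l) = phi (d ⊗ mulH (f ⊗ l)).
Proof. by apply: (tens_lift3 (F := fun d f l => phi (d ⊗ mulH (f ⊗ l)))); lin. Qed.

Lemma mulmid_ex : exists g : {linear H ⨂ H ⨂ H -> H ⨂ H}, forall h g' f,
  g (h ⊗ g' ⊗ f) = h ⊗ mulH (g' ⊗ f).
Proof. by apply: (tens_lift3 (F := fun h g f => h ⊗ mulH (g ⊗ f))); lin. Qed.

Section FourPoints.
Variable C : coalg k.

Lemma phi_cocycle (x y z w : {linear C -> H}) :
  cpt x -> cpt y -> cpt z -> cpt w ->
  comm x y -> comm x z -> comm x w -> comm y z -> comm y w -> comm z w ->
  PB x y (z ⊙ w) ⋆ PB (x ⊙ y) z w = PB y z w ⋆ (PB x (y ⊙ z) w ⋆ PB x y z).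
Proof.
move=> hx hy hz hw hxy hxz hxw hyz hyw hzw.
have [K1 K1E] := phiK1_ex; have [m mE] := mulmid_ex.
(* With [K1], the five factors of the cocycle identity as functions of (h, g, f, l); [K3] and [K5]
   apply the counit to the variable that is absent from their factor. *)
pose K2 : {linear HHHH -> k^o} := phi ∘ tmap (tmap mulH idfun) idfun.
pose K3 : {linear HHHH -> k^o} := phi ∘ tmap (tmap (prr H H) idfun) idfun.
pose K4 : {linear HHHH -> k^o} := phi ∘ tmap m idfun.
pose K5 : {linear HHHH -> B} := sca B ∘ phi ∘ prl HHH H.
have K2E h g f l : K2 (h ⊗ g ⊗ f ⊗ l) = phi (mulH (h ⊗ g) ⊗ f ⊗ l) by rewrite /= !tmapE.
have K3E h g f l : K3 (h ⊗ g ⊗ f ⊗ l) = (ceps H h : k) *: phi (g ⊗ f ⊗ l).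
  by rewrite /= !tmapE prrE !Tensor.pureZl linearZ.
have K4E h g f l : K4 (h ⊗ g ⊗ f ⊗ l) = phi (h ⊗ mulH (g ⊗ f) ⊗ l) by rewrite /= !tmapE mE.
have KE : op2 (mulB B) (sca B ∘ K1) (sca B ∘ K2)
  = op2 (mulB B) (sca B ∘ K3) (op2 (mulB B) (sca B ∘ K4) K5).
  apply: tens_lin_eq => hgf l; move: hgf; apply: lin_ind => [||hg f]; [lin..|].
  move: hg; apply: lin_ind => [||h g]; [lin..|].
  transitivity ((S2 h (fun h1 h2 => S2 g (fun g1 g2 => S2 f (fun f1 f2 => S2 l (fun l1 l2 =>
    phi (h1 ⊗ g1 ⊗ mulH (f1 ⊗ l1)) * phi (mulH (h2 ⊗ g2) ⊗ f2 ⊗ l2) : k^o)))) : k) *: (1 : B)).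
    rewrite op2_tens4 (S2_mor (f := fun a : k^o => (a : k) *: (1 : B))); last by lin.
    apply: S2_ext => h1 h2; rewrite (S2_mor (f := fun a : k^o => (a : k) *: (1 : B))); last by lin.
    apply: S2_ext => g1 g2; rewrite (S2_mor (f := fun a : k^o => (a : k) *: (1 : B))); last by lin.
    apply: S2_ext => f1 f2; rewrite (S2_mor (f := fun a : k^o => (a : k) *: (1 : B))); last by lin.
    apply: S2_ext => l1 l2.
    by rewrite mulBE !(lcompE (sca B)) !scaE K1E K2E -scalerAl mul1r scalerA.
  have -> : S2 h (fun h1 h2 => S2 g (fun g1 g2 => S2 f (fun f1 f2 => S2 l (fun l1 l2 =>
      phi (h1 ⊗ g1 ⊗ mulH (f1 ⊗ l1)) * phi (mulH (h2 ⊗ g2) ⊗ f2 ⊗ l2) : k^o))))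
    = S2 g (fun g1 g' => S2 f (fun f1 f' => S2 l (fun l1 l2 => S2 h (fun h1 h2 =>
      S2 g' (fun g2 g3 => S2 f' (fun f2 f3 =>
      (phi (g1 ⊗ f1 ⊗ l1) * phi (h1 ⊗ mulH (g2 ⊗ f2) ⊗ l2) * phi (h2 ⊗ g3 ⊗ f3) : k^o))))))).
    transitivity (S2 h (fun h1 h2 => S2 g (fun g1 g' => S2 g' (fun g2 g3 => S2 f (fun f1 f' => S2 f' (fun f2 f3 =>
      S2 l (fun l1 l2 => phi (g1 ⊗ f1 ⊗ l1) * phi (h1 ⊗ mulH (g2 ⊗ f2) ⊗ l2) * phi (h2 ⊗ g3 ⊗ f3) : k^o))))))).
      exact: (cq_phi_cocycle Hcq h g f l).
    s2match; reflexivity.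
  rewrite op2_tens4.
  (* The factor phi(g, f, l) does not involve h, so the counit absorbs one Sweedler factor of h. *)
  transitivity (S2 g (fun g1 g2 => S2 f (fun f1 f2 => S2 l (fun l1 l2 =>
    mulB B (sca B (phi (g1 ⊗ f1 ⊗ l1)) ⊗ op2 (mulB B) (sca B ∘ K4) K5 (h ⊗ g2 ⊗ f2 ⊗ l2)))))); last first.
    rewrite -[LHS](S2_counitl (F := fun h => S2 g (fun g1 g2 => S2 f (fun f1 f2 => S2 l (fun l1 l2 =>
      mulB B (sca B (phi (g1 ⊗ f1 ⊗ l1)) ⊗ op2 (mulB B) (sca B ∘ K4) K5 (h ⊗ g2 ⊗ f2 ⊗ l2))))))); last by lin.
    apply: S2_ext => h1 h2.
    do 3 (rewrite (S2_mor (f := fun x => (ceps H h1 : k) *: x)); last (by lin); apply: S2_ext => ? ?).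
    by rewrite (lcompE (sca B) K3) K3E (linZ (lin_linear (sca B))) Tensor.pureZl linearZ.
  transitivity (S2 g (fun g1 g' => S2 f (fun f1 f' => S2 l (fun l1 l2 => S2 h (fun h1 h2 =>
      S2 g' (fun g2 g3 => S2 f' (fun f2 f3 =>
      ((phi (g1 ⊗ f1 ⊗ l1) : k) * phi (h1 ⊗ mulH (g2 ⊗ f2) ⊗ l2) * phi (h2 ⊗ g3 ⊗ f3) : k) *: (1 : B)))))))).
by do 6 (rewrite (S2_mor (f := fun a : k^o => (a : k) *: (1 : B))); last (by lin); apply: S2_ext => ? ?).
  apply: S2_ext => g1 g'; apply: S2_ext => f1 f'; apply: S2_ext => l1 l2.
  rewrite mulBE scaE -scalerAl mul1r.
  change K5 with (sca B ∘ phi ∘ prl HHH H).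
  rewrite op2_tens_prlr.
  rewrite S2_tens3; last by lin.
  do 3 (rewrite (S2_mor (f := fun x => (phi (g1 ⊗ f1 ⊗ l1) : k) *: x)); last (by lin); apply: S2_ext => ? ?).
  by rewrite mulBE (lcompE (sca B) K4) (lcompE (sca B) phi) K4E !scaE -!scalerA -scalerAl mul1r.
have z3 : cpt (D := HHH) (cpair (cpair x y) z) by cm.
have K1z : PB x y (z ⊙ w) = sca B ∘ K1 ∘ cpair (cpair (cpair x y) z) w.
  rewrite -(lcompA (sca B) K1); congr (_ ∘ _).
  by rewrite -(op2_def phi); apply: op2_flat => d f l; rewrite K1E.
have K2z : PB (x ⊙ y) z w = sca B ∘ K2 ∘ cpair (cpair (cpair x y) z) w.
  rewrite -(lcompA (sca B) K2); congr (_ ∘ _).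
  by rewrite -(lcompA phi) !pair_comp_id (op2_def mulH).
have K3z : PB y z w = sca B ∘ K3 ∘ cpair (cpair (cpair x y) z) w.
  rewrite -(lcompA (sca B) K3); congr (_ ∘ _).
  by rewrite -(lcompA phi) !pair_comp_id prr_pair.
have K4z : PB x (y ⊙ z) w = sca B ∘ K4 ∘ cpair (cpair (cpair x y) z) w.
  rewrite -(lcompA (sca B) K4); congr (_ ∘ _).
  rewrite -(lcompA phi) !pair_comp_id; congr (_ ∘ cpair _ _).
  exact: pair_flat.
have K5z : PB x y z = K5 ∘ cpair (cpair (cpair x y) z) w.
  by rewrite -(lcompA (sca B ∘ phi)) prl_pair // lcompA.
have z4 : cpt (D := HHHH) (cpair (cpair (cpair x y) z) w) by cm.
by rewrite K1z K2z K3z K4z K5z -!(op2_pull (D := HHHH)) // KE.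
Qed.
End FourPoints.

Lemma phiBK : op2 (C := HHH) (mulB B) (sca B ∘ phi) (sca B ∘ psi) = cst HHH 1.
Proof.
apply: tens_lin_eq3 => h g f; rewrite op2_tens3 cstE !ceps_tens.
transitivity ((S2 h (fun h1 h2 => S2 g (fun g1 g2 => S2 f (fun f1 f2 =>
   phi (h1 ⊗ g1 ⊗ f1) * psi (h2 ⊗ g2 ⊗ f2) : k^o))) : k) *: (1 : B)); last first.
  by congr (_ *: _); apply: (tw_psiP (T := T) h g f).1.
do 3 (rewrite (S2_mor (f := fun a : k^o => (a : k) *: (1 : B))); last (by lin); apply: S2_ext => ? ?).
by rewrite mulBE /= !scaE -scalerAl mul1r scalerA.
Qed.

Lemma phiBIK : op2 (C := HHH) (mulB B) (sca B ∘ psi) (sca B ∘ phi) = cst HHH 1.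
Proof.
apply: tens_lin_eq3 => h g f; rewrite op2_tens3 cstE !ceps_tens.
transitivity ((S2 h (fun h1 h2 => S2 g (fun g1 g2 => S2 f (fun f1 f2 =>
   psi (h1 ⊗ g1 ⊗ f1) * phi (h2 ⊗ g2 ⊗ f2) : k^o))) : k) *: (1 : B)); last first.
  by congr (_ *: _); apply: (tw_psiP (T := T) h g f).2.
do 3 (rewrite (S2_mor (f := fun a : k^o => (a : k) *: (1 : B))); last (by lin); apply: S2_ext => ? ?).
by rewrite mulBE /= !scaE -scalerAl mul1r scalerA.
Qed.

(** * Inverse, commutation rule and cocycle identity of Omega *)

Section Points.
Variable C : coalg k.

Lemma convK (u v w : {linear C -> B}) : u ⋆ v = 1%P -> w ⋆ u ⋆ v = w.
Proof. by move=> e; rewrite -convA e convr1. Qed.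

Lemma omE (x y z : {linear C -> H}) : om x y z =
  (x ▷ G y z) ⋆ G x (y ⊙ z) ⋆ PB x y z ⋆ GI (x ⊙ y) z ⋆ GI x y.
Proof. by rewrite om.unlock. Qed.

Lemma omIE (x y z : {linear C -> H}) : omI x y z =
  G x y ⋆ G (x ⊙ y) z ⋆ PBI x y z ⋆ GI x (y ⊙ z) ⋆ (x ▷ GI y z).
Proof. by rewrite omI.unlock. Qed.

Section TwoPoints.
Variables x y : {linear C -> H}.
Hypotheses (hx : cpt x) (hy : cpt y) (hxy : comm x y).

Lemma act_gamI P : comm x P -> comm y P -> GI x y ⋆ (x ▷ y ▷ P) = (x ⊙ y ▷ P) ⋆ GI x y.
Proof.
move=> cx cy; have := act_gam hx hy hxy cx cy => e.
rewrite -[LHS]convr1 -(gamK hx hy hxy) convA -(convA (GI x y)) e.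
by rewrite convA gamIK // conv1.
Qed.

Lemma act_gamI' P : comm x P -> comm y P -> GI x y ⋆ (x ▷ y ▷ P) ⋆ G x y = x ⊙ y ▷ P.
Proof. by move=> cx cy; rewrite act_gamI // convK // gamIK. Qed.

Lemma act_inv (u v : {linear C -> B}) : comm x u -> u ⋆ v = 1%P -> (x ▷ u) ⋆ (x ▷ v) = 1%P.
Proof. by move=> cu e; rewrite -act_conv // e act_cst1. Qed.

End TwoPoints.

Section ThreePoints.
Variables x y z : {linear C -> H}.
Hypotheses (hx : cpt x) (hy : cpt y) (hz : cpt z).
Hypotheses (hxy : comm x y) (hxz : comm x z) (hyz : comm y z).

Let z3 : cpt (D := HHH) (cpair (cpair x y) z).
Proof. by cm. Qed.

Lemma PBK : PB x y z ⋆ PBI x y z = 1%P.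
Proof. by rewrite !(lcompA (sca B)) -(op2_pull (D := HHH)) // phiBK cptC1. Qed.

Lemma PBIK : PBI x y z ⋆ PB x y z = 1%P.
Proof. by rewrite !(lcompA (sca B)) -(op2_pull (D := HHH)) // phiBIK cptC1. Qed.

(** A measuring acts on scalars through the counit. *)
Lemma act_PB (w : {linear C -> H}) : cpt w -> comm w x -> comm w y -> comm w z ->
  w ▷ PB x y z = PB x y z.
Proof.
move=> hw cx cy cz; apply: linP_eq => c; rewrite op2E.
rewrite -[RHS](S2_counitl (F := fun c => PB x y z c)); last by lin.
apply: S2_ext => c1 c2; rewrite !(lcompE (sca B)) !scaE Tensor.pureZr (linZ (lin_linear act)).
by rewrite (act_one act_meas) hw.2 !scalerA mulrC.
Qed.

Lemma omK : om x y z ⋆ omI x y z = 1%P.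
Proof.
rewrite omE omIE !convA (convK (u := GI x y)); last by apply: gamIK.
rewrite (convK (u := GI (x ⊙ y) z)); last by apply: gamIK; cm.
rewrite (convK (u := PB x y z)); last exact: PBK.
rewrite (convK (u := G x (y ⊙ z))); last by apply: gamK; cm.
by apply: act_inv; [cm | cm | apply: gamK].
Qed.

Lemma omIK : omI x y z ⋆ om x y z = 1%P.
Proof.
rewrite omE omIE !convA (convK (u := x ▷ GI y z)); last by apply: act_inv; [cm | cm | apply: gamIK].
rewrite (convK (u := GI x (y ⊙ z))); last by apply: gamIK; cm.
rewrite (convK (u := PBI x y z)); last exact: PBIK.
rewrite (convK (u := G (x ⊙ y) z)); last by apply: gamK; cm.
exact: gamK.
Qed.

(** The word x |> y |> z |> P passes the factors of Omega from right to left and becomes in turn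
    (xy) |> z |> P, ((xy)z) |> P, (x(yz)) |> P and x |> (yz) |> P, before the leftmost factor
    restores it. *)
Lemma om_comm P : comm x P -> comm y P -> comm z P ->
  om x y z ⋆ (x ▷ y ▷ z ▷ P) = (x ▷ y ▷ z ▷ P) ⋆ om x y z.
Proof.
move=> cx cy cz; rewrite !omE.
rewrite -(convA _ (GI x y)) act_gamI; [|by cm..].
rewrite convA -(convA _ (GI (x ⊙ y) z)) act_gamI; [|by cm..].
rewrite convA -(convA _ (PB x y z)) phi_slider; [|by cm..].
rewrite convA -(convA _ (G x (y ⊙ z))) -act_gam; [|by cm..].
rewrite convA -act_conv; [|by cm..].
rewrite -act_gam; [|by cm..].
by rewrite act_conv; [rewrite !convA|by cm..].
Qed.

End ThreePoints.

Section FourPoints.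
Variables x y z w : {linear C -> H}.
Hypotheses (hx : cpt x) (hy : cpt y) (hz : cpt z) (hw : cpt w).
Hypotheses (hxy : comm x y) (hxz : comm x z) (hyz : comm y z).
Hypotheses (hxw : comm x w) (hyw : comm y w) (hzw : comm z w).

(** A cocycle identity with noncommutative coefficients: the letters gamma(z,w), gamma(x,y) and
    gamma(y,z) surround, with their inverses, the Omegas in which a product is an argument. *)
Lemma om_cocycle :
  (x ▷ y ▷ G z w) ⋆ om x y (z ⊙ w) ⋆ (x ▷ y ▷ GI z w) ⋆ (G x y ⋆ om (x ⊙ y) z w ⋆ GI x y)
  = (x ▷ om y z w) ⋆ (x ▷ G y z) ⋆ om x (y ⊙ z) w ⋆ (x ▷ GI y z) ⋆ om x y z.
Proof.
(* The two scalars from the left side of the cocycle identity of [phi], framed by the [gamma]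
   letters of x(y(zw)) and the [gammaI] letters of ((xy)z)w. *)
transitivity ((x ▷ y ▷ G z w) ⋆ (x ▷ G y (z ⊙ w)) ⋆ G x (y ⊙ (z ⊙ w)) ⋆
    (PB x y (z ⊙ w) ⋆ PB (x ⊙ y) z w) ⋆ GI (x ⊙ y ⊙ z) w ⋆ GI (x ⊙ y) z ⋆ GI x y).
  rewrite !omE !convA -(convA _ (GI x y) (x ▷ y ▷ GI z w)).
  (* The tail [GI x y] of the first Omega and the [G x y] behind it turn x |> y |> gammaI(z,w) into
     (xy) |> gammaI(z,w), the inverse of the first factor of the second Omega. *)
  rewrite -(convA _ (GI x y ⋆ (x ▷ y ▷ GI z w))) act_gamI'; [|by cm..].
  rewrite -(convA _ (x ⊙ y ▷ GI z w)) (act_inv (x := x ⊙ y) _ (u := GI z w)); [|by cm|by cm|by apply: gamIK].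
  rewrite convr1 (convK (u := GI (x ⊙ y) (z ⊙ w))) //.
  by apply: gamIK; cm.
rewrite (phi_cocycle (x := x) (y := y) (z := z) (w := w)); [|by cm..].
rewrite {1}omE !(act_conv (x := x)); [|by cm..].
rewrite (act_PB (w := x)); [|by cm..].
rewrite -(convA _ (x ▷ GI y z) (x ▷ G y z)) (act_inv (x := x) _ (u := GI y z)); [|by cm|by cm|by apply: gamIK].
rewrite convr1 !omE !convA.
rewrite (convK (u := x ▷ GI (y ⊙ z) w)); last by apply: act_inv; [cm|cm|apply: gamIK; cm].
rewrite (convK (u := x ▷ GI y z)); last by apply: act_inv; [cm|cm|apply: gamIK; cm].
rewrite (convK (u := GI x (y ⊙ z))); last by apply: gamIK; cm.
(* phi(y,z,w) moves right and phi(x,y,z) moves left to join phi(x,yz,w); the letters that they pass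
   are rebracketed as in the frame above. *)
rewrite -(convA _ (PB y z w) (G x _)) phi_slidel; [|by cm..].
rewrite -(convA _ (GI (x ⊙ (y ⊙ z)) w)) -phi_slider; [|by cm..].
by rewrite !convA.
Qed.

End FourPoints.
End Points.

Ltac cm_hook ::=
  lazymatch goal with
  | |- cpt _ => apply: cpt_mul
  | |- comm _ _ => progress rewrite ?omE ?omIE
  end.

(** * Letters equal to the unit *)

Section Points.
Variable C : coalg k.

Local Notation one := (cst C oneH).

Lemma cpt_one : cpt one.
Proof.
apply: cpt_cst; last exact: (cq_eps_one Hcq).
by rewrite (S2_lift idfun) /= (cq_Delta_one Hcq).
Qed.

Lemma one_act u : one ▷ u = u.
Proof. by apply: op2_idl => b; apply: tw_act_one. Qed.

Lemma one_mul x : one ⊙ x = x.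
Proof. by apply: op2_idl => h; apply: (alg_mul1 (cq_algebra Hcq)). Qed.

Lemma mul_one x : x ⊙ one = x.
Proof. by apply: op2_idr => h; apply: (alg_mulr1 (cq_algebra Hcq)). Qed.

Lemma gam_one1 x : cpt x -> G one x = 1%P.
Proof.
move=> hx; have h : lin (fun h : H => (ceps H h : k) *: (1 : B)) by lin.
rewrite (op2_cstl (g := mklin h)); last by move=> v; case: (tw_gamma_unital v).
by apply: linP_eq => c /=; rewrite cst_cpt.
Qed.

Lemma gam_one2 x : cpt x -> G x one = 1%P.
Proof.
move=> hx; have h : lin (fun h : H => (ceps H h : k) *: (1 : B)) by lin.
rewrite (op2_cstr (g := mklin h)); last by move=> v; case: (tw_gamma_unital v).
by apply: linP_eq => c /=; rewrite cst_cpt.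
Qed.

Lemma gamI_one1 x : cpt x -> GI one x = 1%P.
Proof.
move=> hx; rewrite -[LHS]convr1 -{1}(gam_one1 hx) gamIK //; [exact: cpt_one|cm].
Qed.

Lemma gamI_one2 x : cpt x -> GI x one = 1%P.
Proof.
move=> hx; rewrite -[LHS]convr1 -{1}(gam_one2 hx) gamIK //; [exact: cpt_one|cm].
Qed.

Lemma PB_one2 x z : cpt x -> cpt z -> comm x z -> PB x one z = 1%P.
Proof.
move=> hx hz hxz; apply: linP_eq => c; rewrite lcompE scaE cstE; congr (_ *: _).
have h : lin (fun h : H => h ⊗ oneH) by lin.
have -> : cpair x one = mklin h ∘ x.
  have <- : op2 (idfun : {linear H ⨂ H -> H ⨂ H}) x one = cpair x one by rewrite op2_id.
  by apply: op2_cstr.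
rewrite -(op2_def phi) (op2_compl (f' := ceps HH)); last first.
  move=> a b; rewrite /= ceps_tens.
  by rewrite (cq_phi_unital Hcq) (cq_eps_mul Hcq).
by rewrite op2_def; apply: (cpt_pair hx hz hxz).2.
Qed.

(* Only phi(h, 1, g) is assumed to be trivial: the cocycle identity at (1, 1, x, z)
   makes the invertible element phi(1, x, z) idempotent. *)
Lemma PB_one1 x z : cpt x -> cpt z -> comm x z -> PB one x z = 1%P.
Proof.
move=> hx hz hxz; have h1 := cpt_one.
have := phi_cocycle h1 h1 hx hz; rewrite !one_mul => /(_ ltac:(cm) ltac:(cm) ltac:(cm) ltac:(cm) ltac:(cm) hxz).
rewrite !PB_one2 //; [|by cm..]; rewrite conv1 convr1 => e.
rewrite -[LHS]conv1 -(PBIK h1 hx hz) //; [|by cm..].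
by rewrite -convA -e PBIK //; cm.
Qed.

(** The cocycle identity at (x, y, 1, 1) makes phi(x, y, 1) idempotent. *)
Lemma PB_one3 x y : cpt x -> cpt y -> comm x y -> PB x y one = 1%P.
Proof.
move=> hx hz hxz; have h1 := cpt_one.
have := phi_cocycle hx hz h1 h1; rewrite !mul_one => /(_ hxz ltac:(cm) ltac:(cm) ltac:(cm) ltac:(cm) ltac:(cm)).
rewrite !PB_one2 //; [|by cm..]; rewrite conv1 convr1 => e.
rewrite -[LHS]conv1 -(PBIK hx hz h1) //; [|by cm..].
by rewrite -convA -e PBIK //; cm.
Qed.

Lemma om_one1 y z : cpt y -> cpt z -> comm y z -> om one y z = 1%P.
Proof.
move=> hy hz hyz; rewrite !omE one_act one_mul gam_one1; [|by cm].
by rewrite PB_one1 // gamI_one1 // !convr1 gamK.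
Qed.

Lemma om_one2 x z : cpt x -> cpt z -> comm x z -> om x one z = 1%P.
Proof.
move=> hx hz hxz; rewrite !omE gam_one1 // act_cst1 // conv1 one_mul PB_one2 // convr1.
by rewrite mul_one gamI_one2 // convr1 gamK.
Qed.

Lemma om_one3 x y : cpt x -> cpt y -> comm x y -> om x y one = 1%P.
Proof.
move=> hx hy hxy; rewrite !omE gam_one2 // act_cst1 // conv1 mul_one PB_one3 // convr1.
by rewrite gamI_one2; [rewrite convr1 gamK|cm].
Qed.

End Points.

(** * The algebra on B ⨂ H ⨂ B *)

Lemma lact_ex : exists g : {linear Be B ⨂ L -> L}, forall u v a h a',
  g ((u ⊗ v) ⊗ (a ⊗ h ⊗ a')) = (u * a) ⊗ h ⊗ (a' * v).
Proof.
have /choice [f fE] (p : B * H * B) : exists f : {linear B ⨂ B -> L},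
    forall u v, f (u ⊗ v) = (u * p.1.1) ⊗ p.1.2 ⊗ (p.2 * v).
  by apply: (tens_lift (F := fun u v => (u * p.1.1) ⊗ p.1.2 ⊗ (p.2 * v))); lin.
have [||g gE] := @tens_lift_step _ _ _ _ _ _ (fun a h a' => f (a, h, a')).
- by move=> *; apply: lin_linear.
- apply: trilin_tens => [a b c|u v]; first exact: lin_linear.
  have [t1 t2 t3] : trilin (fun a h a' => (u * a) ⊗ (h : H) ⊗ (a' * v)) by lin.
  by split=> [h a'|a a'|a h] s x y; rewrite !fE /=; [apply: t1|apply: t2|apply: t3].
by exists g => *; rewrite gE fE.
Qed.

Definition lact := projT1 (cid lact_ex).
Lemma lactE u v a h a' : lact (env u v ⊗ (a ⊗ h ⊗ a')) = (u * a) ⊗ h ⊗ (a' * v).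
Proof. by rewrite /lact /env; case: cid. Qed.

Lemma lact_ind (P : L -> Prop) : (forall x y, P x -> P y -> P (x + y)) ->
  (forall a h a', P (a ⊗ h ⊗ a')) -> forall X, P X.
Proof.
move=> hP hp; elim/tens_ind=> // u v; elim/tens_ind: u => [x y hx hy|a h]; last exact: hp.
by rewrite Tensor.pureDl; apply: hP.
Qed.

Lemma L_eq (V : lmodType k) (f g : L -> V) : lin f -> lin g ->
  (forall a h a', f (a ⊗ h ⊗ a') = g (a ⊗ h ⊗ a')) -> f =1 g.
Proof. by move=> hf hg e; elim/lact_ind=> // x y hx hy; rewrite !linD // hx hy. Qed.

Lemma lactM a b u v X : lact (env a b ⊗ lact (env u v ⊗ X)) = lact (env (a * u) (v * b) ⊗ X).
Proof. by move: X; apply: L_eq => [||c h c']; [lin..|]; rewrite !lactE !mulrA. Qed.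

Lemma lact1 X : lact (env 1 1 ⊗ X) = X.
Proof. by move: X; apply: L_eq => [||c h c']; [lin..|]; rewrite !lactE mulr1 mul1r. Qed.

Lemma lin_envl (V : lmodType k) (f : V -> B) c : lin f -> lin (fun x => env (f x) c).
Proof. exact: lin_tensl. Qed.
Lemma lin_envr (V : lmodType k) (f : V -> B) c : lin f -> lin (fun x => env c (f x)).
Proof. exact: lin_tensr. Qed.

Lemma bL_ex : exists g : {linear B ⨂ L -> L}, forall b X, g (b ⊗ X) = lact (env b 1 ⊗ X).
Proof.
apply: (tens_lift (F := fun b X => lact (env b 1 ⊗ X))); split=> [X|b]; last lin.
by apply: lin_app; apply: lin_tensl; apply: lin_envl; apply: lin_id.
Qed.
Definition bL := projT1 (cid bL_ex).
Lemma bLE b X : bL (b ⊗ X) = lact (env b 1 ⊗ X).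
Proof. by rewrite /bL; case: cid. Qed.

Lemma bR_ex : exists g : {linear L ⨂ B -> L}, forall X b, g (X ⊗ b) = lact (env 1 b ⊗ X).
Proof.
apply: (tens_lift (F := fun X b => lact (env 1 b ⊗ X))); split=> [X|b]; first lin.
by apply: lin_app; apply: lin_tensl; apply: lin_envr; apply: lin_id.
Qed.
Definition bR := projT1 (cid bR_ex).
Lemma bRE b X : bR (X ⊗ b) = lact (env 1 b ⊗ X).
Proof. by rewrite /bR; case: cid. Qed.

Lemma br_ex (a a' : B) : exists g : {linear H -> L}, forall h, g h = a ⊗ h ⊗ a'.
Proof. by have h : lin (fun h : H => a ⊗ h ⊗ a') by [lin]; exists (mklin h). Qed.
Definition brr a a' := projT1 (cid (br_ex a a')).
Lemma brrE a a' h : brr a a' h = a ⊗ h ⊗ a'.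
Proof. by rewrite /brr; case: cid. Qed.

Local Notation br := (brr 1 1).
Local Notation bra a a' := (brr a a').
Local Notation "u ∙> M" := (op2 bL u M) (at level 42, right associativity).
Local Notation "M <∙ u" := (op2 bR M u) (at level 43, left associativity).

Lemma brr_br a a' h : a ⊗ h ⊗ a' = lact (env a a' ⊗ br h).
Proof. by rewrite brrE lactE mulr1 mul1r. Qed.

Section Points.
Variable C : coalg k.

Implicit Types M N : {linear C -> L}.

Lemma bLA u v M : u ∙> (v ∙> M) = (u ⋆ v) ∙> M.
Proof. by apply: op2_assoc => a b X; rewrite !bLE lactM mulBE mulr1. Qed.

Lemma bRA u v M : M <∙ u <∙ v = M <∙ (u ⋆ v).
Proof. by symmetry; apply: op2_assoc => X a b; rewrite !bRE lactM mulBE mulr1. Qed.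

Lemma bLR u v M : u ∙> (M <∙ v) = (u ∙> M) <∙ v.
Proof. by apply: op2_assoc => a X b; rewrite bLE !bRE bLE !lactM !mulr1 !mul1r. Qed.

Lemma bL1 M : 1%P ∙> M = M.
Proof. by apply: op2_idl => X; rewrite bLE lact1. Qed.

Lemma bR1 M : M <∙ 1%P = M.
Proof. by apply: op2_idr => X; rewrite bRE lact1. Qed.

Definition core x y : {linear C -> L} := G x y ∙> ((br ∘ (x ⊙ y)) <∙ GI x y).

End Points.

(** The product of 1 (x) h (x) 1 and b (x) g (x) b' as a word in the two projections, with b and b'
    as constant letters; the outer scalars a and a' are added by left linearity. *)
Definition mulW (b b' : B) : {linear HH -> L} :=
  ((p1 ▷ cst HH b) ∙> core p1 p2) <∙ (p1 ▷ cst HH b').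

Lemma mul_ex : exists g : {linear L ⨂ L -> L}, forall a h a' b g' b',
  g ((a ⊗ h ⊗ a') ⊗ (b ⊗ g' ⊗ b')) = lact (env a a' ⊗ mulW b b' (h ⊗ g')).
Proof.
apply: (tens_lift33 (F := fun a h a' b g' b' => lact (env a a' ⊗ mulW b b' (h ⊗ g')))).
  move=> b g b'; split=> [h a'|a a'|a h]; [|lin|].
    by apply: lin_app; apply: lin_tensl; apply: lin_envl; apply: lin_id.
  by apply: lin_app; apply: lin_tensl; apply: lin_envr; apply: lin_id.
move=> a h a'; split=> [g b'|b b'|b g]; rewrite /mulW.
- lin.
- lin.
- lin.
Qed.
Definition Lmul := projT1 (cid mul_ex).
Lemma LmulE a h a' b g b' :
  Lmul ((a ⊗ h ⊗ a') ⊗ (b ⊗ g ⊗ b')) = lact (env a a' ⊗ mulW b b' (h ⊗ g)).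
Proof. by rewrite /Lmul; case: cid. Qed.

Local Notation mul := Lmul.
Local Notation lac := lact.
Opaque lact bL bR brr Lmul.

Lemma Lmul_lact u v X Y : mul (lac (env u v ⊗ X) ⊗ Y) = lac (env u v ⊗ mul (X ⊗ Y)).
Proof.
move: X; apply: L_eq => [||a h a']; [lin..|].
move: Y; apply: L_eq => [||b g b']; [lin..|].
by rewrite lactE !LmulE lactM.
Qed.

Lemma act_cst (C : coalg k) (x : {linear C -> H}) b : op2 act x (cst C b) = acti b ∘ x.
Proof. exact: op2_cstr. Qed.

Lemma cpt_p1 : cpt p1. Proof. exact: cpt_prl. Qed.
Lemma cpt_p2 : cpt p2. Proof. exact: cpt_prr. Qed.
Lemma comm_p12 : comm p1 p2.
Proof.
have -> : p1 = idfun ∘ p1 by apply: linP_eq.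
have -> : p2 = idfun ∘ p2 by apply: linP_eq.
exact: comm_prl_prr.
Qed.

Lemma mulW_l b c c' h g : mulW (b * c) c' (h ⊗ g)
  = S2 h (fun h1 h2 => bL (act (h1 ⊗ b) ⊗ mulW c c' (h2 ⊗ g))).
Proof.
rewrite /mulW -conv_cst act_conv; [|exact: cpt_p1|cm].
by rewrite -bLA -bLR act_cst op2_tens_prll.
Qed.

Lemma mulW_r b c c' h g : mulW c (c' * b) (h ⊗ g)
  = S2 h (fun h1 h2 => bR (mulW c c' (h1 ⊗ g) ⊗ act (h2 ⊗ b))).
Proof.
rewrite /mulW -conv_cst act_conv; [|exact: cpt_p1|cm].
by rewrite -bRA (act_cst p1 b) op2_tens_prlr.
Qed.

Lemma Lmul_br h b g b' : mul (br h ⊗ (b ⊗ g ⊗ b')) = mulW b b' (h ⊗ g).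
Proof. by rewrite brrE LmulE lact1. Qed.

Lemma Lmul_bL h b Y : mul (br h ⊗ bL (b ⊗ Y))
  = S2 h (fun h1 h2 => bL (act (h1 ⊗ b) ⊗ mul (br h2 ⊗ Y))).
Proof.
move: Y; apply: L_eq => [||c g c']; [lin..|].
rewrite bLE lactE mulr1 Lmul_br mulW_l; apply: S2_ext => h1 h2.
by rewrite Lmul_br.
Qed.

Lemma Lmul_bR h b Y : mul (br h ⊗ bR (Y ⊗ b))
  = S2 h (fun h1 h2 => bR (mul (br h1 ⊗ Y) ⊗ act (h2 ⊗ b))).
Proof.
move: Y; apply: L_eq => [||c g c']; [lin..|].
rewrite bRE lactE mul1r Lmul_br mulW_r; apply: S2_ext => h1 h2.
by rewrite Lmul_br.
Qed.

Section Points.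
Variable C : coalg k.

Implicit Types (M N : {linear C -> L}) (x y z w : {linear C -> H}) (u v P : {linear C -> B}).

Lemma bL_mul u M N : op2 mul (u ∙> M) N = u ∙> op2 mul M N.
Proof.
by symmetry; apply: op2_assoc => a X Y; rewrite !bLE Lmul_lact.
Qed.

Lemma bR_mul u M N : comm u N -> op2 mul (M <∙ u) N = op2 mul M N <∙ u.
Proof. by move=> c; apply: op2_exchr => // X a Y; rewrite !bRE Lmul_lact. Qed.

Let mulb : {linear H ⨂ L -> L} := mul ∘ tmap br idfun.
Let mulbE h Y : mulb (h ⊗ Y) = mul (br h ⊗ Y).
Proof. by rewrite /mulb lcompE tmapE. Qed.

Let op2_mulb x N : op2 mul (br ∘ x) N = op2 mulb x N.
Proof. by apply: op2_compl => h Y; rewrite mulbE. Qed.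

Lemma mul_bL x u N : cpt x -> comm x u ->
  op2 mul (br ∘ x) (u ∙> N) = (x ▷ u) ∙> op2 mul (br ∘ x) N.
Proof.
move=> hx c; rewrite !op2_mulb; apply: op2_distr => // h a Y.
by rewrite mulbE Lmul_bL; apply: S2_ext => h1 h2; rewrite mulbE.
Qed.

Lemma mul_bR x u N : cpt x -> comm x N ->
  op2 mul (br ∘ x) (N <∙ u) = op2 mul (br ∘ x) N <∙ (x ▷ u).
Proof.
move=> hx c; rewrite !op2_mulb; apply: op2_distr => // h Y a.
by rewrite mulbE Lmul_bR; apply: S2_ext => h1 h2; rewrite mulbE.
Qed.

(** A pair of commuting points factors through the projections of H (x) H, where the equation is the
    definition of [mulW]. *)
Lemma mul_core x y : cpt x -> cpt y -> comm x y -> op2 mul (br ∘ x) (br ∘ y) = core x y.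
Proof.
move=> hx hy hxy.
have hz : cpt (D := HH) (cpair x y) by apply: cpt_pair.
have -> : op2 mul (br ∘ x) (br ∘ y) = mulW 1 1 ∘ cpair x y.
  rewrite op2_mulb -op2_def; apply: op2_compr => h g.
  by rewrite mulbE (brrE 1 1 g) Lmul_br.
rewrite /mulW !act_cst1; [|exact: cpt_p1..].
rewrite bL1 bR1 /core !(op2_pull _ _ _ hz) -(lcompA br) !(op2_pull _ _ _ hz).
by rewrite prl_pair // prr_pair.
Qed.
End Points.

(** * The counit *)

Lemma epsL_ex : exists g : {linear L -> B}, forall a h a', g (a ⊗ h ⊗ a') = (ceps H h : k) *: (a * a').
Proof. by apply: (tens_lift3 (F := fun a h a' => (ceps H h : k) *: (a * a'))); lin. Qed.
Definition epsL := projT1 (cid epsL_ex).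
Lemma epsLE a h a' : epsL (a ⊗ h ⊗ a') = (ceps H h : k) *: (a * a').
Proof. by rewrite /epsL; case: cid. Qed.

Lemma epsL_lact u v X : epsL (lac (env u v ⊗ X)) = u * epsL X * v.
Proof.
move: X; apply: L_eq => [||a h a']; [lin..|].
by rewrite lactE !epsLE -scalerAr -scalerAl !mulrA.
Qed.

Section EpsPoints.
Variable C : coalg k.

Implicit Types (M N : {linear C -> L}) (x y z w : {linear C -> H}) (u v P : {linear C -> B}).

Lemma epsL_bL u M : epsL ∘ (u ∙> M) = u ⋆ (epsL ∘ M).
Proof.
rewrite op2_comp; symmetry; apply: op2_compr => a X.
by rewrite mulBE lcompE bLE epsL_lact mulr1.
Qed.

Lemma epsL_bR u M : epsL ∘ (M <∙ u) = (epsL ∘ M) ⋆ u.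
Proof.
rewrite op2_comp; symmetry; apply: op2_compl => X a.
by rewrite mulBE lcompE bRE epsL_lact mul1r.
Qed.

Lemma epsL_br x : cpt x -> epsL ∘ (br ∘ x) = 1%P.
Proof.
by move=> hx; apply: linP_eq => c; rewrite !lcompE brrE epsLE mulr1 (cst_cpt _ _ hx).
Qed.

Lemma epsL_core x y : cpt x -> cpt y -> comm x y -> epsL ∘ core x y = 1%P.
Proof.
move=> hx hy hxy; rewrite /core epsL_bL epsL_bR epsL_br; last by apply: cpt_mul.
by rewrite conv1 gamK.
Qed.
End EpsPoints.

(** In the counit of a product [gamma] meets [gammaI] and cancels, so only the scalars of [Y]
    survive. Hence the counit of a product depends on its second factor through the counit of that
    factor alone. *)
Lemma epsL_mul h Y : epsL (mul (br h ⊗ Y)) = act (h ⊗ epsL Y).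
Proof.
move: Y; apply: L_eq => [||b g b']; [lin..|].
rewrite Lmul_br epsLE -[LHS]/((epsL ∘ mulW b b') (h ⊗ g)) /mulW epsL_bR epsL_bL.
rewrite epsL_core; [|exact: cpt_p1|exact: cpt_p2|exact: comm_p12].
rewrite convr1 -act_conv; [|exact: cpt_p1|cm].
by rewrite conv_cst act_cst lcompE prlE linearZ [in RHS]Tensor.pureZr linearZ.
Qed.

(** * The cocycle *)

(* The parameter om0 is Omega or its inverse. *)
Section Phi.
Variable om0 : {linear HHH -> B}.

(** As in [mulW], the outer scalars of the first argument are left to linearity. Linearity and
    balancing of the resulting map hold for every [om0]. *)
Definition PhiW (b b' c c' : B) : {linear HHH -> B} :=
  (q1 ▷ (cst HHH b ⋆ (q2 ▷ cst HHH c))) ⋆ om0 ⋆ (q1 ▷ ((q2 ▷ cst HHH c') ⋆ cst HHH b')).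

Lemma Phi_ex : exists g : {linear L ⨂ L ⨂ L -> B}, forall a h a' b g' b' c f c',
  g ((a ⊗ h ⊗ a') ⊗ (b ⊗ g' ⊗ b') ⊗ (c ⊗ f ⊗ c')) = a * PhiW b b' c c' (h ⊗ g' ⊗ f) * a'.
Proof.
apply: (tens_lift333 (F := fun a h a' b g' b' c f c' => a * PhiW b b' c c' (h ⊗ g' ⊗ f) * a')).
- by move=> *; split=> *; lin.
- by move=> *; split=> *; rewrite /PhiW; lin.
- by move=> *; split=> *; rewrite /PhiW; lin.
Qed.
Definition Phi := projT1 (cid Phi_ex).
Lemma PhiE a h a' b g b' c f c' :
  Phi ((a ⊗ h ⊗ a') ⊗ (b ⊗ g ⊗ b') ⊗ (c ⊗ f ⊗ c')) = a * PhiW b b' c c' (h ⊗ g ⊗ f) * a'.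
Proof. by rewrite /Phi; case: cid. Qed.
Opaque Phi.

Lemma cpt_q1 : cpt q1. Proof. exact: cpt_comp (cpt_prl _ _) (cpt_prl _ _). Qed.
Lemma cpt_q2 : cpt q2. Proof. exact: cpt_comp (cpt_prl _ _) (cpt_prr _ _). Qed.
Lemma cpt_q3 : cpt q3. Proof. exact: cpt_prr. Qed.
Lemma comm_q12 : comm q1 q2.
Proof. exact (comm_pull (cpt_prl HH H) (@comm_p12)). Qed.
Lemma comm_q13 : comm q1 q3.
Proof. have -> : q3 = idfun ∘ q3 by [apply: linP_eq]; exact: comm_prl_prr. Qed.
Lemma comm_q23 : comm q2 q3.
Proof. have -> : q3 = idfun ∘ q3 by [apply: linP_eq]; exact: comm_prl_prr. Qed.

Lemma Phi_lact u v X Y Z : Phi (lac (env u v ⊗ X) ⊗ Y ⊗ Z) = u * Phi (X ⊗ Y ⊗ Z) * v.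
Proof.
move: X; apply: L_eq => [||a h a']; [lin..|].
move: Y; apply: L_eq => [||b g b']; [lin..|].
move: Z; apply: L_eq => [||c f c']; [lin..|].
by rewrite lactE !PhiE !mulrA.
Qed.

Lemma Phi_br h b g b' c f c' :
  Phi (br h ⊗ (b ⊗ g ⊗ b') ⊗ (c ⊗ f ⊗ c')) = PhiW b b' c c' (h ⊗ g ⊗ f).
Proof. by rewrite brrE PhiE mul1r mulr1. Qed.

Lemma PhiW_l b b0 b' c c' :
  PhiW (b * b0) b' c c' = (acti b ∘ q1) ⋆ PhiW b0 b' c c'.
Proof.
rewrite /PhiW -act_cst -conv_cst -(convA (cst HHH b)) act_conv; [|exact: cpt_q1|cm].
by rewrite !convA.
Qed.

Lemma PhiW_r b b' b0 c c' :
  PhiW b (b0 * b') c c' = PhiW b b0 c c' ⋆ (acti b' ∘ q1).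
Proof.
rewrite /PhiW -act_cst -conv_cst (convA _ (cst HHH b0)) (act_conv (u := _ ⋆ _)); [|exact: cpt_q1|].
  by rewrite !convA.
by apply: comm_op2; [apply: comm_op2; [exact: comm_q12|cm]|cm].
Qed.

Definition act2c c : {linear HH -> B} := op2 act p1 (acti c ∘ p2).

Lemma act2cE c h g : act2c c (h ⊗ g) = act (h ⊗ act (g ⊗ c)).
Proof.
have e : p1 = idfun ∘ p1 by apply: linP_eq.
by rewrite /act2c e op2_def lcompE pair_prl_prr.
Qed.

Lemma act2c_pull c : q1 ▷ q2 ▷ cst HHH c = act2c c ∘ prl HH H.
  Proof. by rewrite act_cst /act2c (op2_pull _ _ _ (cpt_prl HH H)) -(lcompA (acti c)). Qed.

Lemma PhiW_ll c c0 c' : PhiW 1 1 (c * c0) c' = (act2c c ∘ prl HH H) ⋆ PhiW 1 1 c0 c'.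
Proof.
rewrite /PhiW -act2c_pull !conv1 !convr1 -conv_cst act_conv; [|exact: cpt_q2|cm].
rewrite act_conv; [|exact: cpt_q1|by apply: comm_op2; [exact: comm_q12|cm]].
by rewrite !convA.
Qed.

Lemma PhiW_rr c c0 c' : PhiW 1 1 c (c0 * c') = PhiW 1 1 c c0 ⋆ (act2c c' ∘ prl HH H).
Proof.
rewrite /PhiW -act2c_pull !conv1 !convr1 -conv_cst act_conv; [|exact: cpt_q2|cm].
rewrite act_conv; [|exact: cpt_q1|by apply: comm_op2; [exact: comm_q12|cm]].
by rewrite !convA.
Qed.

Lemma Phi_bL2 h b Y Z : Phi (br h ⊗ bL (b ⊗ Y) ⊗ Z)
  = S2 h (fun h1 h2 => act (h1 ⊗ b) * Phi (br h2 ⊗ Y ⊗ Z)).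
Proof.
move: Y; apply: L_eq => [||b0 g b']; [lin..|].
move: Z; apply: L_eq => [||c f c']; [lin..|].
rewrite bLE lactE mulr1 Phi_br PhiW_l op2_tens3_prlll.
by apply: S2_ext => h1 h2; rewrite Phi_br mulBE.
Qed.

Lemma Phi_bR2 h b Y Z : Phi (br h ⊗ bR (Y ⊗ b) ⊗ Z)
  = S2 h (fun h1 h2 => Phi (br h1 ⊗ Y ⊗ Z) * act (h2 ⊗ b)).
Proof.
move: Y; apply: L_eq => [||b0 g b']; [lin..|].
move: Z; apply: L_eq => [||c f c']; [lin..|].
rewrite bRE lactE mul1r Phi_br PhiW_r op2_tens3_prllr.
by apply: S2_ext => h1 h2; rewrite Phi_br mulBE.
Qed.

Lemma Phi_brr h g c f c' : Phi (br h ⊗ br g ⊗ (c ⊗ f ⊗ c')) = PhiW 1 1 c c' (h ⊗ g ⊗ f).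
Proof. by rewrite (brrE 1 1 g) Phi_br. Qed.

Lemma Phi_bL3 h g c Z : Phi (br h ⊗ br g ⊗ bL (c ⊗ Z))
  = S2 h (fun h1 h2 => S2 g (fun g1 g2 => act (h1 ⊗ act (g1 ⊗ c)) * Phi (br h2 ⊗ br g2 ⊗ Z))).
Proof.
move: Z; apply: L_eq => [||c0 f c']; [lin..|].
rewrite bLE lactE mulr1 Phi_brr PhiW_ll op2_tens3_prll.
by apply: S2_ext => h1 h2; apply: S2_ext => g1 g2; rewrite Phi_brr mulBE act2cE.
Qed.

Lemma Phi_bR3 h g c Z : Phi (br h ⊗ br g ⊗ bR (Z ⊗ c))
  = S2 h (fun h1 h2 => S2 g (fun g1 g2 => Phi (br h1 ⊗ br g1 ⊗ Z) * act (h2 ⊗ act (g2 ⊗ c)))).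
Proof.
move: Z; apply: L_eq => [||c0 f c']; [lin..|].
rewrite bRE lactE mul1r Phi_brr PhiW_rr op2_tens3_prlr.
by apply: S2_ext => h1 h2; apply: S2_ext => g1 g2; rewrite Phi_brr mulBE act2cE.
Qed.

Lemma Phi_brrr h g f : Phi (br h ⊗ br g ⊗ br f) = om0 (h ⊗ g ⊗ f).
Proof.
rewrite (brrE 1 1 f) Phi_brr /PhiW !act_cst1; [|exact: cpt_q2|exact: cpt_q1..].
by rewrite !conv1 act_cst1 ?conv1 ?convr1 //; exact: cpt_q1.
Qed.

End Phi.

Opaque epsL Phi.

Section PhiPoints.
Variable om0 : {linear HHH -> B}.
Variable C : coalg k.

Implicit Types (M N Q : {linear C -> L}) (x y z w : {linear C -> H}) (u v P : {linear C -> B}).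

Definition Ph M N Q : {linear C -> B} := op2 (Phi om0) (cpair M N) Q.

Lemma Ph_bL1 u M N Q : Ph (u ∙> M) N Q = u ⋆ Ph M N Q.
Proof.
rewrite /Ph; have [g [gE ->]] := pair_op2l C L bL.
symmetry; apply: op2_assoc => b XY Z; rewrite mulBE.
move: XY; apply: lin_ind => [||X Y]; [lin..|].
by rewrite gE bLE Phi_lact mulr1.
Qed.

Lemma Ph_bR1 u M N Q : comm u N -> comm u Q -> Ph (M <∙ u) N Q = Ph M N Q ⋆ u.
Proof.
move=> cN cQ; rewrite /Ph; have [g [gE ->//]] := pair_op2r C L bR.
apply: op2_exchr => // XY b Z; rewrite mulBE.
move: XY; apply: lin_ind => [||X Y]; [lin..|].
by rewrite gE bRE Phi_lact mul1r.
Qed.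

Let Ph2_ex : exists g : {linear H ⨂ (L ⨂ L) -> B}, forall h Y Z,
  g (h ⊗ (Y ⊗ Z)) = Phi om0 (br h ⊗ Y ⊗ Z).
Proof. by apply: (tens_lift3r (F := fun h Y Z => Phi om0 (br h ⊗ Y ⊗ Z))); lin. Qed.

Let Ph2E (g : {linear H ⨂ (L ⨂ L) -> B}) x N Q : (forall h Y Z, g (h ⊗ (Y ⊗ Z)) = Phi om0 (br h ⊗ Y ⊗ Z)) ->
  Ph (br ∘ x) N Q = op2 g x (cpair N Q).
Proof.
move=> gE; rewrite /Ph.
have -> : cpair N Q = op2 (idfun : {linear L ⨂ L -> L ⨂ L}) N Q by rewrite op2_id.
rewrite pair_compl -op2_def; symmetry; apply: op2_assoc => h Y Z.
by rewrite gE tmapE.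
Qed.

Lemma Ph_bL2 x u N Q : cpt x -> comm x u ->
  Ph (br ∘ x) (u ∙> N) Q = (x ▷ u) ⋆ Ph (br ∘ x) N Q.
Proof.
move=> hx cu; have [f fE] := Ph2_ex; rewrite !(Ph2E _ _ _ fE).
have [g [gE ->]] := pair_op2l C L bL.
apply: op2_distr => // h b YZ; move: YZ; apply: lin_ind => [||Y Z]; [lin..|].
by rewrite gE fE Phi_bL2; apply: S2_ext => *; rewrite mulBE fE.
Qed.

Lemma Ph_bR2 x u N Q : cpt x -> comm x N -> comm x Q -> comm u Q ->
  Ph (br ∘ x) (N <∙ u) Q = Ph (br ∘ x) N Q ⋆ (x ▷ u).
Proof.
move=> hx cN cQ cu; have [f fE] := Ph2_ex; rewrite !(Ph2E _ _ _ fE).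
have [g [gE ->//]] := pair_op2r C L bR.
apply: op2_distr => // [h YZ b|]; last by cm.
move: YZ; apply: lin_ind => [||Y Z]; [lin..|].
by rewrite gE fE Phi_bR2; apply: S2_ext => *; rewrite mulBE fE.
Qed.

Let Ph3 : {linear HH ⨂ L -> B} := Phi om0 ∘ tmap (tmap br br) idfun.
Let Ph3E h g Z : Ph3 ((h ⊗ g) ⊗ Z) = Phi om0 (br h ⊗ br g ⊗ Z).
Proof. by rewrite /Ph3 lcompE !tmapE. Qed.

Let Ph3_pt x y Q : Ph (br ∘ x) (br ∘ y) Q = op2 Ph3 (cpair x y) Q.
Proof.
rewrite /Ph -tmap_pair; apply: op2_compl => hg Z.
by rewrite /Ph3 lcompE tmapE.
Qed.

Let act2_pt x y u : x ▷ y ▷ u = op2 act2 (cpair x y) u.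
Proof.
have -> : cpair x y = op2 (idfun : {linear H ⨂ H -> H ⨂ H}) x y by rewrite op2_id.
by apply: op2_assoc => *; rewrite act2E.
Qed.

Lemma Ph_bL3 x y u Q : cpt x -> cpt y -> comm x y -> comm x u -> comm y u ->
  Ph (br ∘ x) (br ∘ y) (u ∙> Q) = (x ▷ y ▷ u) ⋆ Ph (br ∘ x) (br ∘ y) Q.
Proof.
move=> hx hy hxy cx cy; rewrite !Ph3_pt act2_pt.
apply: (op2_distr (D := HH)); [|exact: cpt_pair|by cm] => hg b Z.
rewrite bLE; move: hg; apply: lin_ind => [||h g]; [lin..|].
rewrite Ph3E -bLE Phi_bL3 S2_tens; last lin.
by apply: S2_ext => *; apply: S2_ext => *; rewrite mulBE act2E Ph3E.
Qed.

Lemma Ph_bR3 x y u Q : cpt x -> cpt y -> comm x y -> comm x Q -> comm y Q ->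
  Ph (br ∘ x) (br ∘ y) (Q <∙ u) = Ph (br ∘ x) (br ∘ y) Q ⋆ (x ▷ y ▷ u).
Proof.
move=> hx hy hxy cx cy; rewrite !Ph3_pt act2_pt.
apply: (op2_distr (D := HH)); [|exact: cpt_pair|by cm] => hg Z b.
rewrite bRE; move: hg; apply: lin_ind => [||h g]; [lin..|].
rewrite Ph3E -bRE Phi_bR3 S2_tens; last lin.
by apply: S2_ext => *; apply: S2_ext => *; rewrite mulBE act2E Ph3E.
Qed.

Lemma Ph_br x y z : Ph (br ∘ x) (br ∘ y) (br ∘ z) = om0 ∘ cpair (cpair x y) z.
Proof.
rewrite /Ph -tmap_pair op2_def -tmap_pair lcompA; congr (_ ∘ _).
by apply: tens_lin_eq3 => h g f; rewrite !lcompE !tmapE Phi_brrr.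
Qed.

End PhiPoints.

Section TriPoints.
Variable C : coalg k.

Implicit Types (M N Q : {linear C -> L}) (x y z w : {linear C -> H}) (u v P : {linear C -> B}).

(* The element u[x]v. *)
Definition tri u x v : {linear C -> L} := (u ∙> (br ∘ x)) <∙ v.

Lemma tri_bL u v x P : u ∙> tri v x P = tri (u ⋆ v) x P.
Proof. by rewrite /tri bLR bLA. Qed.

Lemma tri_bR u v x P : tri v x P <∙ u = tri v x (P ⋆ u).
Proof. by rewrite /tri bRA. Qed.

Lemma tri_brr a a' x : brr a a' ∘ x = tri (cst C a) x (cst C a').
Proof.
have [g gE] : exists g : {linear L -> L}, forall X, g X = bL (a ⊗ X).
  by have h : lin (fun X : L => bL (a ⊗ X)) by [lin]; exists (mklin h).
have [f fE] : exists f : {linear L -> L}, forall X, f X = bR (X ⊗ a').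
  by have h : lin (fun X : L => bR (X ⊗ a')) by [lin]; exists (mklin h).
rewrite /tri (op2_cstl (g := g)) // (op2_cstr (g := f)) //.
apply: linP_eq => c; rewrite !lcompE fE gE bLE bRE brrE brrE !lactE.
by rewrite !mulr1 !mul1r.
Qed.

(** The right-hand scalar [u'] of the first factor ends up at the far right, so it has to pass every
    letter of the second factor. *)
Lemma mul_tri u x u' v y v' : cpt x -> cpt y -> comm x y -> comm x v ->
  comm u' v -> comm u' y -> comm u' v' ->
  op2 mul (tri u x u') (tri v y v')
  = tri (u ⋆ (x ▷ v) ⋆ G x y) (x ⊙ y) (GI x y ⋆ (x ▷ v') ⋆ u').
Proof.
move=> hx hy hxy xv uv uy uv'; rewrite {1}/tri bR_mul; last by cm.
rewrite bL_mul {1}/tri mul_bR //; last by cm.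
rewrite mul_bL // mul_core //.
by rewrite /core /tri !(bLR, bLA, bRA) !convA.
Qed.

Variable om0 : {linear HHH -> B}.

Lemma Ph_tri u x u' v y v' (r : {linear C -> B}) z (r' : {linear C -> B}) : cpt x -> cpt y -> cpt z ->
  comm x y -> comm x z -> comm y z -> comm x v -> comm x r -> comm x r' -> comm y r ->
  comm u' v -> comm u' y -> comm u' v' -> comm u' r -> comm u' z -> comm u' r' ->
  comm v' r -> comm v' z -> comm v' r' ->
  Ph om0 (tri u x u') (tri v y v') (tri r z r')
  = u ⋆ (x ▷ (v ⋆ (y ▷ r))) ⋆ (om0 ∘ cpair (cpair x y) z) ⋆ (x ▷ ((y ▷ r') ⋆ v')) ⋆ u'.
Proof.
move=> hx hy hz xy xz yz xv xw xw' yw uv uy uv' uw uz uw' v'r v'z v'r'.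
rewrite {1}/tri Ph_bR1; [|by cm..].
rewrite Ph_bL1 {1}/tri Ph_bR2 //; [|by cm..].
rewrite Ph_bL2 //; rewrite /tri Ph_bR3 //; [|by cm..].
rewrite Ph_bL3 // Ph_br act_conv; [|by cm..].
rewrite (act_conv (u := y ▷ r')); [|by cm..].
by rewrite !convA.
Qed.

Lemma bL_sca (s : {linear C -> k^o}) (M : {linear C -> H}) :
  (sca B ∘ s) ∙> (br ∘ M) = br ∘ op2 (scl H) s M.
Proof.
apply: linP_eq => c; rewrite [RHS](lcompE br) !op2E (S2_mor (f := br)); last lin.
apply: S2_ext => c1 c2; rewrite (lcompE (sca B)) (lcompE br) scaE sclE Tensor.pureZl (linZ (lin_linear bL)).
by rewrite bLE lact1 (linZ (lin_linear br)).
Qed.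

Lemma bR_sca (s : {linear C -> k^o}) (M : {linear C -> H}) :
  (br ∘ M) <∙ (sca B ∘ s) = br ∘ op2 (scr H) M s.
Proof.
apply: linP_eq => c; rewrite [RHS](lcompE br) !op2E (S2_mor (f := br)); last lin.
apply: S2_ext => c1 c2; rewrite (lcompE (sca B)) (lcompE br) scaE scrE Tensor.pureZr (linZ (lin_linear bR)).
by rewrite bRE lact1 (linZ (lin_linear br)).
Qed.

(** Axiom (3) in the middle letter: [phi] leaves the left scalar and enters the right one, and the
    middle letter is rebracketed on the way. *)
Lemma tri_slide u x y z v : cpt x -> cpt y -> cpt z -> comm x y -> comm x z -> comm y z ->
  tri (u ⋆ PB x y z) ((x ⊙ y) ⊙ z) v = tri u (x ⊙ (y ⊙ z)) (PB x y z ⋆ v).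
Proof.
move=> hx hy hz xy xz yz; rewrite /tri -bLA -bRA bL_sca phi_quasi_assoc //.
by rewrite -bR_sca bLR.
Qed.

End TriPoints.

Lemma om_pull (C D : coalg k) (t : {linear C -> D}) (x y z : {linear D -> H}) :
  cpt t -> om x y z ∘ t = om (x ∘ t) (y ∘ t) (z ∘ t).
Proof.
move=> ht; rewrite !omE !(op2_pull _ _ _ ht) -(lcompA (sca B)) -(lcompA phi).
by rewrite !(pair_pull _ _ ht).
Qed.

(** Omega at the universal triple: commuting points x, y, z factor through their pairing into [HHH],
    and [om x y z] is the pullback of [omU]. *)
Definition omU : {linear HHH -> B} := om q1 q2 q3.
Definition omUI : {linear HHH -> B} := omI q1 q2 q3.

Lemma omUK : op2 (mulB B) omU omUI = cst HHH 1.
Proof.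
apply: omK; [exact: cpt_q1|exact: cpt_q2|exact: cpt_q3|exact: comm_q12|exact: comm_q13|exact: comm_q23].
Qed.
Lemma omUIK : op2 (mulB B) omUI omU = cst HHH 1.
Proof.
apply: omIK; [exact: cpt_q1|exact: cpt_q2|exact: cpt_q3|exact: comm_q12|exact: comm_q13|exact: comm_q23].
Qed.

(** * The axioms as identities between words *)

Section Words.
Variable C : coalg k.

Implicit Types (M N Q : {linear C -> L}) (u v P : {linear C -> B}).
Section ThreePoints.
Variables x y z : {linear C -> H}.
Hypotheses (hx : cpt x) (hy : cpt y) (hz : cpt z).
Hypotheses (hxy : comm x y) (hxz : comm x z) (hyz : comm y z).

Let cpt3 : cpt (D := HHH) (cpair (cpair x y) z).
Proof. by cm. Qed.

Let q1_pt : q1 ∘ cpair (cpair x y) z = x.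
Proof. by rewrite -(lcompA (prl H H)) !prl_pair. Qed.
Let q2_pt : q2 ∘ cpair (cpair x y) z = y.
Proof. by rewrite -(lcompA (prr H H)) prl_pair // prr_pair. Qed.
Let q3_pt : q3 ∘ cpair (cpair x y) z = z.
Proof. by rewrite prr_pair //; apply: cpt_pair. Qed.

Lemma omU_pt : omU ∘ cpair (cpair x y) z = om x y z.
Proof. by rewrite /omU om_pull // q1_pt q2_pt q3_pt. Qed.

Lemma Ph_brr_word a a' b b' c c' om0 : Ph om0 (bra a a' ∘ x) (bra b b' ∘ y) (bra c c' ∘ z)
  = cst C a ⋆ (x ▷ (cst C b ⋆ (y ▷ cst C c))) ⋆ (om0 ∘ cpair (cpair x y) z)
    ⋆ (x ▷ ((y ▷ cst C c') ⋆ cst C b')) ⋆ cst C a'.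
Proof. by rewrite !tri_brr Ph_tri //; cm. Qed.

(** The scalars are distributed as the coproduct does it: left ones in the first Sweedler factors,
    right ones in the second. *)
Lemma assoc_word a a' b b' c c' :
  Ph omU (bra a 1 ∘ x) (bra b 1 ∘ y) (bra c 1 ∘ z)
    ∙> op2 mul (op2 mul (bra 1 a' ∘ x) (bra 1 b' ∘ y)) (bra 1 c' ∘ z)
  = op2 mul (bra a 1 ∘ x) (op2 mul (bra b 1 ∘ y) (bra c 1 ∘ z))
    <∙ Ph omU (bra 1 a' ∘ x) (bra 1 b' ∘ y) (bra 1 c' ∘ z).
Proof.
rewrite !Ph_brr_word omU_pt !tri_brr.
rewrite !act_cst1 // ?conv1 ?convr1 ?act_cst1 // ?conv1 ?convr1.
rewrite mul_tri; [|by cm..].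
rewrite mul_tri; [|by cm..].
rewrite [in RHS]mul_tri; [|by cm..].
rewrite [in RHS]mul_tri; [|by cm..].
rewrite tri_bL tri_bR !(act_cst1, conv1, convr1); try by cm.
(* The [gammaI] tail of Omega cancels the [gamma] letters of (xy)z and leaves those of x(yz)
   followed by [phi]; [e2] uses the head of Omega in the same way against the [gammaI] letters of
   x(yz). *)
have e1 : om x y z ⋆ G x y ⋆ G (x ⊙ y) z = (x ▷ G y z) ⋆ G x (y ⊙ z) ⋆ PB x y z.
  rewrite !omE (convK (u := GI x y)); last exact: gamIK.
  by rewrite convK //; apply: gamIK; cm.
have e2 : GI x (y ⊙ z) ⋆ (x ▷ GI y z) ⋆ om x y z = PB x y z ⋆ GI (x ⊙ y) z ⋆ GI x y.
  rewrite !omE !convA (convK (u := x ▷ GI y z)); last by apply: act_inv; [cm|cm|exact: gamIK].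
  by rewrite gamIK ?conv1 //; cm.
have -> : cst C a ⋆ (x ▷ (cst C b ⋆ (y ▷ cst C c))) ⋆ om x y z ⋆ (G x y ⋆ G (x ⊙ y) z)
  = cst C a ⋆ (x ▷ (cst C b ⋆ (y ▷ cst C c) ⋆ G y z)) ⋆ G x (y ⊙ z) ⋆ PB x y z.
  rewrite (act_conv (u := _ ⋆ (y ▷ _))); [|by cm..].
  by rewrite convA -(convA _ (om x y z)) -(convA _ (om x y z ⋆ _)) e1 !convA.
rewrite tri_slide //; congr (tri _ _ _).
rewrite [in RHS]convA [in RHS]convA e2 (act_conv (u := y ▷ cst C c')); [|by cm..].
by rewrite !convA -(convA _ (GI x y) (x ▷ y ▷ _)) act_gamI ?convA //; cm.
Qed.

(** The inner scalars are 1, so the two middle letters become adjacent: convolving values of [Phi]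
    amounts to convolving their middle letters. *)
Lemma conv_word om0 om1 a a' b b' c c' :
  Ph om0 (bra a 1 ∘ x) (bra b 1 ∘ y) (bra c 1 ∘ z)
    ⋆ Ph om1 (bra 1 a' ∘ x) (bra 1 b' ∘ y) (bra 1 c' ∘ z)
  = Ph (op2 (C := HHH) (mulB B) om0 om1) (bra a a' ∘ x) (bra b b' ∘ y) (bra c c' ∘ z).
Proof.
rewrite !Ph_brr_word (op2_pull _ _ _ cpt3).
rewrite !(act_cst1, conv1, convr1) //; try by cm.
by rewrite !convA.
Qed.

End ThreePoints.
Opaque om omI.
Section FourPoints.
Variables x y z w : {linear C -> H}.
Hypotheses (hx : cpt x) (hy : cpt y) (hz : cpt z) (hw : cpt w).
Hypotheses (hxy : comm x y) (hxz : comm x z) (hyz : comm y z).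
Hypotheses (hxw : comm x w) (hyw : comm y w) (hzw : comm z w).

Lemma cocycle_word a a' b b' c c' d d' :
  Ph omU (bra a 1 ∘ x) (bra b 1 ∘ y) (op2 mul (bra c 1 ∘ z) (bra d 1 ∘ w))
    ⋆ Ph omU (op2 mul (bra 1 a' ∘ x) (bra 1 b' ∘ y)) (bra 1 c' ∘ z) (bra 1 d' ∘ w)
  = Ph omU (bra a 1 ∘ x)
      (Ph omU (bra b 1 ∘ y) (bra c 1 ∘ z) (bra d 1 ∘ w)
         ∙> op2 mul (bra 1 1 ∘ y) (bra 1 1 ∘ z))
      (bra 1 d' ∘ w)
    ⋆ Ph omU (bra 1 a' ∘ x) (bra 1 b' ∘ y) (bra 1 c' ∘ z).
Proof.
(* [P] collects the right-hand scalars of z and w, and [A] below the left-hand scalars of all four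
   variables; both are opaque variables, which keeps rewriting out of them. *)
have [P PE] : exists P, P = (z ▷ cst C d') ⋆ cst C c' by exists ((z ▷ cst C d') ⋆ cst C c').
have cyP : comm y P by rewrite PE; cm.
have cxP : comm x P by rewrite PE; cm.
have [A AE] : exists A, A = cst C a ⋆ (x ▷ cst C b) ⋆ (x ▷ y ▷ (cst C c ⋆ (z ▷ cst C d))).
  by exists (cst C a ⋆ (x ▷ cst C b) ⋆ (x ▷ y ▷ (cst C c ⋆ (z ▷ cst C d)))).
transitivity (A ⋆ ((x ▷ y ▷ G z w) ⋆ om x y (z ⊙ w) ⋆ (x ▷ y ▷ GI z w)
    ⋆ (G x y ⋆ om (x ⊙ y) z w ⋆ GI x y)) ⋆ (x ▷ y ▷ P) ⋆ (x ▷ cst C b') ⋆ cst C a').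
  rewrite !tri_brr !mul_tri; try by cm.
  rewrite !Ph_tri; try by cm.
  rewrite !omU_pt; try by cm.
  rewrite !(act_cst1, conv1, convr1); try by cm.
  (* [GI x y] passes the scalar [P], so that Omega(xy,z,w) stands between [G x y] and [GI x y] as in
     [om_cocycle]. *)
  rewrite -PE !convA -(convA _ (x ⊙ y ▷ P)) -act_gamI //.
  rewrite (act_conv (x := x)) //; [|by cm].
  rewrite AE.
  rewrite (act_conv (x := y) (G z w)) //; [|by cm].
  rewrite (act_conv (x := x) (y ▷ G z w)) //; [|by cm].
  by rewrite !convA.
rewrite om_cocycle //.
rewrite !tri_brr !mul_tri; try by cm.
rewrite tri_bL !Ph_tri; try by cm.
rewrite !omU_pt; try by cm.
rewrite !(act_cst1, conv1, convr1); try by cm.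
have -> : (y ⊙ z ▷ cst C d') ⋆ GI y z = GI y z ⋆ (y ▷ z ▷ cst C d').
  by rewrite act_gamI //; cm.
rewrite (act_conv (x := x) (u := GI y z)) //; [|by cm].
rewrite (act_conv (x := x) (G y z)) //; [|by cm].
rewrite (act_conv (x := x) (om y z w)) //; [|by cm].
rewrite (act_conv (x := x) (u := cst C b)) //; [|by cm].
rewrite (act_conv (x := x) (u := y ▷ cst C c')) //; [|by cm].
(* The scalar d' comes out of the first Phi on the left of Omega(x,y,z); commutation with Omega
   takes it to the other right-hand scalars. *)
rewrite !convA -(convA _ (x ▷ y ▷ z ▷ cst C d') (om x y z)) -om_comm //; [|by cm..].
rewrite PE AE (act_conv (x := y) (u := z ▷ cst C d')) //; [|by cm].
rewrite (act_conv (x := x) (u := y ▷ z ▷ cst C d')) //; [|by cm].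
by rewrite !convA.
Qed.

End FourPoints.
End Words.

Lemma ev2 (U V W : lmodType k) (f : {linear U ⨂ V -> W}) (P : {linear H -> U}) (Q : {linear H -> V}) h g :
  op2 f (P ∘ p1) (Q ∘ p2) (h ⊗ g) = f (P h ⊗ Q g).
Proof. by rewrite op2_def lcompE pair_prl_prr. Qed.

Lemma pair3 (U V W : lmodType k) (P : {linear H -> U}) (Q : {linear H -> V}) (R : {linear H -> W}) h g f :
  cpair (cpair (P ∘ q1) (Q ∘ q2)) (R ∘ q3) (h ⊗ g ⊗ f) = P h ⊗ Q g ⊗ R f.
Proof.
rewrite (lcompA P) (lcompA Q) -(pair_pull (P ∘ p1) (Q ∘ p2) (cpt_prl HH H)) pair_prl_prr.
by rewrite pair_prl_prr.
Qed.

Lemma ev_Ph om0 (P Q R : {linear H -> L}) h g f :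
  Ph om0 (P ∘ q1) (Q ∘ q2) (R ∘ q3) (h ⊗ g ⊗ f) = Phi om0 (P h ⊗ Q g ⊗ R f).
Proof. by rewrite /Ph op2_def lcompE pair3. Qed.

(** * The right action and balancing over the enveloping algebra *)

Lemma rac_ex : exists g : {linear L ⨂ Be B -> L}, forall X b c,
  g (X ⊗ env b c) = mul (X ⊗ (b ⊗ oneH ⊗ c)).
Proof.
have [g gE] : exists g : {linear B ⨂ B -> L}, forall b c, g (b ⊗ c) = b ⊗ oneH ⊗ c.
  by apply: (tens_lift (F := fun b c => b ⊗ oneH ⊗ c)); lin.
have [f fE] : exists f : {linear L ⨂ Be B -> L}, forall X m, f (X ⊗ m) = mul (X ⊗ g m).
  by apply: (tens_lift (V := Be B) (F := fun X (m : B ⨂ B) => mul (X ⊗ g m))); lin.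
by exists f => X b c; rewrite fE gE.
Qed.
(** Defined through the product because the actions have to come from [s] and [t]. As the product is
    not associative, it remains to prove that this is an action commuting with the left one. *)
Definition rac := projT1 (cid rac_ex).
Lemma racE X b c : rac (X ⊗ env b c) = mul (X ⊗ (b ⊗ oneH ⊗ c)).
Proof. by rewrite /rac; case: cid. Qed.

Definition racm b c : {linear L -> L} := mklin (f := fun X => rac (X ⊗ env b c)) ltac:(lin).
Lemma racmE b c X : racm b c X = rac (X ⊗ env b c). Proof. by []. Qed.
Definition lacm u v : {linear L -> L} := mklin (f := fun X => lac (env u v ⊗ X)) ltac:(lin).
Lemma lacmE u v X : lacm u v X = lac (env u v ⊗ X). Proof. by []. Qed.

Lemma rac_lac u v b c X : rac (lac (env u v ⊗ X) ⊗ env b c) = lac (env u v ⊗ rac (X ⊗ env b c)).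
Proof. by rewrite !racE Lmul_lact. Qed.

Section Points.
Variable C : coalg k.

Lemma lacm_brr u v a a' (x : {linear C -> H}) : lacm u v ∘ (bra a a' ∘ x) = bra (u * a) (a' * v) ∘ x.
Proof.
by apply: linP_eq => c; rewrite !lcompE brrE brrE lacmE lactE.
Qed.

Lemma racm_brr b c a a' (x : {linear C -> H}) : cpt x ->
  racm b c ∘ (bra a a' ∘ x) = tri (cst C a ⋆ (x ▷ cst C b)) x ((x ▷ cst C c) ⋆ cst C a').
Proof.
move=> hx; have h1 := cpt_one C.
transitivity (op2 mul (bra a a' ∘ x) (bra b c ∘ cst C oneH)).
  rewrite comp_cst; symmetry; apply: op2_cstr => X.
  by rewrite racmE racE brrE.
rewrite !tri_brr mul_tri; [|by cm..].
by rewrite gam_one2 // gamI_one2 // mul_one convr1 conv1.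
Qed.
End Points.

Lemma mul_rac X b c Y : mul (rac (X ⊗ env b c) ⊗ Y) = mul (X ⊗ lac (env b c ⊗ Y)).
Proof.
move: X; apply: L_eq => [||a h a']; [lin..|].
move: Y; apply: L_eq => [||u g v]; [lin..|].
rewrite -[a ⊗ h ⊗ a']brrE -[u ⊗ g ⊗ v]brrE -racmE -lacmE.
transitivity (op2 mul (racm b c ∘ bra a a' ∘ p1) (bra u v ∘ p2) (h ⊗ g)).
  by rewrite ev2 lcompE.
transitivity (op2 mul (bra a a' ∘ p1) (lacm b c ∘ bra u v ∘ p2) (h ⊗ g)); last first.
  by rewrite ev2 lcompE.
have h1 := cpt_p1; have h2 := cpt_p2; have h12 := @comm_p12.
rewrite -(lcompA (racm b c)) racm_brr // -(lcompA (lacm b c)) lacm_brr !tri_brr.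
rewrite !mul_tri; [|by cm..].
by rewrite -!conv_cst !act_conv ?convA //; cm.
Qed.

Lemma ev_mul3l (P Q R : {linear H -> L}) h g f :
  op2 mul (op2 mul (P ∘ q1) (Q ∘ q2)) (R ∘ q3) (h ⊗ g ⊗ f) = mul (mul (P h ⊗ Q g) ⊗ R f).
Proof. by rewrite !op2_def (pair_compl mul) (lcompE mul) (lcompE (tmap mul idfun)) pair3 tmapE. Qed.

Lemma ev_mul3r (P Q R : {linear H -> L}) h g f :
  op2 mul (P ∘ q1) (op2 mul (Q ∘ q2) (R ∘ q3)) (h ⊗ g ⊗ f) = mul (P h ⊗ mul (Q g ⊗ R f)).
Proof.
have [|m mE] := tens_lift3 (F := fun X Y Z => mul (X ⊗ mul (Y ⊗ Z))); first by lin.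
rewrite (op2_flat (g := m)); last by move=> *; rewrite mE.
by rewrite lcompE pair3 mE.
Qed.

Let h1 := cpt_p1.
Let h2 := cpt_p2.
Let h12 := comm_p12.
Let hq1 := cpt_q1.
Let hq2 := cpt_q2.
Let hq3 := cpt_q3.
Let hq12 := comm_q12.
Let hq13 := comm_q13.
Let hq23 := comm_q23.

(** Here the twisting condition makes products with scalars associate: [gamma] converts (xy) |> b
    into x |> y |> b on the left, and [gammaI] does the same for c on the right. *)
Lemma rac_mul X Y b c : rac (mul (X ⊗ Y) ⊗ env b c) = mul (X ⊗ rac (Y ⊗ env b c)).
Proof.
move: X; apply: L_eq => [||a h a']; [lin..|].
move: Y; apply: L_eq => [||u g v]; [lin..|].
rewrite -[a ⊗ h ⊗ a']brrE -[u ⊗ g ⊗ v]brrE -!racmE.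
transitivity (op2 (racm b c ∘ mul) (bra a a' ∘ p1) (bra u v ∘ p2) (h ⊗ g)).
  by rewrite ev2 lcompE.
transitivity (op2 mul (bra a a' ∘ p1) (racm b c ∘ bra u v ∘ p2) (h ⊗ g)); last first.
  by rewrite ev2 lcompE.
rewrite -(lcompA (racm b c)) racm_brr // -op2_comp.
have h1' := cpt_one HH.
have -> : racm b c ∘ op2 mul (bra a a' ∘ p1) (bra u v ∘ p2)
  = op2 mul (op2 mul (bra a a' ∘ p1) (bra u v ∘ p2)) (bra b c ∘ cst HH oneH).
  by rewrite comp_cst; symmetry; apply: op2_cstr => X; rewrite racmE racE brrE.
rewrite !tri_brr mul_tri; [|by cm..].
rewrite mul_tri; [|by cm..].
rewrite mul_tri; [|by cm..].
rewrite gam_one2; [|by cm]. rewrite gamI_one2; [|by cm]. rewrite mul_one convr1 conv1.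
rewrite (act_conv (u := cst HH u)) //; last by cm.
rewrite (act_conv (u := p2 ▷ cst HH c)) //; last by cm.
rewrite !convA -(convA _ (op2 gamma p1 p2)) -act_gam //; [|by cm..].
by rewrite !convA act_gamI ?convA //; cm.
Qed.

(** A scalar between the first two arguments is acted on by the first variable; multiplicativity of
    the action merges it with the scalars of [Y], whatever the middle letter [om0] is. *)
Lemma Phi_rac1 om0 X b c Y Z : Phi om0 (rac (X ⊗ env b c) ⊗ Y ⊗ Z) = Phi om0 (X ⊗ lac (env b c ⊗ Y) ⊗ Z).
Proof.
move: X; apply: L_eq => [||a h a']; [lin..|].
move: Y; apply: L_eq => [||u g v]; [lin..|].
move: Z; apply: L_eq => [||r f w]; [lin..|].
rewrite -[a ⊗ h ⊗ a']brrE -[u ⊗ g ⊗ v]brrE -[r ⊗ f ⊗ w]brrE -racmE -lacmE.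
transitivity (Ph om0 (racm b c ∘ bra a a' ∘ q1) (bra u v ∘ q2) (bra r w ∘ q3) (h ⊗ g ⊗ f)).
  by rewrite ev_Ph lcompE.
transitivity (Ph om0 (bra a a' ∘ q1) (lacm b c ∘ bra u v ∘ q2) (bra r w ∘ q3) (h ⊗ g ⊗ f)); last first.
  by rewrite ev_Ph lcompE.
rewrite -(lcompA (racm b c)) racm_brr // -(lcompA (lacm b c)) lacm_brr 4!tri_brr.
rewrite !Ph_tri; try by cm.
rewrite -(conv_cst _ b u) -(conv_cst _ v c) -(convA (cst HHH b)) (convA _ (cst HHH v) (cst HHH c)).
by rewrite !(act_conv (x := q1)) ?convA //; cm.
Qed.

Lemma Phi_rac2 om0 X b c Y Z : Phi om0 (X ⊗ rac (Y ⊗ env b c) ⊗ Z) = Phi om0 (X ⊗ Y ⊗ lac (env b c ⊗ Z)).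
Proof.
move: X; apply: L_eq => [||a h a']; [lin..|].
move: Y; apply: L_eq => [||u g v]; [lin..|].
move: Z; apply: L_eq => [||r f w]; [lin..|].
rewrite -[a ⊗ h ⊗ a']brrE -[u ⊗ g ⊗ v]brrE -[r ⊗ f ⊗ w]brrE -racmE -lacmE.
transitivity (Ph om0 (bra a a' ∘ q1) (racm b c ∘ bra u v ∘ q2) (bra r w ∘ q3) (h ⊗ g ⊗ f)).
  by rewrite ev_Ph lcompE.
transitivity (Ph om0 (bra a a' ∘ q1) (bra u v ∘ q2) (lacm b c ∘ bra r w ∘ q3) (h ⊗ g ⊗ f)); last first.
  by rewrite ev_Ph lcompE.
rewrite -(lcompA (racm b c)) racm_brr // -(lcompA (lacm b c)) lacm_brr 4!tri_brr.
rewrite !Ph_tri; try by cm.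
rewrite -(conv_cst _ b r) -(conv_cst _ w c).
by rewrite !(act_conv (x := q2)) ?convA //; cm.
Qed.

(** Both sides carry the letter x |> y |> z |> b, one to the left and one to the right of Omega;
    they agree because Omega commutes with it. *)
Lemma Phi_right X Y Z b :
  Phi omU (X ⊗ Y ⊗ rac (Z ⊗ env b 1)) = Phi omU (X ⊗ Y ⊗ rac (Z ⊗ env 1 b)).
Proof.
move: X; apply: L_eq => [||a h a']; [lin..|].
move: Y; apply: L_eq => [||u g v]; [lin..|].
move: Z; apply: L_eq => [||r f w]; [lin..|].
rewrite -[a ⊗ h ⊗ a']brrE -[u ⊗ g ⊗ v]brrE -[r ⊗ f ⊗ w]brrE -!racmE.
transitivity (Ph omU (bra a a' ∘ q1) (bra u v ∘ q2) (racm b 1 ∘ bra r w ∘ q3) (h ⊗ g ⊗ f)).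
  by rewrite ev_Ph lcompE.
transitivity (Ph omU (bra a a' ∘ q1) (bra u v ∘ q2) (racm 1 b ∘ bra r w ∘ q3) (h ⊗ g ⊗ f)); last first.
  by rewrite ev_Ph lcompE.
rewrite -!(lcompA (racm _ _)) !racm_brr // !tri_brr.
rewrite !Ph_tri; try by cm.
rewrite !omU_pt; try by cm.
rewrite !(act_cst1, conv1, convr1) //.
rewrite (act_conv (x := q2) (q3 ▷ cst HHH b)) //; last by cm.
rewrite (act_conv (x := q2) (u := q3 ▷ cst HHH b)) //; last by cm.
rewrite !convA (act_conv (x := q1) (q2 ▷ q3 ▷ cst HHH b)); [|by cm..].
rewrite -(convA (q2 ▷ q3 ▷ cst HHH b)) (act_conv (x := q1) (u := q2 ▷ q3 ▷ cst HHH b)); [|by cm..].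
by rewrite !convA -!(convA _ _ (om _ _ _)) -om_comm ?convA //; cm.
Qed.

Opaque rac.

(** * Unit and counit axioms, normalisation of the cocycle *)

Definition Lone : L := 1 ⊗ oneH ⊗ 1.

Lemma Lone_lact b c : b ⊗ oneH ⊗ c = lac (env b c ⊗ Lone).
Proof. by rewrite lactE mulr1 mul1r. Qed.

Section EpsTri.
Variable C : coalg k.

Lemma epsL_tri u (x : {linear C -> H}) v : cpt x -> epsL ∘ tri u x v = u ⋆ v.
Proof. by move=> hx; rewrite /tri epsL_bR epsL_bL epsL_br // convr1. Qed.
End EpsTri.

Lemma mul_one1 X : mul (Lone ⊗ X) = X.
Proof.
move: X; apply: L_eq => [||a h a']; [lin..|].
have hi : cpt (idfun : {linear H -> H}) by exact: cpt_id.
have h0 := cpt_one H.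
have g_lin : lin (fun X : L => mul (Lone ⊗ X)) by lin.
have e : op2 mul (cst H Lone) (bra a a' ∘ idfun) = mklin g_lin ∘ (bra a a' ∘ idfun).
  by apply: op2_cstl.
have := congr1 (fun f : {linear H -> L} => f h) e.
rewrite [X in _ = X -> _](lcompE (mklin g_lin)) [X in _ = _ X -> _](lcompE (bra a a')) brrE => e1.
apply: etrans (esym e1) _; rewrite {e e1}.
have -> : cst H Lone = bra 1 1 ∘ cst H oneH by rewrite comp_cst brrE.
rewrite !tri_brr mul_tri; [|by cm..].
rewrite gam_one1 // gamI_one1 // one_mul !one_act !(conv1, convr1).
by rewrite -tri_brr (lcompE (bra a a')) brrE.
Qed.

Lemma mul_s b c X : mul ((b ⊗ oneH ⊗ c) ⊗ X) = lac (env b c ⊗ X).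
Proof. by rewrite Lone_lact Lmul_lact mul_one1. Qed.

Lemma rac1 X : rac (X ⊗ env 1 1) = X.
Proof.
move: X; apply: L_eq => [||a h a']; [lin..|].
have hi : cpt (idfun : {linear H -> H}) by exact: cpt_id.
have := congr1 (fun f : {linear H -> L} => f h) (@racm_brr _ 1 1 a a' idfun hi).
rewrite !act_cst1 // convr1 conv1 -tri_brr !lcompE brrE racmE => e.
exact: e.
Qed.

Lemma mul_oner X : mul (X ⊗ Lone) = X.
Proof. by rewrite -racE rac1. Qed.

Lemma racM X b c b' c' : rac (rac (X ⊗ env b c) ⊗ env b' c') = rac (X ⊗ env (b * b') (c' * c)).
Proof.
rewrite [in LHS](racE X) rac_mul [RHS]racE Lone_lact rac_lac racE mul_one1.
by rewrite lactE.
Qed.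

Lemma epsL_mul_dep X Y Y' : epsL Y = epsL Y' -> epsL (mul (X ⊗ Y)) = epsL (mul (X ⊗ Y')).
Proof.
move=> e; move: X; apply: L_eq => [||a h a']; [lin..|].
by rewrite brr_br !Lmul_lact !epsL_lact !epsL_mul e.
Qed.

Lemma epsL_one b c : epsL (b ⊗ oneH ⊗ c) = b * c.
Proof. by rewrite epsLE (cq_eps_one Hcq) scale1r. Qed.

Lemma epsL_racl X Y : epsL (rac (X ⊗ env (epsL Y) 1)) = epsL (mul (X ⊗ Y)).
Proof. by rewrite racE; apply: epsL_mul_dep; rewrite epsL_one mulr1. Qed.

Lemma epsL_racr X Y : epsL (rac (X ⊗ env 1 (epsL Y))) = epsL (mul (X ⊗ Y)).
Proof. by rewrite racE; apply: epsL_mul_dep; rewrite epsL_one mul1r. Qed.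

(** Under the counit [Z] may be replaced by the scalar [epsL Z], and products with a scalar on the
    right associate by [rac_mul]. *)
Lemma epsL_assoc X Y Z : epsL (mul (mul (X ⊗ Y) ⊗ Z)) = epsL (mul (X ⊗ mul (Y ⊗ Z))).
Proof.
rewrite -(epsL_racl (mul (X ⊗ Y)) Z) rac_mul; apply: epsL_mul_dep; exact: epsL_racl.
Qed.

(** The unit of convolution is [Phi] with the trivial middle letter: in the counit of a triple
    product all [gamma] letters cancel and only the scalars remain. *)
Lemma Phi_unit X Y Z : Phi (cst HHH 1) (X ⊗ Y ⊗ Z) = epsL (mul (mul (X ⊗ Y) ⊗ Z)).
Proof.
rewrite epsL_assoc.
move: X; apply: L_eq => [||a h a']; [lin..|].
move: Y; apply: L_eq => [||u g v]; [lin..|].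
move: Z; apply: L_eq => [||r f w]; [lin..|].
rewrite -[a ⊗ h ⊗ a']brrE -[u ⊗ g ⊗ v]brrE -[r ⊗ f ⊗ w]brrE.
rewrite -ev_Ph -ev_mul3r -(lcompE epsL) !tri_brr !mul_tri; try by cm.
rewrite epsL_tri; last by cm.
rewrite Ph_tri; try by cm.
have c3 : cpt (D := HHH) (cpair (cpair q1 q2) q3) by cm.
rewrite cptC1 // convr1 !convA.
rewrite (convK (u := op2 gamma q1 _)); last by apply: gamK; cm.
rewrite -(convA _ _ (op2 act q1 (op2 (mulB B) (op2 (mulB B) _ _) _))) -act_conv; [|by cm..].
rewrite -(convA (cst HHH a) (op2 act q1 _) (op2 act q1 _)) -act_conv; [|by cm..].
by rewrite !convA (convK (u := op2 gamma q2 q3)) //; apply: gamK.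
Qed.

Section Normal.
Variables (om0 : {linear HHH -> B}) (X : L) (P Q : {linear H -> L}) (h g : H).

Lemma ev_Ph_cst1 : Ph om0 (cst HH X) (P ∘ p1) (Q ∘ p2) (h ⊗ g) = Phi om0 (X ⊗ P h ⊗ Q g).
Proof.
rewrite /Ph op2_def (lcompE (Phi om0)) pair_cstl.
by rewrite (lcompA _ P p1) pair_prl_prr.
Qed.

Lemma ev_Ph_cst2 : Ph om0 (P ∘ p1) (cst HH X) (Q ∘ p2) (h ⊗ g) = Phi om0 (P h ⊗ X ⊗ Q g).
Proof.
rewrite /Ph op2_def (lcompE (Phi om0)) pair_cstr.
by rewrite (lcompA _ P p1) pair_prl_prr.
Qed.

Lemma ev_Ph_cst3 : Ph om0 (P ∘ p1) (Q ∘ p2) (cst HH X) (h ⊗ g) = Phi om0 (P h ⊗ Q g ⊗ X).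
Proof. by rewrite /Ph op2_def (lcompE (Phi om0)) pair_cstr lcompE pair_prl_prr. Qed.

End Normal.

Section NormalB.

Lemma ev_eps_mul (P Q : {linear H -> L}) h g :
  (epsL ∘ op2 mul (P ∘ p1) (Q ∘ p2)) (h ⊗ g) = epsL (mul (P h ⊗ Q g)).
Proof. by rewrite (lcompE epsL) ev2. Qed.

Let cst_Lone : cst HH Lone = bra 1 1 ∘ cst HH oneH.
Proof. by rewrite comp_cst brrE. Qed.

Let h0 : cpt (cst HH oneH) := cpt_one HH.

Let eps_mul_tri a a' b b' :
  epsL ∘ op2 mul (bra a a' ∘ p1) (bra b b' ∘ p2)
  = cst HH a ⋆ (p1 ▷ cst HH b) ⋆ (p1 ▷ cst HH b') ⋆ cst HH a'.
Proof.
rewrite !tri_brr mul_tri; try by cm.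
rewrite epsL_tri; last by cm.
by rewrite !convA (convK (u := op2 gamma p1 p2)) //; apply: gamK.
Qed.

Lemma Phi_one1 X Y : Phi omU (Lone ⊗ X ⊗ Y) = epsL (mul (X ⊗ Y)).
Proof.
move: X; apply: L_eq => [||a h a']; [lin..|].
move: Y; apply: L_eq => [||b g b']; [lin..|].
rewrite -[a ⊗ h ⊗ a']brrE -[b ⊗ g ⊗ b']brrE -ev_eps_mul -ev_Ph_cst1 eps_mul_tri.
rewrite cst_Lone Ph_brr_word //; try by cm.
rewrite omU_pt //; try by cm.
by rewrite om_one1 // !one_act !(conv1, convr1) ?convA.
Qed.

Lemma Phi_one2 X Y : Phi omU (X ⊗ Lone ⊗ Y) = epsL (mul (X ⊗ Y)).
Proof.
move: X; apply: L_eq => [||a h a']; [lin..|].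
move: Y; apply: L_eq => [||b g b']; [lin..|].
rewrite -[a ⊗ h ⊗ a']brrE -[b ⊗ g ⊗ b']brrE -ev_eps_mul -ev_Ph_cst2 eps_mul_tri.
rewrite cst_Lone Ph_brr_word //; try by cm.
rewrite omU_pt //; try by cm.
by rewrite om_one2 // !one_act !(conv1, convr1) ?convA.
Qed.

Lemma Phi_one3 X Y : Phi omU (X ⊗ Y ⊗ Lone) = epsL (mul (X ⊗ Y)).
Proof.
move: X; apply: L_eq => [||a h a']; [lin..|].
move: Y; apply: L_eq => [||b g b']; [lin..|].
rewrite -[a ⊗ h ⊗ a']brrE -[b ⊗ g ⊗ b']brrE -ev_eps_mul -ev_Ph_cst3 eps_mul_tri.
rewrite cst_Lone Ph_brr_word //; try by cm.
rewrite omU_pt //; try by cm.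
by rewrite om_one3 // !act_cst1 // !(conv1, convr1) ?convA.
Qed.

Lemma Phi_conv om0 om1 a a' b b' c c' h g f :
  S2 h (fun h1 h2 => S2 g (fun g1 g2 => S2 f (fun f1 f2 =>
    Phi om0 (a ⊗ h1 ⊗ 1 ⊗ (b ⊗ g1 ⊗ 1) ⊗ (c ⊗ f1 ⊗ 1))
    * Phi om1 (1 ⊗ h2 ⊗ a' ⊗ (1 ⊗ g2 ⊗ b') ⊗ (1 ⊗ f2 ⊗ c')))))
  = Phi (op2 (C := HHH) (mulB B) om0 om1) (a ⊗ h ⊗ a' ⊗ (b ⊗ g ⊗ b') ⊗ (c ⊗ f ⊗ c')).
Proof.
rewrite -[a ⊗ h ⊗ a']brrE -[b ⊗ g ⊗ b']brrE -[c ⊗ f ⊗ c']brrE.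
rewrite -ev_Ph -conv_word // op2_tens3.
apply: S2_ext => h1' h2'; apply: S2_ext => g1 g2; apply: S2_ext => f1 f2.
by rewrite mulBE !ev_Ph !brrE.
Qed.

Lemma Phi_assoc a a' b b' c c' h g f :
  S2 h (fun h1 h2 => S2 g (fun g1 g2 => S2 f (fun f1 f2 =>
    lac (env (Phi omU (a ⊗ h1 ⊗ 1 ⊗ (b ⊗ g1 ⊗ 1) ⊗ (c ⊗ f1 ⊗ 1))) 1
    ⊗ mul (mul ((1 ⊗ h2 ⊗ a') ⊗ (1 ⊗ g2 ⊗ b')) ⊗ (1 ⊗ f2 ⊗ c'))))))
  = S2 h (fun h1 h2 => S2 g (fun g1 g2 => S2 f (fun f1 f2 =>
    lac (env 1 (Phi omU (1 ⊗ h2 ⊗ a' ⊗ (1 ⊗ g2 ⊗ b') ⊗ (1 ⊗ f2 ⊗ c')))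
    ⊗ mul ((a ⊗ h1 ⊗ 1) ⊗ mul ((b ⊗ g1 ⊗ 1) ⊗ (c ⊗ f1 ⊗ 1))))))).
Proof.
have := f_equal (fun F : {linear HHH -> L} => F (h ⊗ g ⊗ f))
  (assoc_word hq1 hq2 hq3 hq12 hq13 hq23 a a' b b' c c').
rewrite 2!op2_tens3 => e; apply: etrans (etrans e _).
  apply: S2_ext => h1' h2'; apply: S2_ext => g1 g2; apply: S2_ext => f1 f2.
  by rewrite bLE ev_Ph ev_mul3l !brrE.
apply: S2_ext => h1' h2'; apply: S2_ext => g1 g2; apply: S2_ext => f1 f2.
by rewrite bRE ev_Ph ev_mul3r !brrE.
Qed.
End NormalB.

(** * The cocycle identity on pure tensors *)

Section FourFold.

Local Notation pl := (prl HHH H).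
Local Notation r1 := (q1 ∘ pl).
Local Notation r2 := (q2 ∘ pl).
Local Notation r3 := (q3 ∘ pl).
Local Notation r4 := (prr HHH H).

Let hpl : cpt pl := cpt_prl HHH H.
Let hr1 : cpt r1 := cpt_comp hpl hq1.
Let hr2 : cpt r2 := cpt_comp hpl hq2.
Let hr3 : cpt r3 := cpt_comp hpl hq3.
Let hr4 : cpt r4 := cpt_prr HHH H.

Lemma comm_r4 (U : lmodType k) (P : {linear HHH -> U}) : comm (P ∘ pl) r4.
Proof.
have -> : r4 = idfun ∘ r4 by apply: linP_eq.
exact: comm_prl_prr.
Qed.

Let hr12 : comm r1 r2 := comm_pull hpl hq12.
Let hr13 : comm r1 r3 := comm_pull hpl hq13.
Let hr23 : comm r2 r3 := comm_pull hpl hq23.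
Let hr14 : comm r1 r4 := comm_r4 _.
Let hr24 : comm r2 r4 := comm_r4 _.
Let hr34 : comm r3 r4 := comm_r4 _.

Section Four.
Variables (U1 U2 U3 U4 : lmodType k) (P : {linear H -> U1}) (Q : {linear H -> U2})
  (R : {linear H -> U3}) (S : {linear H -> U4}).
Variables (h g f l : H).

Lemma pair4 :
  cpair (cpair (cpair (P ∘ r1) (Q ∘ r2)) (R ∘ r3)) (S ∘ r4) (h ⊗ g ⊗ f ⊗ l) = P h ⊗ Q g ⊗ R f ⊗ S l.
Proof.
rewrite (lcompA P) (lcompA Q) (lcompA R) -(pair_pull (P ∘ q1) (Q ∘ q2) hpl).
by rewrite -(pair_pull _ (R ∘ q3) hpl) pair_prl_prr pair3.
Qed.

End Four.

Local Notation tl := (cpair (cpair r2 r3) r4).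

Lemma pair4_tail (U : lmodType k) (P : {linear H -> U}) (h g f l : H) :
  cpair (P ∘ r1) tl (h ⊗ g ⊗ f ⊗ l) = P h ⊗ (g ⊗ f ⊗ l).
Proof.
have [|m1 m1E] := tens_lift3 (F := fun (a : U) (b : H ⨂ H) (c : H) => a ⊗ (b ⊗ c)); first by lin.
have [|m2 m2E] := tens_lift3 (F := fun (a : U) (b : H) (c : H) => a ⊗ (b ⊗ c)); first by lin.
have idE (U' V' : lmodType k) (M : {linear U' -> V'}) : M = idfun ∘ M by apply: linP_eq.
rewrite -(op2_id _ r4) (pair_flat (g := m1)); last by move=> *; rewrite m1E.
rewrite -(op2_id r2 r3) (pair_flat (g := m2)); last by move=> *; rewrite m2E.
rewrite (pair_compl m2) (lcompE m1) lcompE.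
by rewrite (idE _ _ r2) (idE _ _ r3) (idE _ _ r4) pair4 tmapE m2E m1E.
Qed.

Lemma cpt_tl : cpt (D := HHH) tl.
Proof. by cm. Qed.

Lemma q1_tl : q1 ∘ tl = r2.
Proof. by rewrite -(lcompA (prl H H)) !prl_pair. Qed.
Lemma q2_tl : q2 ∘ tl = r3.
Proof. by rewrite -(lcompA (prr H H)) prl_pair // prr_pair. Qed.
Lemma q3_tl : q3 ∘ tl = r4.
Proof. by rewrite prr_pair //; apply: (cpt_pair (D := H)). Qed.

(** The middle argument on the right of the cocycle identity. It involves the last three variables
    only and is pulled back along [tl], so that its evaluation expands no coproduct of h. *)
Definition inner om0 (P Q R M N : {linear H -> L}) : {linear HHH -> L} :=
  op2 bL (Ph om0 (P ∘ q1) (Q ∘ q2) (R ∘ q3)) (op2 mul (M ∘ q1) (N ∘ q2)).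

Lemma inner_tl om0 (P Q R M N : {linear H -> L}) :
  op2 bL (Ph om0 (P ∘ r2) (Q ∘ r3) (R ∘ r4)) (op2 mul (M ∘ r2) (N ∘ r3))
  = inner om0 P Q R M N ∘ tl.
Proof.
rewrite /inner (op2_pull _ _ _ cpt_tl) /Ph !(op2_pull _ _ _ cpt_tl) (pair_pull _ _ cpt_tl).
by rewrite -(lcompA P q1) -(lcompA Q q2) -(lcompA R q3) -(lcompA M q1) -(lcompA N q2) q1_tl q2_tl q3_tl.
Qed.

Lemma innerE om0 (P Q R M N : {linear H -> L}) g f l :
  inner om0 P Q R M N (g ⊗ f ⊗ l)
  = S2 g (fun g1 g2 => S2 f (fun f1 f2 =>
      lac (env (Phi om0 (P g1 ⊗ Q f1 ⊗ R l)) 1 ⊗ mul (M g2 ⊗ N f2)))).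
Proof.
rewrite /inner (lcompA M) (lcompA N) -(op2_pull _ _ _ (cpt_prl HH H)) op2_tens3_prlr.
apply: S2_ext => g1 g2; apply: S2_ext => f1 f2.
by rewrite bLE ev_Ph ev2.
Qed.

Lemma ev4_l om0 (P Q R S : {linear H -> L}) h g f l :
  Ph om0 (P ∘ r1) (Q ∘ r2) (op2 mul (R ∘ r3) (S ∘ r4)) (h ⊗ g ⊗ f ⊗ l)
  = Phi om0 (P h ⊗ Q g ⊗ mul (R f ⊗ S l)).
Proof.
have [|m mE] := tens_lift3 (F := fun X Y Z => Phi om0 (X ⊗ mul (Y ⊗ Z))); first by lin.
rewrite /Ph (op2_flat (g := m)); last by move=> *; rewrite mE.
by rewrite lcompE pair4 mE.
Qed.

Lemma ev4_m om0 (P Q R S : {linear H -> L}) h g f l :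
  Ph om0 (op2 mul (P ∘ r1) (Q ∘ r2)) (R ∘ r3) (S ∘ r4) (h ⊗ g ⊗ f ⊗ l)
  = Phi om0 (mul (P h ⊗ Q g) ⊗ R f ⊗ S l).
Proof.
rewrite /Ph (op2_def mul) op2_def (pair_compl mul) (pair_compl (tmap mul idfun)).
by rewrite !lcompE pair4 !tmapE.
Qed.

(** Only l occurs in two of the arguments, so only its coproduct survives. *)
Lemma ev4_r om0 (P S : {linear H -> L}) (E : {linear HHH -> L}) h g f l :
  Ph om0 (P ∘ r1) (E ∘ tl) (S ∘ r4) (h ⊗ g ⊗ f ⊗ l)
  = S2 l (fun l1 l2 => Phi om0 (P h ⊗ E (g ⊗ f ⊗ l1) ⊗ S l2)).
Proof.
rewrite /Ph op2_tens_prrr; apply: S2_ext => l1 l2.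
have idE (U' V' : lmodType k) (M : {linear U' -> V'}) : M = idfun ∘ M by apply: linP_eq.
by rewrite (idE _ _ (P ∘ r1)) -tmap_pair (lcompE (tmap _ _)) pair4_tail tmapE.
Qed.

Lemma ev4_3 om0 (P Q R : {linear H -> L}) :
  Ph om0 (P ∘ r1) (Q ∘ r2) (R ∘ r3) = Ph om0 (P ∘ q1) (Q ∘ q2) (R ∘ q3) ∘ pl.
Proof. by rewrite /Ph (op2_pull _ _ _ hpl) (pair_pull _ _ hpl) !lcompA. Qed.

Lemma Phi_cocycle a a' b b' c c' d d' h g f l :
  S2 h (fun h1 h2 => S2 g (fun g1 g2 => S2 f (fun f1 f2 => S2 l (fun l1 l2 =>
    Phi omU (a ⊗ h1 ⊗ 1 ⊗ (b ⊗ g1 ⊗ 1) ⊗ mul ((c ⊗ f1 ⊗ 1) ⊗ (d ⊗ l1 ⊗ 1)))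
    * Phi omU (mul ((1 ⊗ h2 ⊗ a') ⊗ (1 ⊗ g2 ⊗ b')) ⊗ (1 ⊗ f2 ⊗ c') ⊗ (1 ⊗ l2 ⊗ d'))))))
  = S2 h (fun h1 h2 => S2 g (fun g1 g2 => S2 f (fun f1 f2 => S2 l (fun l1 l2 =>
    S2 g1 (fun g11 g12 => S2 f1 (fun f11 f12 =>
    Phi omU (a ⊗ h1 ⊗ 1 ⊗
      lac (env (Phi omU (b ⊗ g11 ⊗ 1 ⊗ (c ⊗ f11 ⊗ 1) ⊗ (d ⊗ l1 ⊗ 1))) 1
        ⊗ mul ((1 ⊗ g12 ⊗ 1) ⊗ (1 ⊗ f12 ⊗ 1)))
      ⊗ (1 ⊗ l2 ⊗ d'))
    * Phi omU (1 ⊗ h2 ⊗ a' ⊗ (1 ⊗ g2 ⊗ b') ⊗ (1 ⊗ f2 ⊗ c')))))))).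
Proof.
have := f_equal (fun F : {linear HHHH -> B} => F (h ⊗ g ⊗ f ⊗ l))
  (cocycle_word hr1 hr2 hr3 hr4 hr12 hr13 hr23 hr14 hr24 hr34 a a' b b' c c' d d').
rewrite [in X in _ = X -> _]inner_tl ev4_3 op2_tens4 op2_tens_prlr => e.
apply: etrans (etrans e _).
  apply: S2_ext => h1' h2'; apply: S2_ext => g1 g2; apply: S2_ext => f1 f2; apply: S2_ext => l1 l2.
  by rewrite mulBE ev4_l ev4_m !brrE.
rewrite S2_tens3; last by lin.
apply: S2_ext => h1' h2'; apply: S2_ext => g1 g2; apply: S2_ext => f1 f2.
rewrite mulBE ev4_r S2_mulr; apply: S2_ext => l1 l2.
rewrite innerE ev_Ph !brrE.
rewrite (S2_mor (f := fun X => Phi omU (a ⊗ h1' ⊗ 1 ⊗ X ⊗ (1 ⊗ l2 ⊗ d')))); last by lin.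
rewrite S2_mulr; apply: S2_ext => g11 g12.
rewrite (S2_mor (f := fun X => Phi omU (a ⊗ h1' ⊗ 1 ⊗ X ⊗ (1 ⊗ l2 ⊗ d')))); last by lin.
by rewrite S2_mulr; apply: S2_ext => f11 f12; rewrite !brrE.
Qed.
End FourFold.

(** * The coproduct and its representatives *)

Local Notation DL := (diamond lac lac).

Definition diaL : {linear L ⨂ L -> DL} := qpi (@diamond_rel k B L L lac lac).

Lemma dia_bal b X Y : diaL (lac (env 1 b ⊗ X) ⊗ Y) = diaL (X ⊗ lac (env b 1 ⊗ Y)).
Proof.
apply/eqP; rewrite -subr_eq0 -linearB; apply/eqP.
by apply: qpi_rel; constructor.
Qed.

(* F factors through the diamond product. *)
Definition bal (V : lmodType k) (F : L -> L -> V) : Prop :=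
  bilin F /\ forall b X Y, F (lac (env 1 b ⊗ X)) Y = F X (lac (env b 1 ⊗ Y)).

Lemma dia_lift (V : lmodType k) (F : L -> L -> V) : bal F ->
  exists g : {linear DL -> V}, forall X Y, g (diaL (X ⊗ Y)) = F X Y.
Proof.
case=> /tens_lift [f fE] hb.
have f0 z : diamond_rel lac lac z -> f z = 0.
  by case=> b X Y; rewrite linearB !fE hb subrr.
exists (mklin (f := qlift f) (qlift_linear f0)) => X Y.
exact: etrans (qliftE f0 _) (fE X Y).
Qed.

Lemma DeltaL_ex : exists g : {linear L -> DL}, forall a h a',
  g (a ⊗ h ⊗ a') = S2 h (fun h1 h2 => diaL ((a ⊗ h1 ⊗ 1) ⊗ (1 ⊗ h2 ⊗ a'))).
Proof.
by apply: (tens_lift3 (F := fun a h a' => S2 h (fun h1 h2 => diaL ((a ⊗ h1 ⊗ 1) ⊗ (1 ⊗ h2 ⊗ a'))))); lin.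
Qed.
Definition DeltaL := projT1 (cid DeltaL_ex).
Lemma DeltaLE a h a' :
  DeltaL (a ⊗ h ⊗ a') = S2 h (fun h1 h2 => diaL ((a ⊗ h1 ⊗ 1) ⊗ (1 ⊗ h2 ⊗ a'))).
Proof. by rewrite /DeltaL; case: cid. Qed.

Lemma DeltaL_lac b c X (V : lmodType k) (F : L -> L -> V) (g g' : {linear DL -> V}) :
  (forall X Y, g (diaL (X ⊗ Y)) = F X Y) ->
  (forall X Y, g' (diaL (X ⊗ Y)) = F (lac (env b 1 ⊗ X)) (lac (env 1 c ⊗ Y))) ->
  g (DeltaL (lac (env b c ⊗ X))) = g' (DeltaL X).
Proof.
move=> gE gE'; move: X; apply: L_eq => [||a h a']; [lin..|].
rewrite lactE !DeltaLE (S2_mor (f := g)); last lin.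
rewrite (S2_mor (f := g')); last lin.
by apply: S2_ext => h1' h2'; rewrite gE gE' !lactE !(mulr1, mul1r).
Qed.

Lemma rac_pure a h a' b c :
  rac (a ⊗ h ⊗ a' ⊗ env b c)
  = S2 h (fun h1 h => S2 h (fun h2 h3 => (a * act (h1 ⊗ b)) ⊗ h2 ⊗ (act (h3 ⊗ c) * a'))).
Proof.
rewrite -brrE -racmE -(lcompE (racm b c)).
have hi : cpt (idfun : {linear H -> H}) by exact: cpt_id.
have -> : bra a a' = bra a a' ∘ idfun by apply: linP_eq.
rewrite racm_brr // /tri op2E.
rewrite -(S2_assoc (F := fun h1 h2 h3 => (a * act (h1 ⊗ b)) ⊗ h2 ⊗ (act (h3 ⊗ c) * a'))); last lin.
apply: S2_ext => h1' h2'.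
have [f fE] : exists f : {linear B -> B}, forall x, f x = a * x.
  by have hh : lin (fun x => a * x) by [lin]; exists (mklin hh).
have [f' fE'] : exists f : {linear B -> B}, forall x, f x = x * a'.
  by have hh : lin (fun x => x * a') by [lin]; exists (mklin hh).
rewrite (op2_cstl (g := f)); last by move=> x; rewrite mulBE fE.
rewrite (op2_cstr (g := f')); last by move=> x; rewrite mulBE fE'.
rewrite !act_cst op2E (S2_mor (f := fun X => bR (X ⊗ _))); last lin.
apply: S2_ext => x y.
rewrite bRE bLE !lcompE fE fE' brrE !lactE !mulr1 !mul1r.
by [].
Qed.

(** * Sums over arbitrary representatives *)

Section Rep.
Variables (R : L -> seq (L * L)) (HR : represents DeltaL R).

Definition sig (V : lmodType k) (X : L) (F : L -> L -> V) : V := \sum_(p <- R X) F p.1 p.2.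

Section One.
Variables (V : lmodType k) (F : L -> L -> V).
Hypothesis hF : bal F.

Lemma sig_rep (g : {linear DL -> V}) X : (forall X Y, g (diaL (X ⊗ Y)) = F X Y) ->
  sig X F = g (DeltaL X).
Proof.
move=> gE; rewrite (HR X) linear_sum; apply: eq_bigr => p _; by rewrite -gE.
Qed.

Lemma sig_lin : lin (fun X => sig X F).
Proof.
have [g gE] := dia_lift hF => a x y.
by rewrite !(sig_rep _ gE) !linearP.
Qed.

(** A balanced [F] factors through the diamond product, so its sum over the representatives chosen
    by [R] depends on the coproduct alone. *)
Lemma sig_pure a h a' : sig (a ⊗ h ⊗ a') F = S2 h (fun h1 h2 => F (a ⊗ h1 ⊗ 1) (1 ⊗ h2 ⊗ a')).
Proof.
have [g gE] := dia_lift hF.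
rewrite (sig_rep _ gE) DeltaLE (S2_mor (f := g)); last lin.
by apply: S2_ext => *; rewrite gE.
Qed.
End One.

Section Transport.
Variables (V : lmodType k) (F : L -> L -> V).
Hypothesis hF : bal F.

Let F1 v : lin (F^~ v). Proof. by case: hF => -[]. Qed.
Let F2 u : lin (F u). Proof. by case: hF => -[]. Qed.

Lemma bal_lac b c : bal (fun X Y => F (lac (env b 1 ⊗ X)) (lac (env 1 c ⊗ Y))).
Proof.
split=> [|d X Y].
  split=> v; first by apply: (lin_comp (g := F^~ _)) => //; lin.
  by apply: (lin_comp (g := F _)) => //; lin.
rewrite !lactM !(mulr1, mul1r).
rewrite -[env b d](_ : env (1 * b) (1 * d) = _); last by rewrite !mul1r.
by rewrite -lactM hF.2 lactM !(mulr1, mul1r).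
Qed.

Lemma sig_lac b c X :
  sig (lac (env b c ⊗ X)) F
  = sig X (fun X1 X2 => F (lac (env b 1 ⊗ X1)) (lac (env 1 c ⊗ X2))).
Proof.
have [g gE] := dia_lift hF; have [g' gE'] := dia_lift (bal_lac b c).
by rewrite (sig_rep _ gE) (sig_rep _ gE'); apply: DeltaL_lac gE gE'.
Qed.

Lemma bal_racl b c : bal (fun X Y => F (rac (X ⊗ env b c)) Y).
Proof.
split=> [|d X Y]; last by rewrite rac_lac hF.2.
by split=> v; [apply: (lin_comp (g := F^~ _)) => //; lin|].
Qed.

Lemma bal_racr b c : bal (fun X Y => F X (rac (Y ⊗ env b c))).
Proof.
split=> [|d X Y]; last by rewrite rac_lac hF.2.
by split=> v; [|apply: (lin_comp (g := F _)) => //; lin].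
Qed.

(** Right multiplication by s(b) inserts the first Sweedler factor of h acting on b next to the left
    scalar, and the coproduct keeps the left scalar in its first leg. *)
Lemma sig_racl b X :
  sig (rac (X ⊗ env b 1)) F = sig X (fun X1 X2 => F (rac (X1 ⊗ env b 1)) X2).
Proof.
have hl := sig_lin hF; have hr := sig_lin (bal_racl b 1).
move: X; apply: L_eq => [|//|a h a'].
  by apply: (lin_comp (f := fun X => rac (X ⊗ env b 1)) hl); lin.
rewrite (sig_pure (bal_racl b 1)).
have e x y : rac (x ⊗ y ⊗ 1 ⊗ env b 1) = S2 y (fun y1 y2 => (x * act (y1 ⊗ b)) ⊗ y2 ⊗ 1).
  rewrite rac_pure; apply: S2_ext => y1 y2.
  rewrite -[RHS](S2_counitr (F := fun y => x * act (y1 ⊗ b) ⊗ y ⊗ 1)); last lin.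
  by apply: S2_ext => y3 y4; rewrite (act_one act_meas) mulr1 Tensor.pureZr.
have e' x y z : rac (x ⊗ y ⊗ z ⊗ env b 1) = S2 y (fun y1 y2 => (x * act (y1 ⊗ b)) ⊗ y2 ⊗ z).
  rewrite rac_pure; apply: S2_ext => y1 y2.
  rewrite -[RHS](S2_counitr (F := fun y => x * act (y1 ⊗ b) ⊗ y ⊗ z)); last lin.
  by apply: S2_ext => y3 y4; rewrite (act_one act_meas) -scalerAl mul1r Tensor.pureZr.
rewrite e' (S2_mor (f := fun X => sig X F)) //.
transitivity (S2 h (fun h1 h2 => S2 h2 (fun h21 h22 =>
   F (a * act (h1 ⊗ b) ⊗ h21 ⊗ 1) (1 ⊗ h22 ⊗ a')))).
  by apply: S2_ext => *; rewrite sig_pure.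
rewrite -(S2_assoc (F := fun h1 h2 h3 => F (a * act (h1 ⊗ b) ⊗ h2 ⊗ 1) (1 ⊗ h3 ⊗ a'))).
  apply: S2_ext => *; rewrite e (S2_mor (f := F^~ _)) //.
by split=> u v; [apply: (lin_comp (g := F^~ _))|apply: (lin_comp (g := F^~ _))|apply: (lin_comp (g := F _))] => //; lin.
Qed.

(** On pure tensors both sides insert the middle one of three Sweedler factors of h acting on b, at
    the right end of the first leg or at the left end of the second; balancing moves scalars between
    these two ends. *)
Lemma sig_tak b X :
  sig X (fun X1 X2 => F (rac (X1 ⊗ env 1 b)) X2) = sig X (fun X1 X2 => F X1 (rac (X2 ⊗ env b 1))).
Proof.
have hl := sig_lin (bal_racl 1 b); have hr := sig_lin (bal_racr b 1).
move: X; apply: L_eq => [//|//|a h a'].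
rewrite (sig_pure (bal_racl 1 b)) (sig_pure (bal_racr b 1)).
have e' x y z : rac (x ⊗ y ⊗ z ⊗ env b 1) = S2 y (fun y1 y2 => (x * act (y1 ⊗ b)) ⊗ y2 ⊗ z).
  rewrite rac_pure; apply: S2_ext => y1 y2.
  rewrite -[RHS](S2_counitr (F := fun y => x * act (y1 ⊗ b) ⊗ y ⊗ z)); last lin.
  by apply: S2_ext => y3 y4; rewrite (act_one act_meas) -scalerAl mul1r Tensor.pureZr.
have e x y z : rac (x ⊗ y ⊗ z ⊗ env 1 b) = S2 y (fun y1 y2 => x ⊗ y1 ⊗ (act (y2 ⊗ b) * z)).
  rewrite rac_pure.
  rewrite -[RHS](S2_counitl (F := fun y => S2 y (fun y1 y2 => x ⊗ y1 ⊗ (act (y2 ⊗ b) * z)))); last lin.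
  apply: S2_ext => y1 y2; rewrite (S2_mor (f := fun X => (ceps H y1 : k) *: X)); last lin.
  by apply: S2_ext => y3 y4; rewrite (act_one act_meas) -scalerAr mulr1 !Tensor.pureZl.
have tr x y c z : F (a ⊗ x ⊗ c) (1 ⊗ y ⊗ z) = F (a ⊗ x ⊗ 1) (c ⊗ y ⊗ z).
  by have := hF.2 c (a ⊗ x ⊗ 1) (1 ⊗ y ⊗ z); rewrite !lactE !(mulr1, mul1r).
transitivity (S2 h (fun h1 h2 => S2 h1 (fun h11 h12 =>
   F (a ⊗ h11 ⊗ 1) (act (h12 ⊗ b) ⊗ h2 ⊗ a')))).
  apply: S2_ext => *; rewrite e (S2_mor (f := F^~ _)) //; apply: S2_ext => *.
  by rewrite mulr1 tr.
rewrite (S2_assoc (F := fun h1 h2 h3 => F (a ⊗ h1 ⊗ 1) (act (h2 ⊗ b) ⊗ h3 ⊗ a'))).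
  by apply: S2_ext => *; rewrite e' (S2_mor (f := F _)) //; apply: S2_ext => *; rewrite mul1r.
by split=> u v; [apply: (lin_comp (g := F^~ _))|apply: (lin_comp (g := F _))|apply: (lin_comp (g := F _))] => //; lin.
Qed.
End Transport.

Lemma bal_next (V : lmodType k) (K : L -> L -> L -> L -> V) X :
  (forall Y1 Y2, bal (fun X1 X2 => K X1 X2 Y1 Y2)) -> (forall X1 X2, bilin (K X1 X2)) ->
  (forall b X1 X2 Y1 Y2, K X1 X2 (lac (env 1 b ⊗ Y1)) Y2 = K (rac (X1 ⊗ env 1 b)) X2 Y1 Y2) ->
  (forall b X1 X2 Y1 Y2, K X1 X2 Y1 (lac (env b 1 ⊗ Y2)) = K X1 (rac (X2 ⊗ env b 1)) Y1 Y2) ->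
  bal (fun Y1 Y2 => sig X (fun X1 X2 => K X1 X2 Y1 Y2)).
Proof.
move=> hX hY hl hr; split=> [|b Y1 Y2].
  by split=> Y; apply: lin_big => p; case: (hY p.1 p.2).
transitivity (sig X (fun X1 X2 => K (rac (X1 ⊗ env 1 b)) X2 Y1 Y2)).
  by apply: eq_bigr => p _; rewrite hl.
rewrite (sig_tak (F := fun X1 X2 => K X1 X2 Y1 Y2)) //.
by apply: eq_bigr => p _; rewrite hr.
Qed.

Lemma L_eq2 (V : lmodType k) (A D : L -> L -> V) : bilin A -> bilin D ->
  (forall a h a' b g b', A (a ⊗ h ⊗ a') (b ⊗ g ⊗ b') = D (a ⊗ h ⊗ a') (b ⊗ g ⊗ b')) ->
  forall X Y, A X Y = D X Y.
Proof.
case=> a1 a2 [d1 d2] e X Y.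
move: X; apply: L_eq => // a h a'; move: Y; exact: L_eq.
Qed.

Lemma L_eq3 (V : lmodType k) (A D : L -> L -> L -> V) : trilin A -> trilin D ->
  (forall a h a' b g b' c f c', A (a ⊗ h ⊗ a') (b ⊗ g ⊗ b') (c ⊗ f ⊗ c')
     = D (a ⊗ h ⊗ a') (b ⊗ g ⊗ b') (c ⊗ f ⊗ c')) ->
  forall X Y Z, A X Y Z = D X Y Z.
Proof.
case=> a1 a2 a3 [d1 d2 d3] e X Y Z.
move: X; apply: L_eq => // a h a'; move: Y Z; apply: L_eq2 => //.
Qed.

Definition quadlin (V : lmodType k) (A : L -> L -> L -> L -> V) :=
  (forall W, trilin (fun X Y Z => A X Y Z W)) /\ forall X Y Z, lin (A X Y Z).

Lemma L_eq4 (V : lmodType k) (A D : L -> L -> L -> L -> V) : quadlin A -> quadlin D ->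
  (forall a h a' b g b' c f c' d l d',
     A (a ⊗ h ⊗ a') (b ⊗ g ⊗ b') (c ⊗ f ⊗ c') (d ⊗ l ⊗ d')
     = D (a ⊗ h ⊗ a') (b ⊗ g ⊗ b') (c ⊗ f ⊗ c') (d ⊗ l ⊗ d')) ->
  forall X Y Z W, A X Y Z W = D X Y Z W.
Proof.
case=> a1 a2 [d1 d2] e X Y Z W.
move: W; apply: L_eq => // d l d'; move: X Y Z; apply: L_eq3 => //.
Qed.

(* The conditions XYl and XYr carry a scalar from the factors of Y to those of X,
   where it is absorbed by the Takeuchi property of the coproduct. *)
Record linked2 (V : lmodType k) (K : L -> L -> L -> L -> V) : Prop := {
  l2_hX : forall Y1 Y2, bal (fun X1 X2 => K X1 X2 Y1 Y2);
  l2_hY : forall X1 X2, bilin (K X1 X2);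
  l2_XYl : forall b X1 X2 Y1 Y2,
  K X1 X2 (lac (env 1 b ⊗ Y1)) Y2 = K (rac (X1 ⊗ env 1 b)) X2 Y1 Y2;
  l2_XYr : forall b X1 X2 Y1 Y2,
  K X1 X2 Y1 (lac (env b 1 ⊗ Y2)) = K X1 (rac (X2 ⊗ env b 1)) Y1 Y2 }.

Section Sig22.
Variables (V : lmodType k) (K : L -> L -> L -> L -> V).
Hypothesis hK : linked2 K.
Let hX := l2_hX hK.
Let hY := l2_hY hK.
Let XYl := l2_XYl hK.
Let XYr := l2_XYr hK.

Let bY X := bal_next X hX hY XYl XYr.

(** The sum over X is innermost, since the expression becomes balanced in the factors of Y only once
    it has been taken. *)
Lemma sig22_lin : bilin (fun X Y => sig Y (fun Y1 Y2 => sig X (fun X1 X2 => K X1 X2 Y1 Y2))).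
Proof.
split=> [Y|X]; last exact: (sig_lin (bY X)).
by apply: lin_big => q; apply: sig_lin.
Qed.

Lemma sig22_pure a h a' b g b' :
  sig (b ⊗ g ⊗ b') (fun Y1 Y2 => sig (a ⊗ h ⊗ a') (fun X1 X2 => K X1 X2 Y1 Y2))
  = S2 g (fun g1 g2 => S2 h (fun h1 h2 =>
      K (a ⊗ h1 ⊗ 1) (1 ⊗ h2 ⊗ a') (b ⊗ g1 ⊗ 1) (1 ⊗ g2 ⊗ b'))).
Proof.
rewrite (sig_pure (bY _)); apply: S2_ext => g1 g2.
exact: (sig_pure (hX _ _)).
Qed.
End Sig22.

Record linked3 (V : lmodType k) (K : L -> L -> L -> L -> L -> L -> V) : Prop := {
  l3_hX : forall Y1 Y2 Z1 Z2, bal (fun X1 X2 => K X1 X2 Y1 Y2 Z1 Z2);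
  l3_hY : forall X1 X2 Z1 Z2, bilin (fun Y1 Y2 => K X1 X2 Y1 Y2 Z1 Z2);
  l3_hZ : forall X1 X2 Y1 Y2, bilin (K X1 X2 Y1 Y2);
  l3_XYl : forall b X1 X2 Y1 Y2 Z1 Z2,
  K X1 X2 (lac (env 1 b ⊗ Y1)) Y2 Z1 Z2 = K (rac (X1 ⊗ env 1 b)) X2 Y1 Y2 Z1 Z2;
  l3_XYr : forall b X1 X2 Y1 Y2 Z1 Z2,
  K X1 X2 Y1 (lac (env b 1 ⊗ Y2)) Z1 Z2 = K X1 (rac (X2 ⊗ env b 1)) Y1 Y2 Z1 Z2;
  l3_YZl : forall b X1 X2 Y1 Y2 Z1 Z2,
  K X1 X2 Y1 Y2 (lac (env 1 b ⊗ Z1)) Z2 = K X1 X2 (rac (Y1 ⊗ env 1 b)) Y2 Z1 Z2;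
  l3_YZr : forall b X1 X2 Y1 Y2 Z1 Z2,
  K X1 X2 Y1 Y2 Z1 (lac (env b 1 ⊗ Z2)) = K X1 X2 Y1 (rac (Y2 ⊗ env b 1)) Z1 Z2 }.

Section Sig222.
Variables (V : lmodType k) (K : L -> L -> L -> L -> L -> L -> V).
Hypothesis hK : linked3 K.
Let hX := l3_hX hK.
Let hY := l3_hY hK.
Let hZ := l3_hZ hK.
Let XYl := l3_XYl hK.
Let XYr := l3_XYr hK.
Let YZl := l3_YZl hK.
Let YZr := l3_YZr hK.

Let bY X Z1 Z2 : bal (fun Y1 Y2 => sig X (fun X1 X2 => K X1 X2 Y1 Y2 Z1 Z2)).
Proof. by apply: (bal_next X (K := fun X1 X2 Y1 Y2 => K X1 X2 Y1 Y2 Z1 Z2)). Qed.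

Lemma bal_next2 X Y : bal (fun Z1 Z2 => sig Y (fun Y1 Y2 => sig X (fun X1 X2 => K X1 X2 Y1 Y2 Z1 Z2))).
Proof.
apply: (bal_next Y (K := fun Y1 Y2 Z1 Z2 => sig X (fun X1 X2 => K X1 X2 Y1 Y2 Z1 Z2))) => //.
- by move=> Y1 Y2; split=> v; apply: lin_big => p; case: (hZ p.1 p.2 Y1 Y2).
- by move=> *; apply: eq_bigr => p _.
- by move=> *; apply: eq_bigr => p _.
Qed.

Lemma sig222_lin : trilin (fun X Y Z => sig Z (fun Z1 Z2 => sig Y (fun Y1 Y2 =>
  sig X (fun X1 X2 => K X1 X2 Y1 Y2 Z1 Z2)))).
Proof.
split=> [Y Z|X Z|X Y]; last exact: (sig_lin (bal_next2 X Y)).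
  by apply: lin_big => q; apply: lin_big => p; apply: sig_lin.
by apply: lin_big => q; apply: (sig_lin (bY X _ _)).
Qed.

Lemma sig222_pure a h a' b g b' c f c' :
  sig (c ⊗ f ⊗ c') (fun Z1 Z2 => sig (b ⊗ g ⊗ b') (fun Y1 Y2 =>
    sig (a ⊗ h ⊗ a') (fun X1 X2 => K X1 X2 Y1 Y2 Z1 Z2)))
  = S2 f (fun f1 f2 => S2 g (fun g1 g2 => S2 h (fun h1 h2 =>
      K (a ⊗ h1 ⊗ 1) (1 ⊗ h2 ⊗ a') (b ⊗ g1 ⊗ 1) (1 ⊗ g2 ⊗ b') (c ⊗ f1 ⊗ 1) (1 ⊗ f2 ⊗ c')))).
Proof.
rewrite (sig_pure (bal_next2 _ _)); apply: S2_ext => f1 f2.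
rewrite (sig_pure (bY _ _ _)); apply: S2_ext => g1 g2.
exact: (sig_pure (hX _ _ _ _)).
Qed.
End Sig222.

Record linked4 (V : lmodType k) (K : L -> L -> L -> L -> L -> L -> L -> L -> V) : Prop := {
  l4_hX : forall Y1 Y2 Z1 Z2 W1 W2, bal (fun X1 X2 => K X1 X2 Y1 Y2 Z1 Z2 W1 W2);
  l4_hY : forall X1 X2 Z1 Z2 W1 W2, bilin (fun Y1 Y2 => K X1 X2 Y1 Y2 Z1 Z2 W1 W2);
  l4_hZ : forall X1 X2 Y1 Y2 W1 W2, bilin (fun Z1 Z2 => K X1 X2 Y1 Y2 Z1 Z2 W1 W2);
  l4_hW : forall X1 X2 Y1 Y2 Z1 Z2, bilin (K X1 X2 Y1 Y2 Z1 Z2);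
  l4_XYl : forall b X1 X2 Y1 Y2 Z1 Z2 W1 W2,
  K X1 X2 (lac (env 1 b ⊗ Y1)) Y2 Z1 Z2 W1 W2 = K (rac (X1 ⊗ env 1 b)) X2 Y1 Y2 Z1 Z2 W1 W2;
  l4_XYr : forall b X1 X2 Y1 Y2 Z1 Z2 W1 W2,
  K X1 X2 Y1 (lac (env b 1 ⊗ Y2)) Z1 Z2 W1 W2 = K X1 (rac (X2 ⊗ env b 1)) Y1 Y2 Z1 Z2 W1 W2;
  l4_YZl : forall b X1 X2 Y1 Y2 Z1 Z2 W1 W2,
  K X1 X2 Y1 Y2 (lac (env 1 b ⊗ Z1)) Z2 W1 W2 = K X1 X2 (rac (Y1 ⊗ env 1 b)) Y2 Z1 Z2 W1 W2;
  l4_YZr : forall b X1 X2 Y1 Y2 Z1 Z2 W1 W2,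
  K X1 X2 Y1 Y2 Z1 (lac (env b 1 ⊗ Z2)) W1 W2 = K X1 X2 Y1 (rac (Y2 ⊗ env b 1)) Z1 Z2 W1 W2;
  l4_ZWl : forall b X1 X2 Y1 Y2 Z1 Z2 W1 W2,
  K X1 X2 Y1 Y2 Z1 Z2 (lac (env 1 b ⊗ W1)) W2 = K X1 X2 Y1 Y2 (rac (Z1 ⊗ env 1 b)) Z2 W1 W2;
  l4_ZWr : forall b X1 X2 Y1 Y2 Z1 Z2 W1 W2,
  K X1 X2 Y1 Y2 Z1 Z2 W1 (lac (env b 1 ⊗ W2)) = K X1 X2 Y1 Y2 Z1 (rac (Z2 ⊗ env b 1)) W1 W2 }.

Section Sig2222.
Variables (V : lmodType k) (K : L -> L -> L -> L -> L -> L -> L -> L -> V).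
Hypothesis hK : linked4 K.
Let hX := l4_hX hK.
Let hY := l4_hY hK.
Let hZ := l4_hZ hK.
Let hW := l4_hW hK.
Let XYl := l4_XYl hK.
Let XYr := l4_XYr hK.
Let YZl := l4_YZl hK.
Let YZr := l4_YZr hK.
Let ZWl := l4_ZWl hK.
Let ZWr := l4_ZWr hK.

Let bY X Z1 Z2 W1 W2 : bal (fun Y1 Y2 => sig X (fun X1 X2 => K X1 X2 Y1 Y2 Z1 Z2 W1 W2)).
Proof. by apply: (bal_next X (K := fun X1 X2 Y1 Y2 => K X1 X2 Y1 Y2 Z1 Z2 W1 W2)). Qed.

Let bZ X Y W1 W2 : bal (fun Z1 Z2 => sig Y (fun Y1 Y2 => sig X (fun X1 X2 => K X1 X2 Y1 Y2 Z1 Z2 W1 W2))).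
Proof.
refine (@bal_next2 _ (fun X1 X2 Y1 Y2 Z1 Z2 => K X1 X2 Y1 Y2 Z1 Z2 W1 W2) _ X Y).
by split=> *; [exact: hX|exact: hY|exact: hZ|exact: XYl|exact: XYr|exact: YZl|exact: YZr].
Qed.

Let bW X Y Z : bal (fun W1 W2 => sig Z (fun Z1 Z2 => sig Y (fun Y1 Y2 => sig X (fun X1 X2 => K X1 X2 Y1 Y2 Z1 Z2 W1 W2)))).
Proof.
apply: (bal_next Z (K := fun Z1 Z2 W1 W2 => sig Y (fun Y1 Y2 => sig X (fun X1 X2 => K X1 X2 Y1 Y2 Z1 Z2 W1 W2)))) => //.
- by move=> Z1 Z2; split=> v; apply: lin_big => q; apply: lin_big => p; case: (hW p.1 p.2 q.1 q.2 Z1 Z2).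
- by move=> *; apply: eq_bigr => q _; apply: eq_bigr => p _.
- by move=> *; apply: eq_bigr => q _; apply: eq_bigr => p _.
Qed.

Lemma sig2222_lin : quadlin (fun X Y Z W => sig W (fun W1 W2 => sig Z (fun Z1 Z2 =>
  sig Y (fun Y1 Y2 => sig X (fun X1 X2 => K X1 X2 Y1 Y2 Z1 Z2 W1 W2))))).
Proof.
split=> [W|X Y Z]; last exact: (sig_lin (bW X Y Z)).
split=> [Y Z|X Z|X Y]; apply: lin_big => r; last exact: (sig_lin (bZ X Y _ _)).
  by apply: lin_big => q; apply: lin_big => p; apply: sig_lin.
by apply: lin_big => q; apply: (sig_lin (bY X _ _ _ _)).
Qed.

Lemma sig2222_pure a h a' b g b' c f c' d l d' :
  sig (d ⊗ l ⊗ d') (fun W1 W2 => sig (c ⊗ f ⊗ c') (fun Z1 Z2 => sig (b ⊗ g ⊗ b') (fun Y1 Y2 =>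
    sig (a ⊗ h ⊗ a') (fun X1 X2 => K X1 X2 Y1 Y2 Z1 Z2 W1 W2))))
  = S2 l (fun l1 l2 => S2 f (fun f1 f2 => S2 g (fun g1 g2 => S2 h (fun h1 h2 =>
      K (a ⊗ h1 ⊗ 1) (1 ⊗ h2 ⊗ a') (b ⊗ g1 ⊗ 1) (1 ⊗ g2 ⊗ b') (c ⊗ f1 ⊗ 1) (1 ⊗ f2 ⊗ c')
        (d ⊗ l1 ⊗ 1) (1 ⊗ l2 ⊗ d'))))).
Proof.
rewrite (sig_pure (bW _ _ _)); apply: S2_ext => l1 l2.
rewrite (sig_pure (bZ _ _ _ _)); apply: S2_ext => f1 f2.
rewrite (sig_pure (bY _ _ _ _ _)); apply: S2_ext => g1 g2.
exact: (sig_pure (hX _ _ _ _ _ _)).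
Qed.
End Sig2222.

Section Triple.
Variables (V : lmodType k).

Definition bal3 (K : L -> L -> L -> V) := [/\ trilin K,
  forall b X Y Z, K (lac (env 1 b ⊗ X)) Y Z = K X (lac (env b 1 ⊗ Y)) Z &
  forall b X Y Z, K X (lac (env 1 b ⊗ Y)) Z = K X Y (lac (env b 1 ⊗ Z))].

Definition sig3 X (K : L -> L -> L -> V) := sig X (fun X1 X' => sig X' (K X1)).

Lemma bal3_bal K X : bal3 K -> bal (K X).
Proof. by case=> -[k1 k2 k3] k12 k23; split. Qed.

Lemma bal3_sig K : bal3 K -> bal (fun X X' => sig X' (K X)).
Proof.
move=> hK; split=> [|b X X'].
  split=> [X'|X]; last exact: (sig_lin (bal3_bal X hK)).
  by apply: lin_big => p; case: hK => -[k1 k2 k3] _ _; apply: k1.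
rewrite (sig_lac (bal3_bal X hK)); apply: eq_bigr => p _.
by rewrite lact1; case: hK => _ -> _.
Qed.

Lemma sig3_lin K : bal3 K -> lin (fun X => sig3 X K).
Proof. by move=> hK; apply: (sig_lin (bal3_sig hK)). Qed.

Lemma sig3_pure K a h a' : bal3 K ->
  sig3 (a ⊗ h ⊗ a') K = S2 h (fun h1 h => S2 h (fun h2 h3 =>
    K (a ⊗ h1 ⊗ 1) (1 ⊗ h2 ⊗ 1) (1 ⊗ h3 ⊗ a'))).
Proof.
move=> hK; rewrite /sig3 (sig_pure (bal3_sig hK)); apply: S2_ext => h1' h2'.
exact: (sig_pure (bal3_bal _ hK)).
Qed.

(** The Takeuchi property of the outer coproduct moves b to the right of the second leg, and by
    [sig_racl] the inner coproduct hands it on to the first factor of that leg. *)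
Lemma sig3_tak12 K X b : bal3 K ->
  sig3 X (fun X1 X2 X3 => K (rac (X1 ⊗ env 1 b)) X2 X3)
  = sig3 X (fun X1 X2 X3 => K X1 (rac (X2 ⊗ env b 1)) X3).
Proof.
move=> hK; rewrite /sig3 (sig_tak (bal3_sig hK)).
by apply: eq_bigr => p _; rewrite (sig_racl (bal3_bal _ hK)).
Qed.

Lemma sig3_tak23 K X b : bal3 K ->
  sig3 X (fun X1 X2 X3 => K X1 (rac (X2 ⊗ env 1 b)) X3)
  = sig3 X (fun X1 X2 X3 => K X1 X2 (rac (X3 ⊗ env b 1))).
Proof.
by move=> hK; apply: eq_bigr => p _; rewrite (sig_tak (bal3_bal _ hK)).
Qed.

End Triple.

(** * Multiplicativity of the coproduct *)

Section Delta.
Variable C : coalg k.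

Lemma triE u x v (c : C) :
  tri u x v c = S2 c (fun c1 c => S2 c (fun c2 c3 => (u c1 : B) ⊗ (x c2 : H) ⊗ (v c3 : B))).
Proof.
rewrite /tri op2E -(S2_assoc (F := fun a b d => u a ⊗ x b ⊗ v d)); last lin.
apply: S2_ext => c1 c2; rewrite op2E (S2_mor (f := fun X => bR (X ⊗ _))); last lin.
apply: S2_ext => c3 c4.
by rewrite bRE bLE lcompE brrE !lactE !(mulr1, mul1r).
Qed.

Lemma tri1E u x (c : C) : tri u x 1%P c = S2 c (fun c1 c2 => (u c1 : B) ⊗ (x c2 : H) ⊗ 1).
Proof.
rewrite triE; apply: S2_ext => c1 c2.
rewrite -[RHS](S2_counitr (F := fun c => u c1 ⊗ x c ⊗ 1)); last lin.
by apply: S2_ext => *; rewrite cstE Tensor.pureZr.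
Qed.

Lemma tri1lE x v (c : C) : tri 1%P x v c = S2 c (fun c1 c2 => 1 ⊗ (x c1 : H) ⊗ (v c2 : B)).
Proof.
rewrite triE -[RHS](S2_counitl (F := fun c => S2 c (fun c1 c2 => 1 ⊗ x c1 ⊗ v c2))); last lin.
apply: S2_ext => c1 c2; rewrite (S2_mor (f := fun X => (ceps C c1 : k) *: X)); last lin.
by apply: S2_ext => *; rewrite cstE !Tensor.pureZl.
Qed.

Lemma Delta_tri u x v : cpt x ->
  DeltaL ∘ tri u x v = op2 diaL (tri u x 1%P) (tri 1%P x v) :> {linear C -> _}.
Proof.
move=> hx; apply: linP_eq => c; rewrite lcompE op2E triE.
rewrite (S2_mor (f := DeltaL)); last lin.
transitivity (S2 c (fun c1 c2 => S2 c2 (fun c2 c3 => S2 c2 (fun c21 c22 =>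
   diaL ((u c1 ⊗ x c21 ⊗ 1) ⊗ (1 ⊗ x c22 ⊗ v c3)))))).
  apply: S2_ext => c1 c2; rewrite (S2_mor (f := DeltaL)); last lin.
  apply: S2_ext => c3 c4; rewrite DeltaLE.
  by rewrite (cptE (F := fun a b => diaL ((u c1 ⊗ a ⊗ 1) ⊗ (1 ⊗ b ⊗ v c4)))) //; lin.
transitivity (S2 c (fun c1 c2 => S2 c1 (fun c11 c12 => S2 c2 (fun c21 c22 =>
   diaL ((u c11 ⊗ x c12 ⊗ 1) ⊗ (1 ⊗ x c21 ⊗ v c22)))))).
  rewrite (S2_assoc (F := fun a b d => S2 d (fun d1 d2 => diaL ((u a ⊗ x b ⊗ 1) ⊗ (1 ⊗ x d1 ⊗ v d2))))); last lin.
  apply: S2_ext => c1 c2.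
  by rewrite (S2_assoc (F := fun a b d => diaL ((u c1 ⊗ x a ⊗ 1) ⊗ (1 ⊗ x b ⊗ v d)))) //; lin.
apply: S2_ext => c1 c2; rewrite tri1E tri1lE S2_exch.
rewrite (S2_mor (f := fun X => diaL (_ ⊗ X))); last lin.
apply: S2_ext => c3 c4; rewrite (S2_mor (f := fun X => diaL (X ⊗ _))); last lin.
by apply: S2_ext => *.
Qed.

Lemma dia_slide (M N : {linear C -> L}) u : op2 diaL (M <∙ u) N = op2 diaL M (u ∙> N).
Proof.
by symmetry; apply: op2_assoc => X b Y; rewrite bLE bRE dia_bal.
Qed.

(** The right-hand side carries [gammaI] at the right end of the first leg and [gamma] at the left
    end of the second; balancing brings them together, and they cancel to leave the coproduct of
    xy. *)
Lemma Delta_mul_word a a' b b' (x y : {linear C -> H}) : cpt x -> cpt y -> comm x y ->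
  DeltaL ∘ op2 mul (bra a a' ∘ x) (bra b b' ∘ y)
  = op2 diaL (op2 mul (bra a 1 ∘ x) (bra b 1 ∘ y)) (op2 mul (bra 1 a' ∘ x) (bra 1 b' ∘ y)).
Proof.
move=> hx hy hxy; rewrite !tri_brr !mul_tri; try by cm.
rewrite !act_cst1 // !(conv1, convr1) Delta_tri; last by cm.
have e u : tri u (x ⊙ y) (GI x y) = tri u (x ⊙ y) 1%P <∙ GI x y by rewrite tri_bR conv1.
by rewrite e dia_slide tri_bL gamIK.
Qed.
End Delta.

Lemma Delta_mul_pure a a' b b' h g :
  DeltaL (mul ((a ⊗ h ⊗ a') ⊗ (b ⊗ g ⊗ b')))
  = S2 h (fun h1 h2 => S2 g (fun g1 g2 =>
      diaL (mul ((a ⊗ h1 ⊗ 1) ⊗ (b ⊗ g1 ⊗ 1)) ⊗ mul ((1 ⊗ h2 ⊗ a') ⊗ (1 ⊗ g2 ⊗ b'))))).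
Proof.
have /(congr1 (fun F : {linear HH -> DL} => F (h ⊗ g))) := Delta_mul_word a a' b b' h1 h2 h12.
rewrite (lcompE DeltaL) ev2 !brrE op2_tens => ->.
by apply: S2_ext => x1 x2; apply: S2_ext => y1 y2; rewrite !ev2 !brrE.
Qed.

Let mul_linked : linked2 (fun X1 X2 Y1 Y2 => diaL (mul (X1 ⊗ Y1) ⊗ mul (X2 ⊗ Y2))).
Proof.
split=> [Y1 Y2|X1 X2|*|*]; [|lin|by rewrite mul_rac|by rewrite mul_rac].
by split=> [|b X1 X2]; [lin|rewrite !Lmul_lact dia_bal].
Qed.

Lemma Delta_mul X Y : DeltaL (mul (X ⊗ Y)) =
  sig X (fun X1 X2 => sig Y (fun Y1 Y2 => diaL (mul (X1 ⊗ Y1) ⊗ mul (X2 ⊗ Y2)))).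
Proof.
rewrite /sig exchange_big; move: X Y; apply: L_eq2; first by lin.
  exact: (sig22_lin mul_linked).
move=> a h a' b g b'; rewrite Delta_mul_pure S2_exch; symmetry.
exact: (sig22_pure mul_linked).
Qed.

(** * From pure tensors to all elements and all representatives *)

Lemma sig_exch3 (V : lmodType k) X Y Z (K : L -> L -> L -> L -> L -> L -> V) :
  sig X (fun X1 X2 => sig Y (fun Y1 Y2 => sig Z (fun Z1 Z2 => K X1 X2 Y1 Y2 Z1 Z2)))
  = sig Z (fun Z1 Z2 => sig Y (fun Y1 Y2 => sig X (fun X1 X2 => K X1 X2 Y1 Y2 Z1 Z2))).
Proof.
rewrite /sig; under eq_bigr => p _ do rewrite exchange_big.
by rewrite exchange_big; apply: eq_bigr => r _; rewrite exchange_big.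
Qed.

Lemma S2_exch3 (V : lmodType k) (h g f : H) (K : H -> H -> H -> H -> H -> H -> V) :
  S2 h (fun h1 h2 => S2 g (fun g1 g2 => S2 f (fun f1 f2 => K h1 h2 g1 g2 f1 f2)))
  = S2 f (fun f1 f2 => S2 g (fun g1 g2 => S2 h (fun h1 h2 => K h1 h2 g1 g2 f1 f2))).
Proof.
rewrite /S2; under eq_bigr => p _ do rewrite exchange_big.
by rewrite exchange_big; apply: eq_bigr => r _; rewrite exchange_big.
Qed.

Let conv_linked om0 om1 : linked3 (V := B)
  (fun X1 X2 Y1 Y2 Z1 Z2 => Phi om0 (X1 ⊗ Y1 ⊗ Z1) * Phi om1 (X2 ⊗ Y2 ⊗ Z2)).
Proof.
split=> [Y1 Y2 Z1 Z2|*|*|*|*|*|*]; [|lin|lin|by rewrite Phi_rac1|by rewrite Phi_rac1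
  |by rewrite Phi_rac2|by rewrite Phi_rac2].
by split=> [|b X1 X2]; [lin|rewrite !Phi_lact mul1r mulr1 mulrA].
Qed.

Lemma Phi_conv_sig om0 om1 X Y Z :
  sig X (fun X1 X2 => sig Y (fun Y1 Y2 => sig Z (fun Z1 Z2 =>
    Phi om0 (X1 ⊗ Y1 ⊗ Z1) * Phi om1 (X2 ⊗ Y2 ⊗ Z2))))
  = Phi (op2 (C := HHH) (mulB B) om0 om1) (X ⊗ Y ⊗ Z).
Proof.
(* The axioms have the sum over X outermost, whereas linked summands are treated with it
   innermost. *)
rewrite sig_exch3; move: X Y Z; apply: L_eq3.
- exact: (sig222_lin (conv_linked om0 om1)).
- by lin.
move=> a h a' b g b' c f c'; rewrite -Phi_conv S2_exch3.
exact: (sig222_pure (conv_linked om0 om1)).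
Qed.

Let assocl_linked : linked3
  (fun X1 X2 Y1 Y2 Z1 Z2 => bL (Phi omU (X1 ⊗ Y1 ⊗ Z1) ⊗ mul (mul (X2 ⊗ Y2) ⊗ Z2))).
Proof.
split=> [Y1 Y2 Z1 Z2|*|*|b X1 X2 Y1 Y2 Z1 Z2|b X1 X2 Y1 Y2 Z1 Z2
  |b X1 X2 Y1 Y2 Z1 Z2|b X1 X2 Y1 Y2 Z1 Z2]; [|lin|lin| | | |].
2: by rewrite (Phi_rac1 omU X1 1 b).
2: by rewrite (mul_rac X2 b 1).
2: by rewrite (Phi_rac2 omU X1 1 b).
2: by rewrite -(mul_rac (mul (X2 ⊗ Y2)) b 1) (rac_mul X2).
split=> [|b X1 X2]; first lin.
rewrite (Phi_lact omU 1 b X1) (Lmul_lact b 1 X2) (Lmul_lact b 1 (mul (X2 ⊗ Y2))).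
by rewrite mul1r !bLE lactM mulr1.
Qed.

Let assocr_linked : linked3
  (fun X1 X2 Y1 Y2 Z1 Z2 => bR (mul (X1 ⊗ mul (Y1 ⊗ Z1)) ⊗ Phi omU (X2 ⊗ Y2 ⊗ Z2))).
Proof.
split=> [Y1 Y2 Z1 Z2|*|*|b X1 X2 Y1 Y2 Z1 Z2|b X1 X2 Y1 Y2 Z1 Z2
  |b X1 X2 Y1 Y2 Z1 Z2|b X1 X2 Y1 Y2 Z1 Z2]; [|lin|lin| | | |].
2: by rewrite (Lmul_lact 1 b Y1) (mul_rac X1 1 b).
2: by rewrite (Phi_rac1 omU X2 b 1).
2: by rewrite (mul_rac Y1 1 b).
2: by rewrite (Phi_rac2 omU X2 b 1).
split=> [|b X1 X2]; first lin.
rewrite (Phi_lact omU b 1 X2) (Lmul_lact 1 b X1).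
by rewrite mulr1 !bRE lactM mulr1.
Qed.

Lemma Phi_assoc_sig X Y Z :
  sig X (fun X1 X2 => sig Y (fun Y1 Y2 => sig Z (fun Z1 Z2 =>
    lac (env (Phi omU (X1 ⊗ Y1 ⊗ Z1)) 1 ⊗ mul (mul (X2 ⊗ Y2) ⊗ Z2)))))
  = sig X (fun X1 X2 => sig Y (fun Y1 Y2 => sig Z (fun Z1 Z2 =>
    lac (env 1 (Phi omU (X2 ⊗ Y2 ⊗ Z2)) ⊗ mul (X1 ⊗ mul (Y1 ⊗ Z1)))))).
Proof.
transitivity (sig Z (fun Z1 Z2 => sig Y (fun Y1 Y2 => sig X (fun X1 X2 =>
    bL (Phi omU (X1 ⊗ Y1 ⊗ Z1) ⊗ mul (mul (X2 ⊗ Y2) ⊗ Z2)))))).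
  rewrite -sig_exch3; apply: eq_bigr => p _; apply: eq_bigr => q _; apply: eq_bigr => r _.
  by rewrite bLE.
transitivity (sig Z (fun Z1 Z2 => sig Y (fun Y1 Y2 => sig X (fun X1 X2 =>
    bR (mul (X1 ⊗ mul (Y1 ⊗ Z1)) ⊗ Phi omU (X2 ⊗ Y2 ⊗ Z2)))))); last first.
  rewrite -sig_exch3; apply: eq_bigr => p _; apply: eq_bigr => q _; apply: eq_bigr => r _.
  by rewrite bRE.
move: X Y Z; apply: L_eq3.
- exact: (sig222_lin assocl_linked).
- exact: (sig222_lin assocr_linked).
move=> a h a' b g b' c f c'.
apply: etrans (sig222_pure assocl_linked a h a' b g b' c f c') _.
apply: etrans _ (esym (sig222_pure assocr_linked a h a' b g b' c f c')).
apply: etrans (esym (S2_exch3 h g f (fun h1 h2 g1 g2 f1 f2 =>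
  bL (Phi omU (a ⊗ h1 ⊗ 1 ⊗ (b ⊗ g1 ⊗ 1) ⊗ (c ⊗ f1 ⊗ 1))
    ⊗ mul (mul ((1 ⊗ h2 ⊗ a') ⊗ (1 ⊗ g2 ⊗ b')) ⊗ (1 ⊗ f2 ⊗ c')))))) _.
apply: etrans _ (S2_exch3 h g f (fun h1 h2 g1 g2 f1 f2 =>
  bR (mul ((a ⊗ h1 ⊗ 1) ⊗ mul ((b ⊗ g1 ⊗ 1) ⊗ (c ⊗ f1 ⊗ 1)))
    ⊗ Phi omU (1 ⊗ h2 ⊗ a' ⊗ (1 ⊗ g2 ⊗ b') ⊗ (1 ⊗ f2 ⊗ c'))))).
apply: etrans _ (etrans (Phi_assoc a a' b b' c c' h g f) _).
  by apply: S2_ext => *; apply: S2_ext => *; apply: S2_ext => *; rewrite bLE.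
by apply: S2_ext => *; apply: S2_ext => *; apply: S2_ext => *; rewrite bRE.
Qed.

Lemma sig_exch4 (V : lmodType k) X Y Z W (K : L -> L -> L -> L -> L -> L -> L -> L -> V) :
  sig X (fun X1 X2 => sig Y (fun Y1 Y2 => sig Z (fun Z1 Z2 => sig W (fun W1 W2 => K X1 X2 Y1 Y2 Z1 Z2 W1 W2))))
  = sig W (fun W1 W2 => sig Z (fun Z1 Z2 => sig Y (fun Y1 Y2 => sig X (fun X1 X2 => K X1 X2 Y1 Y2 Z1 Z2 W1 W2)))).
Proof.
rewrite (sig_exch3 X Y Z (fun X1 X2 Y1 Y2 Z1 Z2 => sig W (fun W1 W2 => K X1 X2 Y1 Y2 Z1 Z2 W1 W2))).
rewrite /sig; under eq_bigr => r _ do under eq_bigr => q _ do rewrite exchange_big.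
under eq_bigr => r _ do rewrite exchange_big.
by rewrite exchange_big.
Qed.

Lemma S2_exch4 (V : lmodType k) (h g f l : H) (K : H -> H -> H -> H -> H -> H -> H -> H -> V) :
  S2 h (fun h1 h2 => S2 g (fun g1 g2 => S2 f (fun f1 f2 => S2 l (fun l1 l2 => K h1 h2 g1 g2 f1 f2 l1 l2))))
  = S2 l (fun l1 l2 => S2 f (fun f1 f2 => S2 g (fun g1 g2 => S2 h (fun h1 h2 => K h1 h2 g1 g2 f1 f2 l1 l2)))).
Proof.
rewrite (S2_exch3 h g f (fun h1 h2 g1 g2 f1 f2 => S2 l (fun l1 l2 => K h1 h2 g1 g2 f1 f2 l1 l2))).
rewrite /S2; under eq_bigr => r _ do under eq_bigr => q _ do rewrite exchange_big.
under eq_bigr => r _ do rewrite exchange_big.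
by rewrite exchange_big.
Qed.

Lemma cocycle_linked : linked4 (V := B)
  (fun X1 X2 Y1 Y2 Z1 Z2 W1 W2 =>
     Phi omU (X1 ⊗ Y1 ⊗ mul (Z1 ⊗ W1)) * Phi omU (mul (X2 ⊗ Y2) ⊗ Z2 ⊗ W2)).
Proof.
split=> [Y1 Y2 Z1 Z2 W1 W2|*|*|*|b X1 X2 Y1 Y2 Z1 Z2 W1 W2|b X1 X2 Y1 Y2 Z1 Z2 W1 W2
  |b X1 X2 Y1 Y2 Z1 Z2 W1 W2|b X1 X2 Y1 Y2 Z1 Z2 W1 W2|b X1 X2 Y1 Y2 Z1 Z2 W1 W2
  |b X1 X2 Y1 Y2 Z1 Z2 W1 W2]; [|lin|lin|lin| | | | | |].
2: by rewrite (Phi_rac1 omU X1 1 b).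
2: by rewrite (mul_rac X2 b 1).
2: by rewrite (Lmul_lact 1 b Z1) (Phi_rac2 omU X1 1 b).
2: by rewrite -(Phi_rac1 omU (mul (X2 ⊗ Y2)) b 1) (rac_mul X2).
2: by rewrite (mul_rac Z1 1 b).
2: by rewrite (Phi_rac2 omU (mul (X2 ⊗ Y2)) b 1).
split=> [|b X1 X2]; first lin.
rewrite (Phi_lact omU 1 b X1) (Lmul_lact b 1 X2) (Phi_lact omU b 1 (mul (X2 ⊗ Y2))).
by rewrite mul1r mulr1 mulrA.
Qed.

Lemma big_sig3 (V : lmodType k) I (s : seq I) Y (F : I -> L -> L -> L -> V) :
  \sum_(i <- s) sig3 Y (F i) = sig3 Y (fun Y1 Y2 Y3 => \sum_(i <- s) F i Y1 Y2 Y3).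
Proof.
rewrite /sig3 /sig exchange_big; apply: eq_bigr => p _.
by rewrite exchange_big.
Qed.

Lemma sig3_exch (V : lmodType k) Y Z (F : L -> L -> L -> L -> L -> L -> V) :
  sig3 Y (fun Y1 Y2 Y3 => sig3 Z (F Y1 Y2 Y3))
  = sig3 Z (fun Z1 Z2 Z3 => sig3 Y (fun Y1 Y2 Y3 => F Y1 Y2 Y3 Z1 Z2 Z3)).
Proof.
rewrite {1}/sig3 /sig -big_sig3; apply: eq_bigr => p _.
by rewrite -big_sig3.
Qed.

(** A summand of the right side of the cocycle identity. With three factors of Y and of Z it does
    not fit [linked4]: scalars between different consecutive factors of one variable take different
    routes. *)
Definition cocR X1 X2 Y1 Y2 Y3 Z1 Z2 Z3 W1 W2 : B :=
  Phi omU (X1 ⊗ bL (Phi omU (Y1 ⊗ Z1 ⊗ W1) ⊗ mul (Y2 ⊗ Z2)) ⊗ W2) * Phi omU (X2 ⊗ Y3 ⊗ Z3).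

Let bX Y1 Y2 Y3 Z1 Z2 Z3 W1 W2 : bal (fun X1 X2 => cocR X1 X2 Y1 Y2 Y3 Z1 Z2 Z3 W1 W2).
Proof.
rewrite /cocR; split=> [|b X1 X2]; first lin.
by rewrite (Phi_lact omU 1 b X1) (Phi_lact omU b 1 X2) mul1r mulr1 mulrA.
Qed.

Let bY X Z1 Z2 Z3 W1 W2 :
  bal3 (fun Y1 Y2 Y3 => sig X (fun X1 X2 => cocR X1 X2 Y1 Y2 Y3 Z1 Z2 Z3 W1 W2)).
Proof.
split=> [|b Y1 Y2 Y3|b Y1 Y2 Y3].
- by rewrite /cocR; split=> u v; apply: lin_big => p; lin.
- apply: eq_bigr => p _; rewrite /cocR; congr (Phi omU (_ ⊗ _ ⊗ _) * _).
  by rewrite (Phi_lact omU 1 b Y1) (Lmul_lact b 1 Y2) mul1r !bLE lactM mulr1.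
(* Between the first two factors of Y the scalar passes through the value of the nested Phi; between
   the last two it has to pass through the factors of X. *)
transitivity (sig X (fun X1 X2 => cocR (rac (X1 ⊗ env 1 b)) X2 Y1 Y2 Y3 Z1 Z2 Z3 W1 W2)).
  apply: eq_bigr => p _; rewrite /cocR (Phi_rac1 omU p.1 1 b); congr (Phi omU (_ ⊗ _ ⊗ _) * _).
  by rewrite (Lmul_lact 1 b Y2) !bLE !lactM !(mulr1, mul1r).
rewrite (sig_tak (bX _ _ _ _ _ _ _ _)); apply: eq_bigr => p _.
by rewrite /cocR (Phi_rac1 omU p.2 b 1).
Qed.

Let bZ X Y W1 W2 : bal3 (fun Z1 Z2 Z3 => sig3 Y (fun Y1 Y2 Y3 =>
  sig X (fun X1 X2 => cocR X1 X2 Y1 Y2 Y3 Z1 Z2 Z3 W1 W2))).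
Proof.
split=> [|b Z1 Z2 Z3|b Z1 Z2 Z3].
- by rewrite /cocR; split=> u v; apply: lin_big => r; apply: lin_big => q; apply: lin_big => p; lin.
(* A scalar on a factor of Z goes to the factor of Y paired with it, and the Takeuchi property of
   the iterated coproduct of Y carries it to the next one. *)
- transitivity (sig3 Y (fun Y1 Y2 Y3 =>
    sig X (fun X1 X2 => cocR X1 X2 (rac (Y1 ⊗ env 1 b)) Y2 Y3 Z1 Z2 Z3 W1 W2))).
    apply: eq_bigr => r _; apply: eq_bigr => q _; apply: eq_bigr => p _.
    by rewrite /cocR (Phi_rac1 omU r.1 1 b).
  rewrite (sig3_tak12 _ _ (bY X Z1 Z2 Z3 W1 W2)).
  apply: eq_bigr => r _; apply: eq_bigr => q _; apply: eq_bigr => p _.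
  by rewrite /cocR (mul_rac q.1 b 1).
transitivity (sig3 Y (fun Y1 Y2 Y3 =>
    sig X (fun X1 X2 => cocR X1 X2 Y1 (rac (Y2 ⊗ env 1 b)) Y3 Z1 Z2 Z3 W1 W2))).
  apply: eq_bigr => r _; apply: eq_bigr => q _; apply: eq_bigr => p _.
  by rewrite /cocR (mul_rac q.1 1 b).
rewrite (sig3_tak23 _ _ (bY X Z1 Z2 Z3 W1 W2)).
apply: eq_bigr => r _; apply: eq_bigr => q _; apply: eq_bigr => p _.
by rewrite /cocR (Phi_rac2 omU p.2 b 1).
Qed.

Let bW X Y Z : bal (fun W1 W2 => sig3 Z (fun Z1 Z2 Z3 => sig3 Y (fun Y1 Y2 Y3 =>
  sig X (fun X1 X2 => cocR X1 X2 Y1 Y2 Y3 Z1 Z2 Z3 W1 W2)))).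
Proof.
split=> [|b W1 W2].
  rewrite /cocR; split=> u; apply: lin_big => r; apply: lin_big => q; apply: lin_big => p;
  by apply: lin_big => y; apply: lin_big => z; lin.
(* The scalar on the first factor of W goes to Z1, from there to Z2, and through the product with Y2
   to the right end of the middle argument, next to the second factor of W. *)
transitivity (sig3 Z (fun Z1 Z2 Z3 => sig3 Y (fun Y1 Y2 Y3 =>
    sig X (fun X1 X2 => cocR X1 X2 Y1 Y2 Y3 (rac (Z1 ⊗ env 1 b)) Z2 Z3 W1 W2)))).
  apply: eq_bigr => z _; apply: eq_bigr => y _.
  apply: eq_bigr => r _; apply: eq_bigr => q _; apply: eq_bigr => p _.
  by rewrite /cocR (Phi_rac2 omU r.1 1 b).
rewrite (sig3_tak12 _ _ (bZ X Y W1 W2)).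
apply: eq_bigr => z _; apply: eq_bigr => y _.
apply: eq_bigr => r _; apply: eq_bigr => q _; apply: eq_bigr => p _.
rewrite /cocR; congr (_ * _); rewrite -(Phi_rac2 omU p.1 b 1); congr (Phi omU (_ ⊗ _ ⊗ _)).
by rewrite !bLE (rac_lac _ 1 b 1) (rac_mul q.1 y.1 b 1).
Qed.

Let tot X Y Z W := sig W (fun W1 W2 => sig3 Z (fun Z1 Z2 Z3 => sig3 Y (fun Y1 Y2 Y3 =>
  sig X (fun X1 X2 => cocR X1 X2 Y1 Y2 Y3 Z1 Z2 Z3 W1 W2)))).

Let tot_lin : quadlin tot.
Proof.
split=> [W|X Y Z]; last exact: (sig_lin (bW X Y Z)).
split=> [Y Z|X Z|X Y]; apply: lin_big => r; last exact: (sig3_lin (bZ X Y _ _)).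
  by apply: lin_big => z; apply: lin_big => z'; apply: lin_big => y; apply: lin_big => y'; apply: sig_lin.
by apply: lin_big => z; apply: lin_big => z'; apply: (sig3_lin (bY X _ _ _ _ _)).
Qed.

Let tot_pure a h a' b g b' c f c' d l d' :
  tot (a ⊗ h ⊗ a') (b ⊗ g ⊗ b') (c ⊗ f ⊗ c') (d ⊗ l ⊗ d')
  = S2 l (fun l1 l2 => S2 f (fun f1 f => S2 f (fun f2 f3 => S2 g (fun g1 g => S2 g (fun g2 g3 =>
    S2 h (fun h1 h2 => cocR (a ⊗ h1 ⊗ 1) (1 ⊗ h2 ⊗ a') (b ⊗ g1 ⊗ 1) (1 ⊗ g2 ⊗ 1) (1 ⊗ g3 ⊗ b')
      (c ⊗ f1 ⊗ 1) (1 ⊗ f2 ⊗ 1) (1 ⊗ f3 ⊗ c') (d ⊗ l1 ⊗ 1) (1 ⊗ l2 ⊗ d'))))))).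
Proof.
rewrite /tot (sig_pure (bW _ _ _)); apply: S2_ext => l1 l2.
rewrite (sig3_pure _ _ _ (bZ _ _ _ _)); apply: S2_ext => f1 f0; apply: S2_ext => f2 f3.
rewrite (sig3_pure _ _ _ (bY _ _ _ _ _ _)); apply: S2_ext => g1 g0; apply: S2_ext => g2 g3.
exact: (sig_pure (bX _ _ _ _ _ _ _ _)).
Qed.

Lemma Phi_cocycle_sig X Y Z W :
  sig X (fun X1 X2 => sig Y (fun Y1 Y2 => sig Z (fun Z1 Z2 => sig W (fun W1 W2 =>
    Phi omU (X1 ⊗ Y1 ⊗ mul (Z1 ⊗ W1)) * Phi omU (mul (X2 ⊗ Y2) ⊗ Z2 ⊗ W2)))))
  = sig X (fun X1 X2 => sig3 Y (fun Y1 Y2 Y3 => sig3 Z (fun Z1 Z2 Z3 => sig W (fun W1 W2 =>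
    cocR X1 X2 Y1 Y2 Y3 Z1 Z2 Z3 W1 W2)))).
Proof.
transitivity (tot X Y Z W); last first.
  transitivity (sig X (fun X1 X2 => sig W (fun W1 W2 => sig3 Y (fun Y1 Y2 Y3 => sig3 Z (fun Z1 Z2 Z3 =>
    cocR X1 X2 Y1 Y2 Y3 Z1 Z2 Z3 W1 W2))))); last first.
    apply: eq_bigr => p _; rewrite {1}/sig big_sig3.
    by apply: eq_bigr => q _; apply: eq_bigr => r _; rewrite big_sig3.
  rewrite {1}/sig exchange_big; apply: eq_bigr => q _.
  transitivity (\sum_(p <- R X) sig3 Z (fun Z1 Z2 Z3 => sig3 Y (fun Y1 Y2 Y3 =>
    cocR p.1 p.2 Y1 Y2 Y3 Z1 Z2 Z3 q.1 q.2))); last by apply: eq_bigr => p _; rewrite sig3_exch.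
  by rewrite big_sig3; apply: eq_bigr => r _; apply: eq_bigr => s _; rewrite big_sig3.
rewrite sig_exch4; move: X Y Z W; apply: L_eq4.
- exact: (sig2222_lin cocycle_linked).
- exact: tot_lin.
move=> a h a' b g b' c f c' d l d'; rewrite tot_pure.
apply: etrans (sig2222_pure cocycle_linked a h a' b g b' c f c' d l d') _.
apply: etrans (esym (S2_exch4 h g f l (fun h1 h2 g1 g2 f1 f2 l1 l2 =>
  Phi omU (a ⊗ h1 ⊗ 1 ⊗ (b ⊗ g1 ⊗ 1) ⊗ mul ((c ⊗ f1 ⊗ 1) ⊗ (d ⊗ l1 ⊗ 1)))
  * Phi omU (mul ((1 ⊗ h2 ⊗ a') ⊗ (1 ⊗ g2 ⊗ b')) ⊗ (1 ⊗ f2 ⊗ c') ⊗ (1 ⊗ l2 ⊗ d'))))) _.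
apply: etrans (Phi_cocycle a a' b b' c c' d d' h g f l) _; symmetry.
pose F h1 h2 g1 g2 g3 f1 f2 f3 l1 l2 : B := cocR (a ⊗ h1 ⊗ 1) (1 ⊗ h2 ⊗ a') (b ⊗ g1 ⊗ 1)
  (1 ⊗ g2 ⊗ 1) (1 ⊗ g3 ⊗ b') (c ⊗ f1 ⊗ 1) (1 ⊗ f2 ⊗ 1) (1 ⊗ f3 ⊗ c') (d ⊗ l1 ⊗ 1) (1 ⊗ l2 ⊗ d').
(* [Phi_cocycle] splits the first Sweedler factors of g and f, [tot_pure] the last ones;
   coassociativity relates the two. *)
transitivity (S2 l (fun l1 l2 => S2 f (fun f0 f3 => S2 f0 (fun f1 f2 => S2 g (fun g0 g3 =>
  S2 g0 (fun g1 g2 => S2 h (fun h1 h2 => F h1 h2 g1 g2 g3 f1 f2 f3 l1 l2))))))).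
  apply: S2_ext => l1 l2.
  rewrite (S2_assoc (F := fun f1 f2 f3 => S2 g (fun g0 g3 => S2 g0 (fun g1 g2 =>
    S2 h (fun h1 h2 => F h1 h2 g1 g2 g3 f1 f2 f3 l1 l2))))); last by rewrite /F /cocR; lin.
  apply: S2_ext => f1 f0; apply: S2_ext => f2 f3.
  rewrite (S2_assoc (F := fun g1 g2 g3 =>
    S2 h (fun h1 h2 => F h1 h2 g1 g2 g3 f1 f2 f3 l1 l2))) //.
  by rewrite /F /cocR; lin.
s2match; rewrite /F /cocR bLE.
by [].
Qed.

Lemma bimodule_L : is_bimodule lac rac.
Proof.
have lD (x y : Be B) X : lac ((x + y) ⊗ X) = lac (x ⊗ X) + lac (y ⊗ X).
  by rewrite Tensor.pureDl linearD.
have rD (x y : Be B) X : rac (X ⊗ (x + y)) = rac (X ⊗ x) + rac (X ⊗ y).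
  by rewrite Tensor.pureDr linearD.
have lDr (x : Be B) X Y : lac (x ⊗ (X + Y)) = lac (x ⊗ X) + lac (x ⊗ Y).
  by rewrite Tensor.pureDr linearD.
have rDl (x : Be B) X Y : rac ((X + Y) ⊗ x) = rac (X ⊗ x) + rac (Y ⊗ x).
  by rewrite Tensor.pureDl linearD.
split.
- exact: lact1.
- elim/tens_ind=> [x y hx hy z X|b c]; first by rewrite mulrDl !lD hx hy.
  elim/tens_ind=> [x y hx hy X|b' c' X]; first by rewrite mulrDr !lD lDr hx hy.
  apply: etrans (congr1 (fun z : Be B => lac (z ⊗ X)) (Be_mulE b c b' c')) _.
  exact/esym/(lactM b c b' c').
- exact: rac1.
- elim/tens_ind=> [x y hx hy z X|b c]; first by rewrite mulrDl !rD rDl hx hy.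
  elim/tens_ind=> [x y hx hy X|b' c' X]; first by rewrite mulrDr !rD hx hy.
  apply: etrans (congr1 (fun z : Be B => rac (X ⊗ z)) (Be_mulE b c b' c')) _.
  exact/esym/(racM X b c b' c').
- elim/tens_ind=> [x y hx hy z X|b c]; first by rewrite !lD rDl hx hy.
  elim/tens_ind=> [x y hx hy X|b' c' X]; first by rewrite !rD lDr hx hy.
  exact: rac_lac.
Qed.

(** * The coalgebroid *)

Local Notation D3 := (diamond3 lac lac lac).
Local Notation dia3L := (dia3 lac lac lac).

Lemma bal3_dia3 : bal3 dia3L.
Proof.
pose d : {linear L ⨂ L ⨂ L -> D3} := qpi (@diamond3_rel k B L L L lac lac lac).
have h : trilin (fun X Y Z => d (X ⊗ Y ⊗ Z)) by lin.
split=> [//|b X Y Z|b X Y Z].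
  apply/eqP; rewrite -subr_eq0 -[X in X - _]/(d _) -[X in _ - X]/(d _) -linearB; apply/eqP.
  by apply: qpi_rel; apply: Diamond3Rel1.
apply/eqP; rewrite -subr_eq0 -[X in X - _]/(d _) -[X in _ - X]/(d _) -linearB; apply/eqP.
by apply: qpi_rel; apply: Diamond3Rel2.
Qed.

Lemma dia3_lift (V : lmodType k) (F : L -> L -> L -> V) : bal3 F ->
  exists g : {linear D3 -> V}, forall X Y Z, g (dia3L X Y Z) = F X Y Z.
Proof.
case=> /tens_lift3 [f fE] h12' h23.
have f0 z : diamond3_rel lac lac lac z -> f z = 0.
  by case=> b X Y Z; rewrite linearB !fE ?h12' ?h23 subrr.
exists (mklin (f := qlift f) (qlift_linear f0)) => X Y Z.
exact: etrans (qliftE f0 _) (fE X Y Z).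
Qed.

Lemma bal3_rac1 (V : lmodType k) (F : L -> L -> L -> V) b c : bal3 F -> bal3 (fun X Y Z => F (rac (X ⊗ env b c)) Y Z).
Proof.
case=> -[f1 f2 f3] hF hF'; split=> [|d X Y Z|//]; last by rewrite rac_lac hF.
by split=> // v w; apply: (lin_comp (g := fun X => F X v w)) => //; lin.
Qed.

Lemma bal3_rac2 (V : lmodType k) (F : L -> L -> L -> V) b c : bal3 F -> bal3 (fun X Y Z => F X (rac (Y ⊗ env b c)) Z).
Proof.
case=> -[f1 f2 f3] hF hF'; split=> [|d X Y Z|d X Y Z]; [|by rewrite rac_lac hF|by rewrite rac_lac hF'].
by split=> // v w; apply: (lin_comp (g := fun X => F v X w)) => //; lin.
Qed.

Lemma bal3_rac3 (V : lmodType k) (F : L -> L -> L -> V) b c : bal3 F -> bal3 (fun X Y Z => F X Y (rac (Z ⊗ env b c))).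
Proof.
case=> -[f1 f2 f3] hF hF'; split=> [|//|d X Y Z]; last by rewrite rac_lac hF'.
by split=> // v w; apply: (lin_comp (g := fun X => F v w X)) => //; lin.
Qed.

Lemma bal_dia : bal (fun X Y => diaL (X ⊗ Y)).
Proof. by split=> [|b X Y]; [lin|rewrite dia_bal]. Qed.

Lemma Delta_lac b c X : DeltaL (lac (env b c ⊗ X))
  = sig X (fun X1 X2 => diaL (lac (env b 1 ⊗ X1) ⊗ lac (env 1 c ⊗ X2))).
Proof. by rewrite -(sig_lac bal_dia) (HR (lac _)). Qed.

Lemma takeuchi_Delta X : takeuchi rac rac (DeltaL X).
Proof.
move=> s e b.
(* The condition concerns all decompositions. Its two sides are values of linear maps on the diamond
   product, so one decomposition, that of [R], is enough. *)
have [gl glE] := dia_lift (bal_racl bal_dia 1 b).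
have [gr grE] := dia_lift (bal_racr bal_dia b 1).
transitivity (gl (DeltaL X)).
  by rewrite e linear_sum; apply: eq_bigr => p _; rewrite glE.
transitivity (gr (DeltaL X)); last first.
  by rewrite e linear_sum; apply: eq_bigr => p _; rewrite grE.
by rewrite -(sig_rep X glE) -(sig_rep X grE) (sig_tak bal_dia).
Qed.

Lemma coassoc_Delta X :
  sig X (fun X1 X2 => sig X1 (fun X11 X12 => dia3L X11 X12 X2)) = sig3 X dia3L.
Proof.
have [[l1 l2 l3] b12 b23] := bal3_dia3.
have bF X2 : bal (fun X11 X12 => dia3L X11 X12 X2) by split=> [|b Y Z]; [split|rewrite b12].
have hF : bal (fun X1 X2 => sig X1 (fun X11 X12 => dia3L X11 X12 X2)).
  split=> [|b X1 X2]; first split=> v.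
  - exact: (sig_lin (bF v)).
  - by apply: lin_big => p; apply: l3.
  by rewrite (sig_lac (bF X2)); apply: eq_bigr => p _; rewrite lact1 b23.
move: X; apply: L_eq => [||a h a'].
- exact: (sig_lin hF).
- exact: (sig3_lin bal3_dia3).
rewrite (sig3_pure a h a' bal3_dia3) (sig_pure hF).
rewrite -(S2_assoc (F := fun x y z => dia3L (a ⊗ x ⊗ 1) (1 ⊗ y ⊗ 1) (1 ⊗ z ⊗ a'))).
  by apply: S2_ext => x y; rewrite (sig_pure (bF _)).
by split=> u v; [apply: (lin_comp (l1 _ _))|apply: (lin_comp (l2 _ _))|apply: (lin_comp (l3 _ _))]; lin.
Qed.

Lemma takeuchi3_Delta X : takeuchi3 rac rac rac (sig3 X dia3L).
Proof.
move=> s e b.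
have hs (V : lmodType k) (F : L -> L -> L -> V) : bal3 F ->
    \sum_(x <- s) F x.1.1 x.1.2 x.2 = sig3 X F.
  case/dia3_lift=> g gE; transitivity (g (sig3 X dia3L)).
    by rewrite e linear_sum; apply: eq_bigr => x _; rewrite gE.
  rewrite linear_sum; apply: eq_bigr => p _; rewrite linear_sum.
  by apply: eq_bigr => q _; rewrite gE.
split.
  rewrite (hs _ (fun X Y Z => dia3L (rac (X ⊗ env 1 b)) Y Z) (bal3_rac1 1 b bal3_dia3)).
  rewrite (sig3_tak12 X b bal3_dia3).
  by rewrite -(hs _ (fun X Y Z => dia3L X (rac (Y ⊗ env b 1)) Z) (bal3_rac2 b 1 bal3_dia3)).
rewrite (hs _ (fun X Y Z => dia3L X (rac (Y ⊗ env 1 b)) Z) (bal3_rac2 1 b bal3_dia3)).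
rewrite (sig3_tak23 X b bal3_dia3).
by rewrite -(hs _ (fun X Y Z => dia3L X Y (rac (Z ⊗ env b 1))) (bal3_rac3 b 1 bal3_dia3)).
Qed.

Lemma counitl_L X : sig X (fun X1 X2 => lac (env (epsL X1) 1 ⊗ X2)) = X.
Proof.
transitivity (sig X (fun X1 X2 => bL (epsL X1 ⊗ X2))).
  by apply: eq_bigr => p _; rewrite bLE.
have hF : bal (fun X1 X2 => bL (epsL X1 ⊗ X2)).
  split=> [|b X1 X2]; first lin.
  by rewrite (epsL_lact 1 b X1) !bLE lactM mul1r mulr1.
move: X; apply: L_eq => [||a h a']; [exact: (sig_lin hF)|lin|].
rewrite (sig_pure hF) -[RHS](S2_counitl (F := fun h => a ⊗ h ⊗ a')); last lin.
apply: S2_ext => x y; rewrite epsLE mulr1 Tensor.pureZl (linZ (lin_linear bL)) bLE lactE.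
by rewrite !mulr1.
Qed.

Lemma counitr_L X : sig X (fun X1 X2 => lac (env 1 (epsL X2) ⊗ X1)) = X.
Proof.
transitivity (sig X (fun X1 X2 => bR (X1 ⊗ epsL X2))).
  by apply: eq_bigr => p _; rewrite bRE.
have hF : bal (fun X1 X2 => bR (X1 ⊗ epsL X2)).
  split=> [|b X1 X2]; first lin.
  by rewrite (epsL_lact b 1 X2) !bRE lactM !(mulr1, mul1r).
move: X; apply: L_eq => [||a h a']; [exact: (sig_lin hF)|lin|].
rewrite (sig_pure hF) -[RHS](S2_counitr (F := fun h => a ⊗ h ⊗ a')); last lin.
apply: S2_ext => x y; rewrite epsLE mul1r Tensor.pureZr (linZ (lin_linear bR)) bRE lactE.
by rewrite !mul1r.
Qed.
End Rep.

Lemma coalgebroid_L : is_left_coalgebroid rac DeltaL epsL.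
Proof.
have [R0 HR0] := represents_ex DeltaL.
split.
- exact: bimodule_L.
- move=> R HR b c X; apply: etrans (Delta_lac HR b c X) _.
  by [].
- exact: (takeuchi_Delta HR0).
- exact: epsL_lact.
- move=> R HR X; apply: etrans (etrans _ (coassoc_Delta HR X)) _.
    apply: eq_bigr => p _; apply: eq_bigr => q _; reflexivity.
  apply: eq_bigr => p _; apply: eq_bigr => q _; reflexivity.
- move=> R HR X; have <- : sig3 R X (dia3 lac lac lac) = sweedler R 3 X (fun X1 X2 X3 => dia3 lac lac lac X1 X2 X3).
    apply: eq_bigr => p _; apply: eq_bigr => q _; reflexivity.
  exact: (takeuchi3_Delta HR).
- move=> R HR X; exact: (counitl_L HR).
- move=> R HR X; exact: (counitr_L HR).
Qed.

Lemma Delta_one : DeltaL (1 ⊗ oneH ⊗ 1) = diaL ((1 ⊗ oneH ⊗ 1) ⊗ (1 ⊗ oneH ⊗ 1)).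
Proof.
rewrite DeltaLE (S2_rep (F := fun x y => diaL ((1 ⊗ x ⊗ 1) ⊗ (1 ⊗ y ⊗ 1))) (s := [:: (oneH, oneH)])).
- by rewrite big_seq1.
- by lin.
by rewrite big_seq1; apply: (cq_Delta_one Hcq).
Qed.

(** * Closed formulas *)

Section Mul.

Let idE (U V : lmodType k) (M : {linear U -> V}) : M = idfun ∘ M.
Proof. exact: linP_eq. Qed.

Lemma ev2_id (V : lmodType k) (f : {linear H ⨂ H -> V}) h g : op2 f p1 p2 (h ⊗ g) = f (h ⊗ g).
Proof. by rewrite op2_def lcompE (idE p1) (idE p2) pair_prl_prr. Qed.

Lemma ev3_id (V : lmodType k) (f : {linear H ⨂ H ⨂ H -> V}) h g f0 :
  (f ∘ cpair (cpair q1 q2) q3) (h ⊗ g ⊗ f0) = f (h ⊗ g ⊗ f0).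
Proof. by rewrite lcompE (idE q1) (idE q2) (idE q3) pair3. Qed.

Lemma ev3r (U V : lmodType k) (f : {linear H ⨂ U -> V}) (f' : {linear H ⨂ H -> U}) h g f0 :
  op2 f q1 (op2 f' q2 q3) (h ⊗ g ⊗ f0) = f (h ⊗ f' (g ⊗ f0)).
Proof.
have [|m mE] := tens_lift3 (F := fun x y z => f (x ⊗ f' (y ⊗ z))); first by lin.
rewrite (op2_flat (g := m)); last by move=> *; rewrite mE.
by rewrite ev3_id mE.
Qed.

Lemma ev3l (U V : lmodType k) (f : {linear U ⨂ H -> V}) (f' : {linear H ⨂ H -> U}) h g f0 :
  op2 f (op2 f' q1 q2) q3 (h ⊗ g ⊗ f0) = f (f' (h ⊗ g) ⊗ f0).
Proof.
have [|m mE] := tens_lift3 (F := fun x y z => f (f' (x ⊗ y) ⊗ z)); first by lin.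
have -> : op2 f (op2 f' q1 q2) q3 = m ∘ cpair (cpair q1 q2) q3.
  rewrite !op2_def (pair_compl f') lcompA; congr (_ ∘ _).
  by apply: tens_lin_eq3 => *; rewrite lcompE tmapE mE.
by rewrite ev3_id mE.
Qed.

Lemma Lmul_sum a h a' b g b' : mul ((a ⊗ h ⊗ a') ⊗ (b ⊗ g ⊗ b')) =
  S2 h (fun h1 h => S2 h (fun h2 h => S2 h (fun h3 h => S2 h (fun h4 h5 =>
  S2 g (fun g1 g => S2 g (fun g2 g3 =>
    (a * act (h1 ⊗ b) * gamma (h2 ⊗ g1)) ⊗ mulH (h3 ⊗ g2) ⊗ (gammaI (h4 ⊗ g3) * act (h5 ⊗ b') * a'))))))).
Proof.
rewrite LmulE.
have -> : mulW b b' = (p1 ▷ cst HH b) ∙> (G p1 p2 ∙> ((br ∘ (p1 ⊙ p2)) <∙ (GI p1 p2 ⋆ (p1 ▷ cst HH b')))).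
  by rewrite /mulW /core -!bLR !bRA.
rewrite !act_cst op2_tens_prll.
(* Evaluating the word letter by letter interleaves the sums over h and g; [s2match] then sorts
   them. *)
transitivity (S2 h (fun h1 h => S2 h (fun h2 h => S2 g (fun g1 g => S2 h (fun h3 h => S2 g (fun g2 g3 =>
  S2 h (fun h4 h5 => (a * act (h1 ⊗ b) * gamma (h2 ⊗ g1)) ⊗ mulH (h3 ⊗ g2) ⊗ (gammaI (h4 ⊗ g3) * act (h5 ⊗ b') * a')))))))).
rewrite (S2_mor (f := fun X => lac (_ ⊗ X))); last lin.
apply: S2_ext => x1 y1; rewrite op2_tens (S2_mor (f := fun X => bL (_ ⊗ X))); last lin.
rewrite (S2_mor (f := fun X => lac (_ ⊗ X))); last lin.
apply: S2_ext => x2 y2; rewrite (S2_mor (f := fun X => bL (_ ⊗ X))); last lin.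
rewrite (S2_mor (f := fun X => lac (_ ⊗ X))); last lin.
apply: S2_ext => g1 g2; rewrite ev2_id op2_tens.
rewrite (S2_mor (f := fun X => bL (_ ⊗ X))); last lin.
rewrite (S2_mor (f := fun X => bL (_ ⊗ X))); last lin.
rewrite (S2_mor (f := fun X => lac (_ ⊗ X))); last lin.
apply: S2_ext => x3 y3.
rewrite (S2_mor (f := fun X => bL (_ ⊗ X))); last lin.
rewrite (S2_mor (f := fun X => bL (_ ⊗ X))); last lin.
rewrite (S2_mor (f := fun X => lac (_ ⊗ X))); last lin.
apply: S2_ext => g3 g4; rewrite op2_tens_prlr (lcompE br) ev2_id brrE.
rewrite (S2_mor (f := fun X => bR (_ ⊗ X))); last lin.
rewrite (S2_mor (f := fun X => bL (_ ⊗ X))); last lin.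
rewrite (S2_mor (f := fun X => bL (_ ⊗ X))); last lin.
rewrite (S2_mor (f := fun X => lac (_ ⊗ X))); last lin.
apply: S2_ext => x4 y4; rewrite ev2_id mulBE !bRE !bLE !lactE.
by rewrite !mulr1 !mul1r !mulrA.
s2match.
by [].
Qed.

Lemma Phi_sum a h a' b g b' c f c' :
  Phi omU ((a ⊗ h ⊗ a') ⊗ (b ⊗ g ⊗ b') ⊗ (c ⊗ f ⊗ c')) =
  S2 h (fun h1 h => S2 h (fun h2 h => S2 h (fun h3 h => S2 h (fun h4 h => S2 h (fun h5 h =>
  S2 h (fun h6 h => S2 h (fun h7 h => S2 h (fun h8 h9 =>
  S2 g (fun g1 g => S2 g (fun g2 g => S2 g (fun g3 g => S2 g (fun g4 g =>
  S2 g (fun g5 g => S2 g (fun g6 g7 =>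
  S2 f (fun f1 f => S2 f (fun f2 f => S2 f (fun f3 f4 =>
    a * act (h1 ⊗ b) * act (h2 ⊗ act (g1 ⊗ c)) * act (h3 ⊗ gamma (g2 ⊗ f1))
    * gamma (h4 ⊗ mulH (g3 ⊗ f2)) * ((phi (h5 ⊗ g4 ⊗ f3) : k) *: gammaI (mulH (h6 ⊗ g5) ⊗ f4))
    * gammaI (h7 ⊗ g6) * act (h8 ⊗ act (g7 ⊗ c')) * act (h9 ⊗ b') * a'))))))))))))))))).
Proof.
rewrite PhiE.
(* Bracketed to the right, the word can be evaluated from its left end, one letter at a time. *)
have -> : PhiW omU b b' c c' = (q1 ▷ cst HHH b) ⋆ ((q1 ▷ q2 ▷ cst HHH c) ⋆ ((q1 ▷ G q2 q3)
  ⋆ (G q1 (q2 ⊙ q3) ⋆ ((sca B ∘ (phi ∘ cpair (cpair q1 q2) q3)) ⋆ (GI (q1 ⊙ q2) q3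
  ⋆ (GI q1 q2 ⋆ ((q1 ▷ q2 ▷ cst HHH c') ⋆ (q1 ▷ cst HHH b')))))))).
  rewrite /PhiW /omU omE (act_conv (x := q1) (u := cst HHH b)); [|by cm..].
  rewrite (act_conv (x := q1) (u := q2 ▷ cst HHH c')); [|by cm..].
  by rewrite !convA.
have hp := cpt_prl HH H.
have e2 z : q1 ▷ q2 ▷ cst HHH z = (p1 ▷ p2 ▷ cst HH z) ∘ prl HH H.
  by rewrite !(op2_pull _ _ _ hp) (cptC1 z hp).
have v2 z x y : (p1 ▷ p2 ▷ cst HH z) (x ⊗ y) = act (x ⊗ act (y ⊗ z)).
  by rewrite (act_cst p2) (idE p1) ev2.
(* The last three letters do not see f; as a pullback from [HH] they create no further Sweedler
   factor of it, whence only four. *)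
have -> : GI q1 q2 ⋆ ((q1 ▷ q2 ▷ cst HHH c') ⋆ (q1 ▷ cst HHH b'))
  = (GI p1 p2 ⋆ ((p1 ▷ p2 ▷ cst HH c') ⋆ (p1 ▷ cst HH b'))) ∘ prl HH H.
  by rewrite !(op2_pull _ _ _ hp) !(cptC1 _ hp).
rewrite e2 (act_cst q1).
transitivity (S2 h (fun h1 h => S2 h (fun h2 h => S2 g (fun g1 g =>
  S2 h (fun h3 h => S2 g (fun g2 g => S2 f (fun f1 f =>
  S2 h (fun h4 h => S2 g (fun g3 g => S2 f (fun f2 f =>
  S2 h (fun h5 h => S2 g (fun g4 g => S2 f (fun f3 f4 =>
  S2 h (fun h6 h => S2 g (fun g5 g => S2 h (fun h7 h => S2 g (fun g6 g7 => S2 h (fun h8 h9 =>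
    a * act (h1 ⊗ b) * act (h2 ⊗ act (g1 ⊗ c)) * act (h3 ⊗ gamma (g2 ⊗ f1))
    * gamma (h4 ⊗ mulH (g3 ⊗ f2)) * ((phi (h5 ⊗ g4 ⊗ f3) : k) *: gammaI (mulH (h6 ⊗ g5) ⊗ f4))
    * gammaI (h7 ⊗ g6) * act (h8 ⊗ act (g7 ⊗ c')) * act (h9 ⊗ b') * a')))))))))))))))))).
  rewrite op2_tens3_prlll S2_mull S2_mulr; apply: S2_ext => x1 y1.
  rewrite mulBE op2_tens3_prll S2_mull S2_mull S2_mulr; apply: S2_ext => x2 y2.
  rewrite S2_mull S2_mull S2_mulr; apply: S2_ext => g1 g2.
  rewrite mulBE v2 op2_tens3 !S2_mull S2_mulr; apply: S2_ext => x3 y3.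
  rewrite !S2_mull S2_mulr; apply: S2_ext => g3 g4.
  rewrite !S2_mull S2_mulr; apply: S2_ext => f1 f2.
  rewrite mulBE ev3r op2_tens3 !S2_mull S2_mulr; apply: S2_ext => x4 y4.
  rewrite !S2_mull S2_mulr; apply: S2_ext => g5 g6.
  rewrite !S2_mull S2_mulr; apply: S2_ext => f3 f4.
  rewrite mulBE ev3r op2_tens3 !S2_mull S2_mulr; apply: S2_ext => x5 y5.
  rewrite !S2_mull S2_mulr; apply: S2_ext => g7 g8.
  rewrite !S2_mull S2_mulr; apply: S2_ext => f5 f6.
  rewrite mulBE (lcompE (sca B)) ev3_id scaE op2_tens3_prlr !S2_mull S2_mulr; apply: S2_ext => x6 y6.
  rewrite !S2_mull S2_mulr; apply: S2_ext => g9 g10.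
  rewrite mulBE ev3l op2_tens !S2_mull S2_mulr; apply: S2_ext => x7 y7.
  rewrite !S2_mull S2_mulr; apply: S2_ext => g11 g12.
  rewrite mulBE ev2_id (act_cst p1) op2_tens_prlr !S2_mull S2_mulr; apply: S2_ext => x8 y8.
  rewrite mulBE v2 -!scalerAl mul1r -!scalerAr -!scalerAl !mulrA.
  by [].
s2match.
by [].
Qed.
End Mul.

(** * The bialgebroid *)

(** The relations of the balanced cube are indexed by all of [Be B]; additivity reduces them to the
    pure elements of [Phi_rac1]. *)
Lemma Phi_racBe1 om0 X (a : Be B) Y Z : Phi om0 (rac (X ⊗ a) ⊗ Y ⊗ Z) = Phi om0 (X ⊗ lac (a ⊗ Y) ⊗ Z).
Proof.
move: a; apply: tens_ind => [x y hx hy|b c]; last exact: Phi_rac1.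
rewrite (Tensor.pureDr X x y) (Tensor.pureDl x y Y) !linearD /=.
by rewrite !(Tensor.pureDl, Tensor.pureDr) !linearD /= hx hy.
Qed.

Lemma Phi_racBe2 om0 X (a : Be B) Y Z : Phi om0 (X ⊗ rac (Y ⊗ a) ⊗ Z) = Phi om0 (X ⊗ Y ⊗ lac (a ⊗ Z)).
Proof.
move: a; apply: tens_ind => [x y hx hy|b c]; last exact: Phi_rac2.
rewrite (Tensor.pureDr Y x y) (Tensor.pureDl x y Z) !linearD /=.
by rewrite !(Tensor.pureDl, Tensor.pureDr) !linearD /= hx hy.
Qed.

Lemma cube_lift (V : lmodType k) (F : L -> L -> L -> V) : trilin F ->
  (forall a X Y Z, F (rac (X ⊗ a)) Y Z = F X (lac (a ⊗ Y)) Z) ->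
  (forall a X Y Z, F X (rac (Y ⊗ a)) Z = F X Y (lac (a ⊗ Z))) ->
  exists g : {linear cube lac rac -> V}, forall X Y Z, g (cub lac rac X Y Z) = F X Y Z.
Proof.
case/tens_lift3=> f fE c1 c2.
have f0 z : cube_rel lac rac z -> f z = 0.
  by case=> a X Y Z; rewrite linearB !fE ?c1 ?c2 subrr.
exists (mklin (f := qlift f) (qlift_linear f0)) => X Y Z.
exact: etrans (qliftE f0 _) (fE X Y Z).
Qed.

Lemma PhiC_ex om0 : exists g : {linear cube lac rac -> B}, forall X Y Z,
  g (cub lac rac X Y Z) = Phi om0 (X ⊗ Y ⊗ Z).
Proof.
apply: (cube_lift (F := fun X Y Z => Phi om0 (X ⊗ Y ⊗ Z))); first lin.
  by move=> *; apply: Phi_racBe1.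
by move=> *; apply: Phi_racBe2.
Qed.
Definition PhiC om0 := projT1 (cid (PhiC_ex om0)).
Lemma PhiCE om0 X Y Z : PhiC om0 (cub lac rac X Y Z) = Phi om0 (X ⊗ Y ⊗ Z).
Proof. by rewrite /PhiC; case: cid. Qed.

Definition sL : {linear B -> L} := mklin (f := fun b => b ⊗ oneH ⊗ 1) ltac:(lin).
Definition tL : {linear B -> L} := mklin (f := fun b => 1 ⊗ oneH ⊗ b) ltac:(lin).
Lemma sLE b : sL b = b ⊗ oneH ⊗ 1. Proof. by []. Qed.
Lemma tLE b : tL b = 1 ⊗ oneH ⊗ b. Proof. by []. Qed.

Lemma PhiC_linear om0 : left_linear (PhiC om0).
Proof. by move=> b c X Y Z; rewrite !PhiCE Phi_lact. Qed.

Opaque PhiC sL tL.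

Lemma conv_inverse_L : conv_inverse DeltaL epsL mul (PhiC omU) (PhiC omUI).
Proof.
move=> R HR X Y Z; split.
  (* The convolution product is [Phi] of the convolved middle letters, and Omega with its inverse
     yields the trivial letter. *)
  rewrite -Phi_unit -omUK -(Phi_conv_sig HR).
  by apply: eq_bigr => p _; apply: eq_bigr => q _; apply: eq_bigr => r _; rewrite !PhiCE.
rewrite -Phi_unit -omUIK -(Phi_conv_sig HR).
by apply: eq_bigr => p _; apply: eq_bigr => q _; apply: eq_bigr => r _; rewrite !PhiCE.
Qed.

Lemma cocycle_L : is_normalised_cocycle DeltaL epsL mul Lone (PhiC omU).
Proof.
split.
- exact: PhiC_linear.
- exact: epsL_assoc.
- exists (PhiC omUI); split; first exact: PhiC_linear.
  exact: conv_inverse_L.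
- move=> X Y; rewrite !PhiCE; split; [exact: Phi_one1|exact: Phi_one2|exact: Phi_one3].
- by move=> X Y Z b; rewrite !PhiCE Phi_right.
- move=> R HR X Y Z W; apply: etrans (etrans _ (Phi_cocycle_sig HR X Y Z W)) _.
    apply: eq_bigr => p _; apply: eq_bigr => q _; apply: eq_bigr => r _; apply: eq_bigr => s _.
    by rewrite !PhiCE.
  apply: eq_bigr => p _; apply: eq_bigr => q _; apply: eq_bigr => q' _.
  apply: eq_bigr => r _; apply: eq_bigr => r' _; apply: eq_bigr => s _.
  by rewrite !PhiCE /cocR bLE.
move=> R HR X Y Z; apply: etrans (etrans _ (Phi_assoc_sig HR X Y Z)) _.
  by apply: eq_bigr => p _; apply: eq_bigr => q _; apply: eq_bigr => r _; rewrite !PhiCE.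
by apply: eq_bigr => p _; apply: eq_bigr => q _; apply: eq_bigr => r _; rewrite !PhiCE.
Qed.

Lemma bialgebroid_L : is_left_coquasi_bialgebroid DeltaL epsL mul Lone sL tL (PhiC omU).
Proof.
split.
- by split; [exact: mul_one1|exact: mul_oner].
- split=> [|b c]; first by rewrite sLE.
  by rewrite !sLE mul_s lactE mulr1.
- split=> [|b c]; first by rewrite tLE.
  by rewrite !tLE mul_s lactE mulr1.
- by move=> b c; rewrite sLE tLE !mul_s !lactE !mulr1 !mul1r.
- by move=> b X; rewrite sLE tLE !mul_s -!racE.
- exact: coalgebroid_L.
- exact: Delta_one.
- by move=> R HR X Y; rewrite (Delta_mul HR).
- by rewrite epsL_one mulr1.
- by move=> X Y; rewrite epsL_racl epsL_racr.
- exact: cocycle_L.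
Qed.
Lemma bialgebroid_ex :
  exists (mu : {linear (B ⨂ H ⨂ B) ⨂ (B ⨂ H ⨂ B) -> B ⨂ H ⨂ B})
    (s t : {linear B -> B ⨂ H ⨂ B})
    (ll : {linear Be B ⨂ (B ⨂ H ⨂ B) -> B ⨂ H ⨂ B})
    (rr : {linear (B ⨂ H ⨂ B) ⨂ Be B -> B ⨂ H ⨂ B})
    (Delta : {linear B ⨂ H ⨂ B -> diamond ll ll})
    (eps : {linear B ⨂ H ⨂ B -> B})
    (PP : {linear cube ll rr -> B}),
    (forall b : B, s b = b ⊗ oneH ⊗ 1)
    /\ (forall b : B, t b = 1 ⊗ oneH ⊗ b)
    /\ (forall (b b' : B) (h : tw_C T),
          Delta (b ⊗ h ⊗ b') =
          sweedler (cop (cdelta H)) 2 h (fun h1 h2 =>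
            dia ll ll (b ⊗ h1 ⊗ 1) (1 ⊗ h2 ⊗ b')))
    /\ (forall (b b' : B) (h : tw_C T), eps (b ⊗ h ⊗ b') = (ceps H h : k) *: (b * b'))
    /\ (forall (a a' b b' : B) (h g : H),
          mu ((a ⊗ h ⊗ a') ⊗ (b ⊗ g ⊗ b')) =
          sweedler (cop (cdelta H)) 5 h (fun h1 h2 h3 h4 h5 =>
          sweedler (cop (cdelta H)) 3 g (fun g1 g2 g3 =>
            (a * act (h1 ⊗ b) * gamma (h2 ⊗ g1))
            ⊗ mulH (h3 ⊗ g2)
            ⊗ (gammaI (h4 ⊗ g3) * act (h5 ⊗ b') * a'))))
    /\ (forall (a a' b b' c c' : B) (h g f : H),
          PP (cub ll rr (a ⊗ h ⊗ a') (b ⊗ g ⊗ b') (c ⊗ f ⊗ c')) =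
          sweedler (cop (cdelta H)) 9 h (fun h1 h2 h3 h4 h5 h6 h7 h8 h9 =>
          sweedler (cop (cdelta H)) 7 g (fun g1 g2 g3 g4 g5 g6 g7 =>
          sweedler (cop (cdelta H)) 4 f (fun f1 f2 f3 f4 =>
            a * act (h1 ⊗ b)
            * act (h2 ⊗ act (g1 ⊗ c))
            * act (h3 ⊗ gamma (g2 ⊗ f1))
            * gamma (h4 ⊗ mulH (g3 ⊗ f2))
            * (phi (h5 ⊗ g4 ⊗ f3) *: gammaI (mulH (h6 ⊗ g5) ⊗ f4))
            * gammaI (h7 ⊗ g6)
            * act (h8 ⊗ act (g7 ⊗ c'))
            * act (h9 ⊗ b') * a'))))
    /\ is_left_coquasi_bialgebroid Delta eps mu (1 ⊗ oneH ⊗ 1) s t PP.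
Proof.
exists mul, sL, tL, lac, rac, DeltaL, epsL, (PhiC omU).
split; first exact: sLE.
split; first exact: tLE.
split; first by move=> b b' h; exact: DeltaLE.
split; first by move=> b b' h; exact: epsLE.
split; first by move=> a a' b b' h g; exact: Lmul_sum.
split; last exact: bialgebroid_L.
move=> a a' b b' c c' h g f; apply: etrans (PhiCE _ _ _ _) _.
exact: Phi_sum.
Qed.
End Twisted.

Theorem theorem3p3 (k : fieldType) (B : algType k)
  (H : lmodType k) (DeltaH : {linear H -> H ⨂ H}) (epsH : {linear H -> k^o})
  (mulH : {linear H ⨂ H -> H}) (oneH : H) (phi : {linear H ⨂ H ⨂ H -> k^o})
  (H_coquasi : is_coquasi_bialgebra DeltaH epsH mulH oneH phi)
  (act : {linear H ⨂ B -> B}) (act_measuring : is_measuring DeltaH epsH act)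
  (gamma gammaI : {linear H ⨂ H -> B})
  (gamma_unit : gamma_unital epsH oneH gamma)
  (gamma_inv : conv_inv2 DeltaH epsH gamma gammaI)
  (act_gamma : forall (h g : H) (b : B),
    act (h ⊗ act (g ⊗ b)) =
    sweedler (cop DeltaH) 3 h (fun h1 h2 h3 =>
    sweedler (cop DeltaH) 3 g (fun g1 g2 g3 =>
      gamma (h1 ⊗ g1) * act (mulH (h2 ⊗ g2) ⊗ b) * gammaI (h3 ⊗ g3))))
  (act_oneH : forall b : B, act (oneH ⊗ b) = b) :
  exists (mul : {linear (B ⨂ H ⨂ B) ⨂ (B ⨂ H ⨂ B) -> B ⨂ H ⨂ B})
    (s t : {linear B -> B ⨂ H ⨂ B})
    (l : {linear Be B ⨂ (B ⨂ H ⨂ B) -> B ⨂ H ⨂ B})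
    (r : {linear (B ⨂ H ⨂ B) ⨂ Be B -> B ⨂ H ⨂ B})
    (Delta : {linear B ⨂ H ⨂ B -> diamond l l})
    (eps : {linear B ⨂ H ⨂ B -> B})
    (Phi : {linear cube l r -> B}),
    (forall b : B, s b = b ⊗ oneH ⊗ 1)
    /\ (forall b : B, t b = 1 ⊗ oneH ⊗ b)
    /\ (forall (b b' : B) (h : H),
          Delta (b ⊗ h ⊗ b') =
          sweedler (cop DeltaH) 2 h (fun h1 h2 =>
            dia l l (b ⊗ h1 ⊗ 1) (1 ⊗ h2 ⊗ b')))
    /\ (forall (b b' : B) (h : H), eps (b ⊗ h ⊗ b') = epsH h *: (b * b'))
    /\ (forall (a a' b b' : B) (h g : H),
          mul ((a ⊗ h ⊗ a') ⊗ (b ⊗ g ⊗ b')) =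
          sweedler (cop DeltaH) 5 h (fun h1 h2 h3 h4 h5 =>
          sweedler (cop DeltaH) 3 g (fun g1 g2 g3 =>
            (a * act (h1 ⊗ b) * gamma (h2 ⊗ g1))
            ⊗ mulH (h3 ⊗ g2)
            ⊗ (gammaI (h4 ⊗ g3) * act (h5 ⊗ b') * a'))))
    /\ (forall (a a' b b' c c' : B) (h g f : H),
          Phi (cub l r (a ⊗ h ⊗ a') (b ⊗ g ⊗ b') (c ⊗ f ⊗ c')) =
          sweedler (cop DeltaH) 9 h (fun h1 h2 h3 h4 h5 h6 h7 h8 h9 =>
          sweedler (cop DeltaH) 7 g (fun g1 g2 g3 g4 g5 g6 g7 =>
          sweedler (cop DeltaH) 4 f (fun f1 f2 f3 f4 =>
            a * act (h1 ⊗ b)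
            * act (h2 ⊗ act (g1 ⊗ c))
            * act (h3 ⊗ gamma (g2 ⊗ f1))
            * gamma (h4 ⊗ mulH (g3 ⊗ f2))
            * (phi (h5 ⊗ g4 ⊗ f3) *: gammaI (mulH (h6 ⊗ g5) ⊗ f4))
            * gammaI (h7 ⊗ g6)
            * act (h8 ⊗ act (g7 ⊗ c'))
            * act (h9 ⊗ b') * a'))))
    /\ is_left_coquasi_bialgebroid Delta eps mul (1 ⊗ oneH ⊗ 1) s t Phi.
Proof.
(* The hypotheses are packed into one structure; once its projections are unfolded, the two
   statements agree by conversion. *)
have := bialgebroid_ex (@Twisted k B (Coalg (cq_coalgebra H_coquasi)) mulH oneH phi H_coquasi
  act act_measuring gamma gammaI gamma_unit gamma_inv act_gamma act_oneH).
cbv beta iota delta [tw_C tw_mul tw_one tw_phi tw_act tw_gamma tw_gammaI car cdelta ceps].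
exact (fun x => x).
Qed.
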